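(* Let $\varepsilon\ge 0$ and define $$\rho=\max\left(\frac{2+\gamma+2(\gamma+1)\varepsilon}{2\gamma+1},\ \frac{1+2\gamma+4\gamma\varepsilon}{4\gamma-2}\right).$$ There exist $E_0$ and $C$ such that any Dirichlet eigenfunction $u$ of $\Omega$ with energy $E\in\mathcal{Z}_\varepsilon$ such that $E>E_0$ satisfies $$\|u\|_{L^2(\Omega)}\le C\,E^{\rho}\,\|u\|_{L^2(W)}.$$
   Context: Fix constants $B_0,B_1,L_0>0$ and a function $L$ on $[-B_0,B_1]$ such that: $L(x)=L_0$ for $x\le 0$; on $(0,B_1)$, $L$ is smooth, non-negative and non-increasing; $L'(x)$ has a negative limit (finite or $-\infty$) as $x\to B_1$; and as $x\to 0^+$, $L(x)=L_0-c_Lx^{\gamma}+o(x^{\gamma})$ and $L'(x)=-c_L\gamma x^{\gamma-1}+o(x^{\gamma-1})$ for some $c_L>0$ and $\gamma\ge 3/2$. The billiard is $\Omega=\{(x,y): -B_0\le x\le B_1,\ 0\le y\le L(x)\}$, with $R=[-B_0,0]\times[0,L_0]$ and $W=\Omega\setminus R$. A Dirichlet eigenfunction of energy $E$ is a nonzero $u\in H^1_0(\Omega)$ with $-(\partial_x^2+\partial_y^2)u=Eu$ in $\Omega$. With $\mathbb{N}=\{1,2,3,\dots\}$, the non-resonant set is $$\mathcal{Z}_\varepsilon=\left\{E>0:\ \left|E-\frac{k^2\pi^2}{L_0^2}-\frac{l^2\pi^2}{B_0^2}\right|\ge c_0E^{-\varepsilon}\ \text{ for all } k,l\in\mathbb{N}\right\},$$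 where $c_0>0$ is a fixed constant, chosen so that $\mathcal{Z}_0$ is non-empty. *)

(* Defs.v *)
From HB Require Import structures.
From mathcomp Require Import all_boot all_order all_algebra.
From mathcomp Require Import complex.
From mathcomp Require Import all_classical all_reals all_analysis.

Set Implicit Arguments.
Unset Strict Implicit.
Unset Printing Implicit Defensive.

Import Order.TTheory GRing.Theory Num.Theory.
Import numFieldNormedType.Exports.

Local Open Scope classical_set_scope.
Local Open Scope ring_scope.

(** * The billiard table *)

Section Billiard.
Context {R : realType}.

(* [L] is a total function, but only its values on [[-B0, B1]] are constrained
   or used. Derivatives are only taken on the open interval [(0, B1)], where
   they depend on the values of [L] in [(0, B1)] alone. No condition is put on
   the value [L B1]. *)
Record billiard_profile (B0 B1 L0 cL gamma : R) (L : R -> R) : Prop := BilliardProfile {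
  profile_B0_gt0 : 0 < B0 ;
  profile_B1_gt0 : 0 < B1 ;
  profile_L0_gt0 : 0 < L0 ;
  profile_cL_gt0 : 0 < cL ;
  profile_gamma : 3 / 2 <= gamma ;
  profile_flat : forall x, - B0 <= x <= 0 -> L x = L0 ;
  profile_smooth : forall n x, 0 < x < B1 -> derivable (derive1n n L) x 1 ;
  profile_ge0 : forall x, 0 < x < B1 -> 0 <= L x ;
  profile_noninc : forall x y, 0 < x -> x <= y -> y < B1 -> L y <= L x ;
  profile_end : exists2 l : \bar R,
    (l < 0)%E & (derive1 L x)%:E @[x --> B1^'-] --> l ;
  profile_expansion :
    (fun x => L x - (L0 - cL * x `^ gamma)) =o_ (0^'+) (fun x => x `^ gamma) ;
  profile_expansion' :
    (fun x => derive1 L x + cL * gamma * x `^ (gamma - 1))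
      =o_ (0^'+) (fun x => x `^ (gamma - 1))
}.

Definition billiard (B0 B1 : R) (L : R -> R) : set (R * R) :=
  [set z | (- B0 <= z.1 <= B1) /\ (0 <= z.2 <= L z.1)].

Definition rectangle (B0 L0 : R) : set (R * R) :=
  [set z | (- B0 <= z.1 <= 0) /\ (0 <= z.2 <= L0)].

Definition wing (B0 B1 L0 : R) (L : R -> R) : set (R * R) :=
  billiard B0 B1 L `\` rectangle B0 L0.

End Billiard.

(** * Test functions, [L^2] and [H^1_0] *)

Section Sobolev.
Context {R : realType}.
Implicit Types (D : set (R * R)) (f g phi : R * R -> R).

Definition lebesgue2 := (@lebesgue_measure R \x @lebesgue_measure R)%E.

Definition dirx : R * R := (1, 0).
Definition diry : R * R := (0, 1).

Fixpoint is_Ck (n : nat) phi : Prop :=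
  if n is m.+1 then
    [/\ continuous phi, forall z, derivable phi z dirx,
        forall z, derivable phi z diry, is_Ck m ('D_dirx phi) & is_Ck m ('D_diry phi)]
  else continuous phi.

(* Smooth functions on the plane with compact support inside the interior
   of [D]. *)
Definition test_function D phi : Prop :=
  [/\ forall n, is_Ck n phi,
      compact (closure [set z | phi z != 0]) &
      closure [set z | phi z != 0] `<=` interior D].

Definition laplacian phi : R * R -> R :=
  fun z => 'D_dirx ('D_dirx phi) z + 'D_diry ('D_diry phi) z.

Definition L2norm D f : \bar R :=
  ('N[lebesgue2]_2%:E [EFin \o (f \_ D)])%E.

(* [L^2] classes are handled through Borel representatives; the values of [f]
   outside [D] are irrelevant. [measurableTypeR R] is [R] with the Borel
   sigma-algebra on which [lebesgue_measure] is declared. *)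
Definition in_L2 D f : Prop :=
  measurable_fun (T := (measurableTypeR R * measurableTypeR R)%type) D f /\
  (L2norm D f < +oo)%E.

Definition weak_derivative D (e : R * R) f g : Prop :=
  forall phi, test_function D phi ->
    \int[lebesgue2]_(z in D) (f z * 'D_e phi z) =
      - (\int[lebesgue2]_(z in D) (g z * phi z)).

(* Closure of the test functions in [H^1]; [g1, g2] is the weak gradient. *)
Definition in_H10 D f : Prop :=
  in_L2 D f /\
  exists g1 g2 : R * R -> R,
    [/\ in_L2 D g1 /\ weak_derivative D dirx f g1,
        in_L2 D g2 /\ weak_derivative D diry f g2 &
        forall eta : R, 0 < eta -> exists2 phi, test_function D phi &
          [/\ (L2norm D (f \- phi)%R < eta%:E)%E,
              (L2norm D (g1 \- 'D_dirx phi)%R < eta%:E)%E &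
              (L2norm D (g2 \- 'D_diry phi)%R < eta%:E)%E]].

(* [- (d_x^2 + d_y^2) f = E f] in the sense of distributions on the interior
   of [D]. *)
Definition helmholtz D (E : R) f : Prop :=
  forall phi, test_function D phi ->
    - (\int[lebesgue2]_(z in D) (f z * laplacian phi z)) =
      E * (\int[lebesgue2]_(z in D) (f z * phi z)).

Definition Re_fun (u : R * R -> R[i]) : R * R -> R := fun z => complex.Re (u z).
Definition Im_fun (u : R * R -> R[i]) : R * R -> R := fun z => complex.Im (u z).

Definition L2normC D (u : R * R -> R[i]) : \bar R :=
  L2norm D (fun z => ComplexField.Normc.normc (u z)).

(* Eigenfunctions are complex valued; as [E] and the Laplacian are real, the
   conditions are imposed on the real and imaginary parts. A real-valued
   eigenfunction is the case of a vanishing imaginary part. *)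
Record dirichlet_eigenfunction D (E : R) (u : R * R -> R[i]) : Prop :=
  DirichletEigenfunction {
    eigen_H10 : in_H10 D (Re_fun u) /\ in_H10 D (Im_fun u) ;
    eigen_eq : helmholtz D E (Re_fun u) /\ helmholtz D E (Im_fun u) ;
    eigen_neq0 : ~ {ae lebesgue2, forall z, D z -> u z = 0}
  }.

End Sobolev.

Section Resonance.
Context {R : realType}.

Definition nonresonant (B0 L0 c0 eps : R) : set R :=
  [set E | 0 < E /\ forall k l : nat, (0 < k)%N -> (0 < l)%N ->
     c0 * E `^ (- eps) <=
       `|E - k%:R ^+ 2 * pi ^+ 2 / L0 ^+ 2 - l%:R ^+ 2 * pi ^+ 2 / B0 ^+ 2|].

Definition rho (gamma eps : R) : R :=
  Num.max ((2 + gamma + 2 * (gamma + 1) * eps) / (2 * gamma + 1))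
          ((1 + 2 * gamma + 4 * gamma * eps) / (4 * gamma - 2)).

End Resonance.

(* Main.v *)
(* Only the first entry of the maximum in [rho] is needed. Let [f] be the real or
   the imaginary part of the eigenfunction and let [f_k(x)] be its sine
   coefficients on the vertical slices of the rectangle. There
   [f_k'' + m_k f_k = 0] with [m_k = E - k^2 pi^2 / L0^2] and [f_k(- B0) = 0], so
   a second sine expansion, in [x], expresses the mass of [f_k] through the trace
   [f_k(0)], with the factor [sum_l lam_l^2 / (m_k - lam_l^2)^2],
   [lam_l = l pi / B0]. This factor is bounded if [m_k <= 0], and nonresonance
   bounds it by [C E^(1 + 2 eps)] if [m_k > 0].

   The traces with [m_k <= 0] are controlled by the trace of [f] on [x = 0],
   hence by [|f|_W |f_x|]. If [m_k > 0], testing the equation on the window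
   [0 < x < delta] of the wing against [w(x) sin(k pi y / L(x))], where
   [w = (sin (om x) / om) (1 - x / delta)^2] and [om^2 = m_k], expresses [f_k(0)]
   through data in the wing. Bessel's inequality in [y] then gives
   [sum_k f_k(0)^2 <= C delta^-1 |f|_W^2 + C E delta^(2 gamma + 1) |f_x|^2], and
   [delta^(2 gamma + 1) = c E^(-3 - 2 eps)] lets the last term be absorbed.

   As [f] is only in [H^1_0], all of this is carried out for a test function
   close to [f], up to errors that vanish in the limit for fixed [E]. Finitely
   many modes suffice because the defect in Parseval's identity is controlled by
   the [H^1] norm. *)

Require Import Defs.
From mathcomp Require Import all_boot all_order all_algebra.
From mathcomp Require Import complex.
From mathcomp Require Import ring lra.
From mathcomp Require Import all_classical all_reals all_analysis measurable_realfun.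

Set Implicit Arguments.
Unset Strict Implicit.
Unset Printing Implicit Defensive.

Import Order.TTheory GRing.Theory Num.Theory.
Import numFieldNormedType.Exports.

Local Open Scope classical_set_scope.
Local Open Scope ring_scope.

(** * Calculus on the line *)

(** An eigenfunction is known only in [H^1_0], so neither pointwise values on [x = 0] nor a normal
    derivative on the curved boundary are at hand. The equation is used in weak form only, against
    products [b x * S (y / l x)]. As [S] vanishes at 0 and 1, these vanish on the boundary without
    straightening it; the price is terms in [l'], small near the junction because [l'] is of order
    [x^(gamma - 1)]. Such products are not compactly supported in the table; cutting them off is
    harmless precisely because [b] and [S] vanish at their ends.

    A constant [CE] multiplies [eta ^ 2] and may depend on [E] in any way, since [eta] tends to 0 at
    fixed [E]. It must not depend on the approximating test function, so the number of modes has to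
    be fixed beforehand.

    The exponents: the factor [E^(1 + 2 eps)] of the rectangle multiplies
    [E delta^(2 gamma + 1) |f_x|^2], and [|f_x|^2] is of order [E |f|^2]; absorption forces
    [delta^(2 gamma + 1)] down to [E^(- 3 - 2 eps)]. The loss that remains is
    [E^(1 + 2 eps) / delta], of order [E^(2 rho1)]. *)

Section ContinuousArith.
Context {R : realType} {T : topologicalType}.
Implicit Types f g : T -> R.

Lemma cont_cst (k : R) : continuous (fun _ : T => k).
Proof. by move=> x; exact: cvg_cst. Qed.

Lemma contD f g : continuous f -> continuous g -> continuous (fun x => f x + g x).
Proof. by move=> cf cg x; apply: cvgD; [exact: cf|exact: cg]. Qed.

Lemma contN f : continuous f -> continuous (fun x => - f x).
Proof. by move=> cf x; apply: cvgN; exact: cf. Qed.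

Lemma contM f g : continuous f -> continuous g -> continuous (fun x => f x * g x).
Proof. by move=> cf cg x; apply: cvgM; [exact: cf|exact: cg]. Qed.

Lemma contX f n : continuous f -> continuous (fun x => f x ^+ n).
Proof.
move=> cf; elim: n => [|n IH]; first exact: cont_cst.
by under eq_fun do rewrite exprS; exact: contM.
Qed.

Lemma cont_norm f : continuous f -> continuous (fun x => `|f x|).
Proof. by move=> cf x; apply: cvg_norm; exact: cf. Qed.

Lemma cont_sum (I : Type) (r : seq I) (P : pred I) (F : I -> T -> R) :
  (forall i, continuous (F i)) -> continuous (fun x => \sum_(i <- r | P i) F i x).
Proof.
move=> cF; elim: r => [|i r IH].
  by under eq_fun do rewrite big_nil; exact: cont_cst.
case: (boolP (P i)) => [|/negbTE] Pi; under eq_fun do rewrite big_cons Pi; last by [].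
by apply: contD.
Qed.

Lemma cont_comp (g : R -> R) f : continuous g -> continuous f ->
  continuous (fun x => g (f x)).
Proof. by move=> cg cf x; apply: (continuous_comp (cf x)); exact: cg. Qed.

Lemma contV f : continuous f -> (forall x, f x != 0) -> continuous (fun x => (f x)^-1).
Proof. by move=> cf f0 x; apply: cvgV; [exact: f0|exact: cf]. Qed.

End ContinuousArith.

(** Descent on the syntax of the function. The leaves are closed by continuity facts in the context,
    which is why proofs introduce such facts just before calling [cont]. *)
Ltac cont_rec := first
  [ solve [match goal with
    | |- continuous (fun x => (@?f x + @?g x)) => apply: (@contD _ _ f g); cont_rec
    | |- continuous (fun x => - (@?f x)) => apply: (@contN _ _ f); cont_rec
    | |- continuous (fun x => (@?f x * @?g x)) => apply: (@contM _ _ f g); cont_rec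
    | |- continuous (fun x => (@?f x ^+ ?n)) => apply: (@contX _ _ f n); cont_rec
    | |- continuous (fun x => `|@?f x|) => apply: (@cont_norm _ _ f); cont_rec
    | |- continuous (fun _ => ?k) => exact: cont_cst
    | |- continuous (fun x => x) => let z := fresh in move=> z; exact: cvg_id
    | |- continuous (fun x => sin (@?f x)) =>
        apply: (@cont_comp _ _ sin f (@continuous_sin _)); cont_rec
    | |- continuous (fun x => cos (@?f x)) =>
        apply: (@cont_comp _ _ cos f (@continuous_cos _)); cont_rec
    end]
  | assumption
  | match goal with H : forall i, continuous _ |- continuous _ => exact: H end ].

Ltac cont := try cont_rec.

Section PointwiseDerivative.
Context {R : realType}.
Implicit Types (f g : R -> R) (x : R).

Lemma derM f g x df dg : is_derive x 1 f df -> is_derive x 1 g dg ->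
  is_derive x 1 (fun x => f x * g x) (df * g x + f x * dg).
Proof.
move=> Hf Hg; have := is_deriveM Hf Hg; rewrite /GRing.scale/=.
by rewrite [g x * df]mulrC addrC.
Qed.

Lemma derD f g x df dg : is_derive x 1 f df -> is_derive x 1 g dg ->
  is_derive x 1 (fun x => f x + g x) (df + dg).
Proof. by move=> Hf Hg; exact: (is_deriveD Hf Hg). Qed.

Lemma derN f x df : is_derive x 1 f df -> is_derive x 1 (fun x => - f x) (- df).
Proof. by move=> Hf; exact: (is_deriveN Hf). Qed.

Lemma derC (k x : R) : is_derive x 1 (fun _ : R => k) 0.
Proof. exact: is_derive_cst. Qed.

Lemma derI x : is_derive x 1 (fun t : R => t) 1.
Proof. exact: is_derive_id. Qed.

Lemma derZ k f x df : is_derive x 1 f df -> is_derive x 1 (fun x => k * f x) (k * df).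
Proof. by move=> Hf; have := derM (derC k x) Hf; rewrite mul0r add0r. Qed.

Lemma derComp f g x dg df : is_derive x 1 g dg -> is_derive (g x) 1 f df ->
  is_derive x 1 (fun x => f (g x)) (df * dg).
Proof. by move=> Hg Hf; have := is_derive1_comp (f := f) (g := g); apply. Qed.

Lemma derV f x df : is_derive x 1 f df -> f x != 0 ->
  is_derive x 1 (fun x => (f x)^-1) (- (df / f x ^+ 2)).
Proof.
move=> Hf f0; have := is_deriveV f0 Hf; rewrite /GRing.scale/= => H.
by apply: is_derive_eq; rewrite mulNr mulrC.
Qed.

Lemma derX2 f x df : is_derive x 1 f df -> is_derive x 1 (fun x => f x ^+ 2) (2 * f x * df).
Proof.
move=> Hf; have := derM Hf Hf; congr is_derive; last by ring.
Qed.

Lemma der_cont (f df : R -> R) : (forall x, is_derive x 1 f (df x)) -> continuous f.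
Proof. by move=> dF x; apply/differentiable_continuous/derivable1_diffP. Qed.

End PointwiseDerivative.

Section IntervalIntegral.
Context {R : realType}.
Implicit Types (a b c x y : R) (f g F G : R -> R).

(** Not oriented: for [b < a] the segment is empty and the value is 0. Hence the condition [a <= b]
    in the fundamental theorem and the ordering in the splitting rule. *)
Definition integ a b f : R := \int[lebesgue_measure]_(x in `[a, b]) f x.

Lemma continuous_integrable a b f : continuous f ->
  (@lebesgue_measure R).-integrable `[a, b] (EFin \o f).
Proof.
move=> cf; apply: continuous_compact_integrable; first exact: segment_compact.
exact: continuous_subspaceT.
Qed.

Lemma eq_integ a b f g : (forall x, a <= x <= b -> f x = g x) ->
  integ a b f = integ a b g.
Proof.
move=> fg; apply: eq_Rintegral => x; rewrite inE/= in_itv/= => xab; exact: fg.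
Qed.

Lemma integD a b f g : continuous f -> continuous g ->
  integ a b (fun x => f x + g x) = integ a b f + integ a b g.
Proof. by move=> cf cg; rewrite /integ RintegralD//; exact: continuous_integrable. Qed.

Lemma integZ a b k f : continuous f ->
  integ a b (fun x => k * f x) = k * integ a b f.
Proof. by move=> cf; rewrite /integ RintegralZl//; exact: continuous_integrable. Qed.

Lemma integB a b f g : continuous f -> continuous g ->
  integ a b (fun x => f x - g x) = integ a b f - integ a b g.
Proof. by move=> cf cg; rewrite /integ RintegralB//; exact: continuous_integrable. Qed.

Lemma integN a b f : continuous f -> integ a b (fun x => - f x) = - integ a b f.
Proof.
move=> cf; rewrite -mulN1r -integZ//; apply: eq_integ => x _; by rewrite mulN1r.
Qed.

Lemma integ0 a b : integ a b (fun _ => 0) = 0.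
Proof. by rewrite /integ /Rintegral integral0. Qed.

Lemma integ_cst a b k : a <= b -> integ a b (fun _ => k) = k * (b - a).
Proof.
rewrite /integ Rintegral_cst//= lebesgue_measure_itv/= lte_fin.
by rewrite le_eqVlt => /orP[/eqP ->|->]; rewrite ?ltxx ?subrr.
Qed.

Lemma le_integ a b f g : continuous f -> continuous g ->
  (forall x, a <= x <= b -> f x <= g x) -> integ a b f <= integ a b g.
Proof.
move=> cf cg fg; apply: le_Rintegral => //; try exact: continuous_integrable.
Qed.

Lemma integ_ge0 a b f : (forall x, a <= x <= b -> 0 <= f x) -> 0 <= integ a b f.
Proof.
by move=> f0; apply: Rintegral_ge0 => x /=; rewrite in_itv/= => /f0.
Qed.

Lemma le_norm_integ a b f : continuous f ->
  `|integ a b f| <= integ a b (fun x => `|f x|).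
Proof. by move=> cf; apply: le_normr_Rintegral => //; exact: continuous_integrable. Qed.

Lemma integ_norm_le a b f k : continuous f -> a <= b ->
  (forall x, a <= x <= b -> `|f x| <= k) -> `|integ a b f| <= k * (b - a).
Proof.
move=> cf ab fk; apply: le_trans (le_norm_integ _ _ cf) _.
rewrite -integ_cst//; apply: le_integ => //; cont.
Qed.

Lemma integ_sum a b (I : Type) (r : seq I) (P : pred I) (F : I -> R -> R) :
  (forall i, continuous (F i)) ->
  integ a b (fun x => \sum_(i <- r | P i) F i x) =
  \sum_(i <- r | P i) integ a b (F i).
Proof.
move=> cF; elim: r => [|i r IH].
  by rewrite big_nil -[RHS](integ0 a b); apply: eq_integ => x _; rewrite big_nil.
rewrite big_cons; case: ifPn => Pi.
  rewrite -IH -integD//; first by apply: eq_integ => x _; rewrite big_cons Pi.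
  exact: cont_sum.
by rewrite -IH; apply: eq_integ => x _; rewrite big_cons (negbTE Pi).
Qed.

Lemma integ_split a c b f : continuous f -> a <= c <= b ->
  integ a b f = integ a c f + integ c b f.
Proof.
move=> cf /andP[ac cb].
rewrite /integ -[X in _ = _ + X]Rintegral_itv_obnd_cbnd; last first.
  apply: integrableS (continuous_integrable c b cf) => //.
  by apply: subset_itvr; rewrite bnd_simp.
rewrite -Rintegral_setU//=.
- by rewrite -itv_bndbnd_setU// bnd_simp.
- rewrite -itv_bndbnd_setU ?bnd_simp//; exact: continuous_integrable.
- apply/disj_setPS => x [] /=; rewrite !in_itv/= => /andP[_ xc] /andP[cx _].
  by move: (lt_le_trans cx xc); rewrite ltxx.
Qed.

Lemma integ_FTC a b f F : a <= b -> continuous f ->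
  (forall x, is_derive x 1 F (f x)) -> integ a b f = F b - F a.
Proof.
rewrite le_eqVlt => /orP[/eqP <- cf dF|ab cf dF].
  by rewrite subrr /integ set_itv1 Rintegral_set1.
have cF : continuous F by move=> x; apply/differentiable_continuous/derivable1_diffP.
rewrite /integ /Rintegral (continuous_FTC2 ab (F := F))//=.
- exact: continuous_subspaceT.
- split; [by move=> x _ | exact: cvg_at_right_filter (cF a)|
          exact: cvg_at_left_filter (cF b)].
- by move=> x _; rewrite derive1E derive_val.
Qed.

Lemma integ_by_parts a b F G f g : a <= b -> continuous f -> continuous g ->
  (forall x, is_derive x 1 F (f x)) -> (forall x, is_derive x 1 G (g x)) ->
  integ a b (fun x => F x * g x) =
  F b * G b - F a * G a - integ a b (fun x => f x * G x).
Proof.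
move=> ab cf cg dF dG.
have cF := der_cont dF; have cG := der_cont dG.
have dFG x : is_derive x 1 (fun x => F x * G x) (f x * G x + F x * g x) by exact: derM.
have <- := @integ_FTC a b (fun x => f x * G x + F x * g x) _ ab _ dFG; last by cont.
by rewrite integD ?addKr//; [rewrite addrC addKr|cont..].
Qed.

Lemma integ_CauchySchwarz a b f g : continuous f -> continuous g ->
  integ a b (fun x => f x * g x) ^+ 2 <=
  integ a b (fun x => f x ^+ 2) * integ a b (fun x => g x ^+ 2).
Proof.
move=> cf cg.
set A := integ a b _; set B := integ a b _; set C := integ a b _.
have B0 : 0 <= B by apply: integ_ge0 => x _; exact: sqr_ge0.
have C0 : 0 <= C by apply: integ_ge0 => x _; exact: sqr_ge0.
have key t : 0 <= B + 2 * t * A + t ^+ 2 * C.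
  have -> : B + 2 * t * A + t ^+ 2 * C = integ a b (fun x => (f x + t * g x) ^+ 2).
    rewrite /A /B /C -!integZ -?integD; cont.
    by apply: eq_integ => x _; ring.
  by apply: integ_ge0 => x _; exact: sqr_ge0.
have [C00|Cn0] := eqVneq C 0.
  have [-> | An0] := eqVneq A 0; first by rewrite expr0n mulr_ge0.
  (* With [C = 0] the quadratic is affine in [t], and this value of [t] makes it equal to -1. *)
  have := key (- (B + 1) / (2 * A)); rewrite C00 mulr0 addr0.
  have -> : 2 * (- (B + 1) / (2 * A)) * A = - (B + 1) by field.
  lra.
have := key (- A / C).
have -> : B + 2 * (- A / C) * A + (- A / C) ^+ 2 * C = (B * C - A ^+ 2) / C by field.
by rewrite pmulr_lge0 ?invr_gt0 ?lt0r ?Cn0// subr_ge0.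
Qed.

End IntervalIntegral.

(** * Integrals depending on a parameter *)

Section ParameterIntegral.
Context {R : realType}.
Implicit Types (a b c d x y : R) (F : R * R -> R).

Lemma cont_fst : continuous (fun z : R * R => z.1).
Proof. by move=> z; exact: cvg_fst. Qed.

Lemma cont_snd : continuous (fun z : R * R => z.2).
Proof. by move=> z; exact: cvg_snd. Qed.

Lemma cont_pair (T : topologicalType) (f g : T -> R) :
  continuous f -> continuous g -> continuous (fun t => (f t, g t)).
Proof. by move=> cf cg t; exact: (cvg_pair (cf t) (cg t)). Qed.

Lemma cont_pair1 F y : continuous F -> continuous (fun x => F (x, y)).
Proof.
move=> cF x; apply: (@continuous_comp _ _ _ (fun x => (x, y)) F); last exact: cF.
by apply: cont_pair; [move=> ?; exact: cvg_id | exact: cont_cst].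
Qed.

Lemma cont_pair2 F x : continuous F -> continuous (fun y => F (x, y)).
Proof.
move=> cF y; apply: (@continuous_comp _ _ _ (fun y => (x, y)) F); last exact: cF.
by apply: cont_pair; [exact: cont_cst | move=> ?; exact: cvg_id].
Qed.

Lemma cont_swap F : continuous F -> continuous (fun z => F (z.2, z.1)).
Proof.
move=> cF z; apply: (@continuous_comp _ _ _ (fun z : R * R => (z.2, z.1)) F); last exact: cF.
by apply: cont_pair; [exact: cont_snd|exact: cont_fst].
Qed.

Lemma rect_bounded F a b c d : continuous F ->
  exists M : R, forall x y, a <= x <= b -> c <= y <= d -> `|F (x, y)| <= M.
Proof.
move=> cF.
have cK : compact (`[a, b]%classic `*` `[c, d]%classic : set (R * R)).
  by apply: compact_setX; exact: segment_compact.
have cA : compact (F @` (`[a, b]%classic `*` `[c, d]%classic)).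
  by apply: continuous_compact => //; exact: continuous_subspaceT.
have [M [_ /(_ (M + 1))]] := compact_bounded cA.
rewrite ltrDl ltr01 => /(_ isT) HM; exists (M + 1) => x y xab ycd.
by apply: HM; exists (x, y) => //; split; rewrite /= in_itv/=.
Qed.

(** Dominated convergence; the dominating constant is a bound of [F] on the compact rectangle over
    [[x - 1, x + 1]], which is enough because continuity at [x] is local. *)
Lemma integ_param_continuous F c d : continuous F ->
  continuous (fun x => integ c d (fun y => F (x, y))).
Proof.
move=> cF x.
have [M HM] := rect_bounded (x - 1) (x + 1) c d cF.
apply: (@continuity_under_integral R _ _ lebesgue_measure (fun x y => F (x, y)) `[c, d]
  _ (x - 1) (x + 1) _ _ (fun _ => M)) => //.
- by move=> x' _; apply: continuous_integrable; exact: cont_pair2.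
- apply: aeW => y _; apply: in1W => x'.
  by move=> A HA; exact: (@cont_pair1 F y cF x' A HA).
- by apply: continuous_integrable; exact: cont_cst.
- move=> x'; rewrite /= in_itv/= => /andP[x1 x2]; apply: aeW => y.
  by rewrite /= in_itv/=; apply: HM; rewrite !ltW.
- by rewrite inE/= in_itv/=; lra.
Qed.

Lemma integ_param_derive F Fx c d : continuous F -> continuous Fx ->
  (forall x y, is_derive x 1 (fun t => F (t, y)) (Fx (x, y))) ->
  forall x, is_derive x 1 (fun x => integ c d (fun y => F (x, y)))
    (integ c d (fun y => Fx (x, y))).
Proof.
move=> cF cFx dF x.
have [M HM] := rect_bounded (x - 1) (x + 1) c d cFx.
have d1 x' y : partial1of2 (fun x y => F (x, y)) x' y = Fx (x', y).
  by rewrite partial1of2E derive_val.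
have I1 x' : (@lebesgue_measure R).-integrable `[c, d] (EFin \o (fun y => F (x', y))).
  by apply: continuous_integrable; exact: cont_pair2.
have Ix : `](x - 1), (x + 1)[%classic x by rewrite /= in_itv/=; lra.
have HM' x' y : `](x - 1), (x + 1)[%classic x' -> `[c, d]%classic y ->
    `|partial1of2 (fun x y => F (x, y)) x' y| <= `|M|.
  rewrite /= !in_itv/= d1 => /andP[x1 x2] yy.
  by apply: le_trans (HM _ _ _ yy) (ler_norm _); rewrite !ltW.
have IM : (@lebesgue_measure R).-integrable `[c, d] (EFin \o (fun _ : R => `|M|)).
  by apply: continuous_integrable; exact: cont_cst.
have mcd : measurable (`[c, d]%classic : set R) by [].
have dv x' y : `](x - 1), (x + 1)[%classic x' -> `[c, d]%classic y ->
  derivable (fun x => F (x, y)) x' 1 by [].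
have D1 := @derivable_under_integral R _ _ lebesgue_measure (fun x y => F (x, y)) _ mcd _ _ _ Ix (fun x' _ => I1 x') dv
  (fun _ => `|M|) (fun _ => normr_ge0 M) IM HM'.
have D2 := @differentiation_under_integral R _ _ lebesgue_measure (fun x y => F (x, y)) _ mcd _ _ _ Ix (fun x' _ => I1 x') dv
  (fun _ => `|M|) (fun _ => normr_ge0 M) IM HM'.
apply: DeriveDef; first exact: D1.
rewrite -derive1E D2; apply: eq_Rintegral => y _; exact: d1.
Qed.

End ParameterIntegral.

(** * Integrals over rectangles *)

Section PlaneIntegral.
Context {R : realType}.
Implicit Types (F : R * R -> R) (a b c d x y : R).
Notation mR := (measurableTypeR R).
Notation leb := (@lebesgue_measure R).

(** Measurable sets are those of the product of two Borel sigma-algebras, and second countability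
    links them to the topology: [U] is the union of the boxes with rational centre and radius
    [1 / (n + 1)] that it contains. Boxes not contained in [U] are replaced by the empty set, so
    that the index type stays countable. *)
Lemma open_measurable_plane (U : set (R * R)) : open U ->
  measurable (U : set (mR * mR)%type).
Proof.
move=> oU.
pose B (p : rat * rat * nat) : set (mR * mR) :=
  ball (ratr p.1.1 : R) (p.2.+1%:R^-1) `*` ball (ratr p.1.2 : R) (p.2.+1%:R^-1).
have mB p : measurable (B p).
  by apply: measurableX; apply: measurable_realfun.open_measurable; exact: ball_open.
have -> : U = \bigcup_p (if `[< B p `<=` U >] then B p else set0).
  apply/seteqP; split => [[x y] Uxy|z [p _]]; last first.
    by case: asboolP => // + Bz; apply.
  have [e /= e0 Ue] := (nbhs_ballP (x, y) U).1 (open_nbhs_nbhs (conj oU Uxy)).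
  have [n n2e] : exists n : nat, n.+1%:R^-1 < e / 2.
    have e20 : 0 < e / 2 by lra.
    have /cvgr0Pnorm_lt : n.+1%:R^-1 @[n --> \oo] --> (0 : R) by exact: cvg_harmonic.
    move=> /(_ _ e20) [n _ Hn]; exists n; have := Hn n (leqnn n).
    by rewrite /= ger0_norm.
  have n0 : 0 < n.+1%:R^-1 :> R by rewrite invr_gt0.
  have rx (t : R) : exists q : rat, ball (ratr q : R) n.+1%:R^-1 t.
    have [|q] := @rat_in_itvoo R (t - n.+1%:R^-1) (t + n.+1%:R^-1).
      by rewrite ltrBlDr -addrA ltrDl addr_gt0.
    rewrite in_itv/= => /andP[q1 q2]; exists q; rewrite /ball/= ltr_norml.
    by rewrite ltrBrDl q1 ltrBlDl q2.
  have [q1 Hq1] := rx x; have [q2 Hq2] := rx y.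
  exists (q1, q2, n) => //=.
  case: asboolP => [_|[]]; first by split.
  move=> [x' y'] [/= B1 B2]; apply: Ue; split => /=.
    exact: ball_splitr (le_ball (ltW n2e) Hq1) (le_ball (ltW n2e) B1).
  exact: ball_splitr (le_ball (ltW n2e) Hq2) (le_ball (ltW n2e) B2).
apply: countable_bigcupT_measurable; first exact: countableP.
move=> p; by case: ifPn.
Qed.

Lemma continuous_measurable_plane F : continuous F ->
  measurable_fun (T := (mR * mR)%type) setT F.
Proof.
move=> cF; apply: (measurability _ (measurable_realfun.RGenOInfty.measurableE R)) => //.
move=> _ [_ [t ->] <-]; rewrite setTI; apply: open_measurable_plane.
by apply: open_comp => // z _; exact: cF.
Qed.

Lemma rect_measurable a b c d :
  measurable (`[a, b]%classic `*` `[c, d]%classic : set (mR * mR)%type).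
Proof. exact: measurableX. Qed.

Lemma rect_integrable F a b c d : continuous F ->
  (@lebesgue2 R).-integrable (`[a, b]%classic `*` `[c, d]%classic) (EFin \o F).
Proof.
move=> cF; apply: measurable_bounded_integrable.
- exact: rect_measurable.
- have := product_measure1E leb leb (measurable_itv `[a, b]) (measurable_itv `[c, d]).
  rewrite /lebesgue2/= => ->; rewrite !lebesgue_measure_itv/=.
  by case: ifPn; case: ifPn; rewrite ?mule0 ?mul0e// -?EFinB -?EFinM ltry.
- by apply: measurable_funTS; exact: continuous_measurable_plane.
- have [M HM] := rect_bounded a b c d cF.
  exists `|M|; split => // t Mt [x y] [/=]; rewrite !in_itv/= => xab ycd.
  by apply: le_trans (HM _ _ xab ycd) _; apply: le_trans (ler_norm _) (ltW _).
Qed.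

(** Fubini is applied on the whole plane, to the function extended by 0 outside the rectangle; this
    is how that extension looks on a slice. *)
Lemma rect_restrict F a b c d x y :
  (F \_ (`[a, b]%classic `*` `[c, d]%classic)) (x, y) =
  ((fun x => (F \o pair x) \_ `[c, d]%classic y) \_ `[a, b]%classic) x.
Proof.
rewrite !patchE; case: ifPn => H; case: ifPn => H1 //=; last 1 first.
- case: ifPn => // H2; exfalso; move/negP: H; apply; rewrite !inE in H1 H2 *; split => //.
- case: ifPn => // /negP[]; move: H; rewrite !inE => -[/= _ H]; exact: H.
- by exfalso; move/negP: H1; apply; move: H; rewrite !inE => -[].
Qed.

Lemma integral_rect F a b c d : continuous F ->
  \int[lebesgue2]_(z in `[a, b]%classic `*` `[c, d]%classic) F z =
  integ a b (fun x => integ c d (fun y => F (x, y))).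
Proof.
move=> cF; rewrite Rintegral_mkcond /Rintegral.
have iF := rect_integrable a b c d cF.
rewrite -integral12_prod_meas1; last first.
  move/(integrable_mkcond _ (rect_measurable a b c d)): iF.
  by rewrite restrict_EFin.
rewrite {1}/integ /Rintegral.
congr fine; rewrite [RHS]integral_mkcond; apply: eq_integral => x _.
rewrite /fubini_F/= restrict_EFin/= patchE; case: ifPn => xab.
  rewrite /integ /Rintegral fineK; last first.
    have := continuous_integrable c d (@cont_pair2 _ F x cF).
    by move/integral_fune_fin_num; apply.
  rewrite [RHS]integral_mkcond; apply: eq_integral => y _.
  by rewrite restrict_EFin/= rect_restrict patchE xab.
apply: integral0_eq => y _; rewrite rect_restrict patchE.
by rewrite (negbTE xab).
Qed.

Lemma integral_rect_swap F a b c d : continuous F ->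
  \int[lebesgue2]_(z in `[a, b]%classic `*` `[c, d]%classic) F z =
  integ c d (fun y => integ a b (fun x => F (x, y))).
Proof.
move=> cF; rewrite Rintegral_mkcond /Rintegral.
have iF := rect_integrable a b c d cF.
rewrite -integral21_prod_meas1; last first.
  move/(integrable_mkcond _ (rect_measurable a b c d)): iF.
  by rewrite restrict_EFin.
rewrite {1}/integ /Rintegral.
congr fine; rewrite [RHS]integral_mkcond; apply: eq_integral => y _.
rewrite /fubini_G/= restrict_EFin/= patchE; case: ifPn => ycd.
  rewrite /integ /Rintegral fineK; last first.
    have := continuous_integrable a b (@cont_pair1 _ F y cF).
    by move/integral_fune_fin_num; apply.
  rewrite [RHS]integral_mkcond; apply: eq_integral => x _.
  rewrite restrict_EFin/= rect_restrict !patchE; case: ifP => //=.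
  by rewrite ycd.
apply: integral0_eq => x _; rewrite rect_restrict !patchE; case: ifP => //=.
by rewrite (negbTE ycd).
Qed.

Lemma integ_Fubini F a b c d : continuous F ->
  integ a b (fun x => integ c d (fun y => F (x, y))) =
  integ c d (fun y => integ a b (fun x => F (x, y))).
Proof. by move=> cF; rewrite -integral_rect// integral_rect_swap. Qed.

End PlaneIntegral.

(** * Smooth functions on the line *)

Section SmoothReal.
Context {R : realType}.
Implicit Types (f g : R -> R) (n : nat) (x : R).

Fixpoint Ck n f : Prop :=
  if n is m.+1 then (forall x, derivable f x 1) /\ Ck m (derive1 f) else continuous f.

Lemma derivable_is_derive f x : derivable f x 1 -> is_derive x 1 f (derive1 f x).
Proof. by move=> df; rewrite derive1E; apply: DeriveDef. Qed.

Lemma is_derive_derive1 f x df : is_derive x 1 f df -> derive1 f x = df.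
Proof. by move=> ?; rewrite derive1E derive_val. Qed.

Lemma Ck_continuous n f : Ck n f -> continuous f.
Proof.
case: n => [//|n] [df _]; apply: (@der_cont _ f (derive1 f)) => x.
exact: derivable_is_derive.
Qed.

Lemma CkW n f : Ck n.+1 f -> Ck n f.
Proof.
elim: n f => [|n IH] f; first by move=> cf; apply: (Ck_continuous cf).
by case=> df cf; split => //; exact: IH.
Qed.

Lemma Ck_is_derive n f df : (forall x, is_derive x 1 f (df x)) -> Ck n df -> Ck n.+1 f.
Proof.
move=> fdf cdf; split; first by move=> x; exact: (@ex_derive _ _ _ _ _ _ _ (fdf x)).
by rewrite (_ : derive1 f = df)//; apply/funext => x; exact: is_derive_derive1.
Qed.

Lemma CkSP n f : Ck n.+1 f -> forall x, is_derive x 1 f (derive1 f x).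
Proof. by move=> [df _] x; exact: derivable_is_derive. Qed.

Lemma Ck_cst n (k : R) : Ck n (fun _ => k).
Proof.
elim: n k => [|n IH] k; first exact: cont_cst.
by apply: (@Ck_is_derive _ _ (fun _ => 0)) => // x; exact: derC.
Qed.

Lemma Ck_id n : Ck n (fun x => x).
Proof.
case: n => [|n]; first by move=> x; exact: cvg_id.
by apply: (@Ck_is_derive _ _ (fun _ => 1)); exact: Ck_cst.
Qed.

Lemma CkD n f g : Ck n f -> Ck n g -> Ck n (fun x => f x + g x).
Proof.
elim: n f g => [|n IH] f g; first exact: contD.
move=> cf cg; notypeclasses refine (@Ck_is_derive _ _ (fun x => derive1 f x + derive1 g x) _ _).
  by move=> x; apply: derD; [exact: (CkSP cf)|exact: (CkSP cg)].
by apply: IH; [case: cf|case: cg].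
Qed.

Lemma CkM n f g : Ck n f -> Ck n g -> Ck n (fun x => f x * g x).
Proof.
elim: n f g => [|n IH] f g; first exact: contM.
move=> cf cg; notypeclasses refine (@Ck_is_derive _ _ (fun x => derive1 f x * g x + f x * derive1 g x) _ _).
  by move=> x; apply: derM; [exact: (CkSP cf)|exact: (CkSP cg)].
by apply: CkD; apply: IH; do ?[exact: CkW]; [case: cf|case: cg].
Qed.

Lemma CkN n f : Ck n f -> Ck n (fun x => - f x).
Proof.
move=> cf; have := CkM (Ck_cst n (-1)) cf.
by under eq_fun do rewrite mulN1r.
Qed.

Lemma Ck_comp n f g : Ck n f -> Ck n g -> Ck n (fun x => f (g x)).
Proof.
elim: n f g => [|n IH] f g; first exact: cont_comp.
move=> cf cg; notypeclasses refine (@Ck_is_derive _ _ (fun x => derive1 f (g x) * derive1 g x) _ _).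
  by move=> x; apply: derComp; [exact: (CkSP cg)|exact: (CkSP cf)].
by apply: CkM; [apply: IH; [case: cf|exact: CkW]|case: cg].
Qed.

Lemma CkV n f : Ck n f -> (forall x, f x != 0) -> Ck n (fun x => (f x)^-1).
Proof.
elim: n f => [|n IH] f; first exact: contV.
move=> cf f0.
notypeclasses refine (@Ck_is_derive _ _ (fun x => - (derive1 f x * ((f x)^-1 * (f x)^-1))) _ _).
  move=> x; have := derV (CkSP cf x) (f0 x).
  by rewrite -[(f x ^+ 2)^-1]exprVn expr2.
apply: CkN; apply: CkM; first by case: cf.
by have IHf := IH _ (CkW cf) f0; exact: CkM.
Qed.

Lemma Ck_trig n : Ck n (@sin R) /\ Ck n (@cos R).
Proof.
elim: n => [|n [IHs IHc]]; first by split; [exact: continuous_sin|exact: continuous_cos].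
split; first by apply: Ck_is_derive IHc => x; exact: is_derive_sin.
by apply: (@Ck_is_derive _ _ (fun x => - sin x)); exact: CkN.
Qed.

Lemma Ck_affine n (a b : R) : Ck n (fun x => a * x + b).
Proof. by apply: CkD; [apply: CkM; [exact: Ck_cst|exact: Ck_id]|exact: Ck_cst]. Qed.

Lemma Ck_sin n f : Ck n f -> Ck n (fun x => sin (f x)).
Proof. by move=> cf; apply: Ck_comp => //; case: (Ck_trig n). Qed.

(** The functions [p(1/x) e^(-1/x)] extended by 0 to [x <= 0]. Carrying the polynomial along makes
    the family closed under differentiation, so that a single induction gives smoothness at every
    order. *)
Definition flat_exp (p : {poly R}) x : R :=
  if 0 < x then p.[x^-1] * expR (- x^-1) else 0.

Lemma flat_exp_bounded p : exists C, forall x, `|flat_exp p x| <= C.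
Proof.
suff [C HC] : exists C, forall t, 0 < t -> `|p.[t] * expR (- t)| <= C.
  exists `|C| => x; rewrite /flat_exp; case: ifPn => x0; last by rewrite normr0.
  by apply: le_trans (ler_norm C); apply: HC; rewrite invr_gt0.
(* Coefficient by coefficient, from [t^i <= i! e^t] for [t > 0]. *)
exists (\sum_(i < size p) `|p`_i| * i`!%:R) => t t0.
rewrite horner_coef mulr_suml; apply: le_trans (ler_norm_sum _ _ _) _.
apply: ler_sum => i _; rewrite normrM normrM -mulrA.
apply: ler_wpM2l => //.
rewrite normrX (gtr0_norm t0) (ger0_norm (expR_ge0 _)) expRN ler_pdivrMr ?expR_gt0//.
have f0 : 0 < i`!%:R :> R by rewrite ltr0n fact_gt0.
rewrite mulrC -ler_pdivrMr//.
case: (nat_of_ord i) => [|j].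
  by rewrite expr0 fact0 divr1 -expR0 ler_expR ltW.
by apply: le_trans (expR_ge1Dxn j (ltW t0)); rewrite lerDr.
Qed.

Lemma flat_exp_der p x : is_derive x 1 (flat_exp p) (flat_exp ('X^2 * (p - p^`())) x).
Proof.
have [x0|x0|->] := ltgtP x 0.
- rewrite {2}/flat_exp ltNge (ltW x0)/=.
  apply: (near_eq_is_derive (f := fun _ => 0)).
  near=> t; rewrite /flat_exp ifF//; apply/negbTE; rewrite -leNgt.
  by apply: ltW; near: t; exact: lt_nbhsl.
- rewrite {2}/flat_exp x0.
  apply: (near_eq_is_derive (f := fun t : R => p.[t^-1] * expR (- t^-1) : R)).
    near=> t; rewrite /flat_exp ifT//.
    by near: t; exact: lt_nbhsr.
  have xn0 : x != 0 by rewrite gt_eqF.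
  have dV : is_derive x 1 (fun t : R => t^-1) (- (1 / x ^+ 2)) := derV (derI x) xn0.
  have d1 : is_derive x 1 (fun t => p.[t^-1]) (p^`().[x^-1] * - (1 / x ^+ 2)).
    apply: (derComp (f := horner p) dV); exact: is_derive_poly.
  have d2 : is_derive x 1 (fun t => expR (- t^-1)) (expR (- x^-1) * - - (1 / x ^+ 2)).
    by apply: (derComp (f := @expR R) (derN dV)).
  apply: is_derive_eq (derM d1 d2) _.
  rewrite hornerM hornerXn hornerD hornerN exprVn; field; exact: xn0.
(* Boundedness for the polynomial ['X^2 * p] says that [flat_exp p] is [O(t^2)] at 0, so its
   derivative there is 0. *)
- have [C HC] := flat_exp_bounded ('X^2 * p).
  have F0 q : flat_exp q 0 = 0 by rewrite /flat_exp ltxx.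
  rewrite F0.
  have FC t : `|flat_exp p t| <= C * t ^+ 2.
    have [t0|t0] := ltP 0 t; last first.
      rewrite /flat_exp ltNge t0/= normr0 mulr_ge0 ?sqr_ge0//.
      exact: le_trans (HC 0).
    have := HC t; rewrite /flat_exp t0 hornerM hornerXn.
    rewrite -mulrA normrM exprVn normfV (ger0_norm (sqr_ge0 t)).
    by rewrite mulrC ler_pdivrMr ?exprn_gt0.
  have C0 : 0 <= C by exact: le_trans (HC 0).
  have lim : h^-1 *: (flat_exp p (h *: 1 + 0) - flat_exp p 0) @[h --> 0^'] --> (0 : R).
    apply/cvgrPdist_le => e e0; near=> h.
    rewrite sub0r normrN F0 subr0 addr0 /GRing.scale/= mulr1 normrM.
    have hn0 : h != 0 by near: h; exact: nbhs_dnbhs_neq.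
    have hC : `|h| * (C + 1) <= e.
      rewrite -ler_pdivlMr; last by rewrite ltr_wpDl.
      near: h; apply: dnbhs0_le; rewrite divr_gt0// ltr_wpDl//.
    apply: le_trans hC; rewrite normfV ler_pdivrMl ?normr_gt0//.
    apply: le_trans (FC h) _; rewrite -[h ^+ 2]ger0_norm ?sqr_ge0// normrX.
    rewrite expr2 mulrA [in leRHS]mulrCA mulrA [in leRHS]mulrC.
    have : 0 <= `|h| * `|h| by rewrite mulr_ge0.
    nra.
  apply: DeriveDef; first by apply/cvg_ex; exists 0.
  by apply/cvg_lim.
Unshelve. all: by end_near.
Qed.

Lemma flat_exp_Ck n p : Ck n (flat_exp p).
Proof.
elim: n p => [|n IH] p; last exact: Ck_is_derive (flat_exp_der p) (IH _).
exact: der_cont (flat_exp_der p).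
Qed.

(** A smooth transition from 0 to 1 across [[0, 1]]. The denominator never vanishes because [x] and
    [1 - x] are not both non-positive. *)
Definition step x : R := flat_exp 1 x / (flat_exp 1 x + flat_exp 1 (1 - x)).

Lemma flat_exp1_ge0 x : 0 <= flat_exp 1 x.
Proof. by rewrite /flat_exp; case: ifPn => // _; rewrite hornerE mul1r expR_ge0. Qed.

Lemma flat_exp1_gt0 x : 0 < x -> 0 < flat_exp 1 x.
Proof. by move=> x0; rewrite /flat_exp x0 hornerE mul1r expR_gt0. Qed.

Lemma step_den_gt0 x : 0 < flat_exp 1 x + flat_exp 1 (1 - x).
Proof.
have [x0|x0] := ltP 0 x.
  by rewrite ltr_pwDl ?flat_exp1_gt0 ?flat_exp1_ge0.
by rewrite ltr_wpDl ?flat_exp1_ge0// flat_exp1_gt0//; lra.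
Qed.

Lemma step_Ck n : Ck n step.
Proof.
apply: CkM; first exact: flat_exp_Ck.
apply: CkV; last by move=> x; rewrite gt_eqF// step_den_gt0.
apply: CkD; first exact: flat_exp_Ck.
apply: Ck_comp; first exact: flat_exp_Ck.
by apply: CkD; [exact: Ck_cst|apply: CkN; exact: Ck_id].
Qed.

Lemma step_ge0_le1 x : 0 <= step x <= 1.
Proof.
have d0 := step_den_gt0 x.
rewrite /step divr_ge0 ?flat_exp1_ge0 ?(ltW d0)//=.
by rewrite ler_pdivrMr// mul1r lerDl flat_exp1_ge0.
Qed.

Lemma step0 x : x <= 0 -> step x = 0.
Proof. by move=> x0; rewrite /step {1}/flat_exp ltNge x0/= mul0r. Qed.

Lemma step1 x : 1 <= x -> step x = 1.
Proof.
move=> x1; rewrite /step [flat_exp 1 (1 - x)]/flat_exp ifF.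
  by rewrite addr0 divff// gt_eqF// flat_exp1_gt0//; lra.
by apply/negbTE; rewrite -leNgt; lra.
Qed.

Lemma step_der_bounded : exists2 M, 0 <= M & forall x, `|derive1 step x| <= M.
Proof.
have c' : continuous (derive1 step) by have [_] := step_Ck 1.
have := @segment_compact R 0 1.
have cA := continuous_compact (continuous_subspaceT c') (@segment_compact R 0 1).
have [M [_ /(_ (M + 1))]] := compact_bounded cA.
rewrite ltrDl ltr01 => /(_ isT) HM _.
have H0 : 0 <= M + 1.
  by apply: le_trans (normr_ge0 _) (HM (derive1 step 0) _); exists 0 => //; rewrite /= in_itv/= lexx ler01.
exists (M + 1) => // x.
have [x0|x0] := ltP x 0.
  suff H : is_derive x 1 step 0 by rewrite (is_derive_derive1 H) normr0.
  apply: (near_eq_is_derive (f := fun _ => 0)).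
  near=> t; rewrite step0//; apply: ltW; near: t; exact: lt_nbhsl.
have [x1|x1] := ltP 1 x.
  suff H : is_derive x 1 step 0 by rewrite (is_derive_derive1 H) normr0.
  apply: (near_eq_is_derive (f := fun _ : R => 1 : R)).
  near=> t; rewrite step1//; apply: ltW; near: t; exact: lt_nbhsr.
by apply: HM; exists x => //; rewrite /= in_itv/= x0.
Unshelve. all: by end_near.
Qed.

End SmoothReal.

(** * Smooth functions on the plane *)

Section SmoothPlane.
Context {R : realType}.
Implicit Types (F G : R * R -> R) (f : R -> R) (n : nat) (x y : R).

Lemma is_derive_dirx F x y d :
  is_derive (x, y) dirx F d <-> is_derive x 1 (fun t => F (t, y)) d.
Proof.
have E : (fun h : R => h^-1 *: ((F \o shift (x, y)) (h *: dirx) - F (x, y))) =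
    (fun h : R => h^-1 *: (((fun t => F (t, y)) \o shift x) (h *: (1 : R)) - F (x, y))).
  apply/funext => h; congr (_ *: (F _ - _)); congr pair => /=.
  by rewrite scaler0 add0r.
split=> -[]; rewrite /derivable/derive => H1 H2; apply: DeriveDef.
- by rewrite /derivable -E.
- by rewrite /derive -E.
- by rewrite /derivable E.
- by rewrite /derive E.
Qed.

Lemma is_derive_diry F x y d :
  is_derive (x, y) diry F d <-> is_derive y 1 (fun t => F (x, t)) d.
Proof.
have E : (fun h : R => h^-1 *: ((F \o shift (x, y)) (h *: diry) - F (x, y))) =
    (fun h : R => h^-1 *: (((fun t => F (x, t)) \o shift y) (h *: (1 : R)) - F (x, y))).
  apply/funext => h; congr (_ *: (F _ - _)); congr pair => /=.
  by rewrite scaler0 add0r.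
split=> -[]; rewrite /derivable/derive => H1 H2; apply: DeriveDef.
- by rewrite /derivable -E.
- by rewrite /derive -E.
- by rewrite /derivable E.
- by rewrite /derive E.
Qed.

Lemma is_Ck_derx n F : is_Ck n.+1 F ->
  forall x y, is_derive x 1 (fun t => F (t, y)) ('D_dirx F (x, y)).
Proof. by move=> [_ dF _ _ _] x y; apply/is_derive_dirx; exact: DeriveDef. Qed.

Lemma is_Ck_dery n F : is_Ck n.+1 F ->
  forall x y, is_derive y 1 (fun t => F (x, t)) ('D_diry F (x, y)).
Proof. by move=> [_ _ dF _ _] x y; apply/is_derive_diry; exact: DeriveDef. Qed.

Lemma is_Ck_cont n F : is_Ck n F -> continuous F.
Proof. by case: n => [//|n] []. Qed.

Lemma is_Ck_intro n F Fx Fy : continuous F ->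
  (forall x y, is_derive x 1 (fun t => F (t, y)) (Fx (x, y))) ->
  (forall x y, is_derive y 1 (fun t => F (x, t)) (Fy (x, y))) ->
  is_Ck n Fx -> is_Ck n Fy -> is_Ck n.+1 F.
Proof.
move=> cF dx dy cx cy.
have dx' z : is_derive z dirx F (Fx z) by case: z => x y; apply/is_derive_dirx.
have dy' z : is_derive z diry F (Fy z) by case: z => x y; apply/is_derive_diry.
have -> : is_Ck n.+1 F = [/\ continuous F, forall z, derivable F z dirx,
        forall z, derivable F z diry, is_Ck n ('D_dirx F) & is_Ck n ('D_diry F)].
  by [].
have -> : 'D_dirx F = Fx by apply/funext => z; rewrite derive_val.
have -> : 'D_diry F = Fy by apply/funext => z; rewrite derive_val.
by split.
Qed.

Lemma is_CkW n F : is_Ck n.+1 F -> is_Ck n F.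
Proof.
elim: n F => [|n IH] F; first by case.
by case=> cF dx dy cx cy; exact: (And5 cF dx dy (IH _ cx) (IH _ cy)).
Qed.

Lemma is_Ck_cst n (k : R) : is_Ck n (fun _ => k).
Proof.
elim: n k => [|n IH] k; first exact: cont_cst.
notypeclasses refine (@is_Ck_intro n _ (fun _ => 0) (fun _ => 0) _ _ _ (IH 0) (IH 0)).
- exact: cont_cst.
- by move=> x y; exact: derC.
- by move=> x y; exact: derC.
Qed.

Lemma is_Ck_fst n : is_Ck n (fun z : R * R => z.1).
Proof.
case: n => [|n]; first exact: cont_fst.
notypeclasses refine (@is_Ck_intro n _ (fun _ => 1) (fun _ => 0) _ _ _
  (is_Ck_cst n 1) (is_Ck_cst n 0)).
- exact: cont_fst.
- by move=> x y; exact: derI.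
- by move=> x y; exact: derC.
Qed.

Lemma is_Ck_snd n : is_Ck n (fun z : R * R => z.2).
Proof.
case: n => [|n]; first exact: cont_snd.
notypeclasses refine (@is_Ck_intro n _ (fun _ => 0) (fun _ => 1) _ _ _
  (is_Ck_cst n 0) (is_Ck_cst n 1)).
- exact: cont_snd.
- by move=> x y; exact: derC.
- by move=> x y; exact: derI.
Qed.

Lemma is_CkD n F G : is_Ck n F -> is_Ck n G -> is_Ck n (fun z => F z + G z).
Proof.
elim: n F G => [|n IH] F G; first exact: contD.
move=> cF cG.
notypeclasses refine (@is_Ck_intro n _ (fun z => 'D_dirx F z + 'D_dirx G z)
  (fun z => 'D_diry F z + 'D_diry G z) _ _ _ _ _).
- by apply: contD; [exact: (is_Ck_cont cF)|exact: (is_Ck_cont cG)].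
- by move=> x y; apply: derD; [exact: (is_Ck_derx cF)|exact: (is_Ck_derx cG)].
- by move=> x y; apply: derD; [exact: (is_Ck_dery cF)|exact: (is_Ck_dery cG)].
- by apply: IH; [case: cF|case: cG].
- by apply: IH; [case: cF|case: cG].
Qed.

Lemma is_CkM n F G : is_Ck n F -> is_Ck n G -> is_Ck n (fun z => F z * G z).
Proof.
elim: n F G => [|n IH] F G; first exact: contM.
move=> cF cG.
notypeclasses refine (@is_Ck_intro n _ (fun z => 'D_dirx F z * G z + F z * 'D_dirx G z)
  (fun z => 'D_diry F z * G z + F z * 'D_diry G z) _ _ _ _ _).
- by apply: contM; [exact: (is_Ck_cont cF)|exact: (is_Ck_cont cG)].
- by move=> x y; apply: derM; [exact: (is_Ck_derx cF)|exact: (is_Ck_derx cG)].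
- by move=> x y; apply: derM; [exact: (is_Ck_dery cF)|exact: (is_Ck_dery cG)].
- by apply: is_CkD; apply: IH; do ?[exact: is_CkW]; [case: cF|case: cG].
- by apply: is_CkD; apply: IH; do ?[exact: is_CkW]; [case: cF|case: cG].
Qed.

Lemma is_Ck_comp n f F : Ck n f -> is_Ck n F -> is_Ck n (fun z => f (F z)).
Proof.
elim: n f F => [|n IH] f F; first by move=> cf cF; exact: cont_comp.
move=> cf cF.
notypeclasses refine (@is_Ck_intro n _ (fun z => derive1 f (F z) * 'D_dirx F z)
  (fun z => derive1 f (F z) * 'D_diry F z) _ _ _ _ _).
- by apply: cont_comp; [exact: (Ck_continuous cf)|exact: (is_Ck_cont cF)].
- by move=> x y; apply: derComp; [exact: (is_Ck_derx cF)|exact: (CkSP cf)].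
- by move=> x y; apply: derComp; [exact: (is_Ck_dery cF)|exact: (CkSP cf)].
- by apply: is_CkM; [apply: IH; [case: cf|exact: is_CkW]|case: cF].
- by apply: is_CkM; [apply: IH; [case: cf|exact: is_CkW]|case: cF].
Qed.

Lemma der_vanish f x : (\forall t \near x, f t = 0) -> is_derive x 1 f 0.
Proof.
move=> f0; apply: (near_eq_is_derive (f := fun _ : R => 0 : R)).
by apply: filterS f0 => t ->.
Qed.

Lemma near_outside (a b x : R) : ~~ (a <= x <= b) -> \forall t \near x, ~~ (a <= t <= b).
Proof.
rewrite negb_and -!ltNge => /orP[xa|bx]; near=> t; rewrite negb_and -!ltNge.
  by rewrite (_ : t < a)//; near: t; exact: lt_nbhsl.
by rewrite (_ : b < t) ?orbT//; near: t; exact: lt_nbhsr.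
Unshelve. all: by end_near.
Qed.

Lemma derive1_outside f a b : (forall t, ~~ (a <= t <= b) -> f t = 0) ->
  forall t, ~~ (a <= t <= b) -> derive1 f t = 0.
Proof.
move=> f0 t tab; apply: is_derive_derive1; apply: der_vanish.
by apply: filterS (near_outside tab) => s /f0.
Qed.

(* Outside the support of the cutoff [c] no regularity of [f] is required. *)
Lemma Ck_cutoffM (p q a b : R) c f : (forall n, Ck n c) -> p < a -> b < q ->
  (forall t, ~~ (a <= t <= b) -> c t = 0) ->
  (forall n x, p < x < q -> derivable (derive1n n f) x 1) ->
  forall n, Ck n (fun x => c x * f x).
Proof.
move=> cc pa bq.
have main n : forall c f, (forall n, Ck n c) ->
    (forall t, ~~ (a <= t <= b) -> c t = 0) ->
    (forall n x, p < x < q -> derivable (derive1n n f) x 1) ->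
    (forall x, is_derive x 1 (fun x => c x * f x) (derive1 c x * f x + c x * derive1 f x)).
  move=> {}c {}f {}cc c0 sf x.
  have [xpq|xpq] := boolP (p < x < q).
    apply: derM; first exact: (CkSP (cc 1)).
    by apply: derivable_is_derive; exact: (sf 0).
  have xab : ~~ (a <= x <= b).
    by apply: contra xpq => /andP[ax xb]; rewrite (lt_le_trans pa ax) (le_lt_trans xb bq).
  rewrite c0// (derive1_outside c0 xab) !mul0r addr0; apply: der_vanish.
  by apply: filterS (near_outside xab) => s /c0 ->; rewrite mul0r.
move=> c0 sf n; elim: n c f cc c0 sf => [|n IH] c f cc c0 sf.
  exact: der_cont (main 0%N c f cc c0 sf).
apply: Ck_is_derive (main 0%N c f cc c0 sf) _; apply: CkD.
- by apply: IH sf; [move=> m; case: (cc m.+1)|exact: derive1_outside].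
- apply: (IH c (derive1 f) cc c0) => m x xpq.
  by have := sf m.+1 x xpq; rewrite -derive1Sn.
Qed.

(** The support lies in the region [a <= x <= b], [tau l(x) <= y <= (1 - tau) l(x)]. It is closed
    and bounded, and is contained in the open region [p < x < q], [0 < y < l(x)], itself a subset of
    [D]. *)
Lemma test_function_fibered (D : set (R * R)) (c s l : R -> R) (p a b q tau : R) :
  (forall n, Ck n c) -> (forall n, Ck n s) -> (forall n, Ck n l) ->
  (forall x, 0 < l x) -> p < a -> b < q -> 0 < tau ->
  (forall x, ~~ (a <= x <= b) -> c x = 0) ->
  (forall t, ~~ (tau <= t <= 1 - tau) -> s t = 0) ->
  (forall x y, p < x < q -> 0 < y < l x -> D (x, y)) ->
  test_function D (fun z => c z.1 * s (z.2 / l z.1)).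
Proof.
move=> cc cs cl l0 pa bq tau0 c0 s0 DD.
have ll : continuous l := Ck_continuous (cl 0%N).
have cl1 : continuous (fun z : R * R => l z.1) by apply: cont_comp => //; exact: cont_fst.
have c2 := @cont_snd R; have c1 := @cont_fst R.
have h1 : continuous (fun z : R * R => z.2 - tau * l z.1) by cont.
have h2 : continuous (fun z : R * R => (1 - tau) * l z.1 - z.2) by cont.
have h3 : continuous (fun z : R * R => l z.1 - z.2) by cont.
pose K : set (R * R) := [set z | a <= z.1 <= b /\ tau * l z.1 <= z.2 <= (1 - tau) * l z.1].
have clK : closed K.
  have -> : K = (((fun z => z.1) @^-1` [set t | a <= t]) `&`
                 ((fun z => z.1) @^-1` [set t | t <= b])) `&`
                (((fun z => z.2 - tau * l z.1) @^-1` [set t | 0 <= t]) `&`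
                 ((fun z => (1 - tau) * l z.1 - z.2) @^-1` [set t | 0 <= t])).
    apply/seteqP; split => z /=.
      by move=> [/andP[? ?] /andP[? ?]]; rewrite !subr_ge0.
    by rewrite !subr_ge0 => -[[p1 p2] [p3 p4]]; split; apply/andP.
  by apply: closedI; apply: closedI; apply: preimage_closed.
have sK : closure [set z | c z.1 * s (z.2 / l z.1) != 0] `<=` K.
  move/closure_id: (clK) => ->; apply: closure_subset => z /=; rewrite mulf_eq0 negb_or => /andP[cz sz].
  split; first by apply: contraNT cz => /c0 ->.
  have : tau <= z.2 / l z.1 <= 1 - tau by apply: contraNT sz => /s0 ->.
  by rewrite ler_pdivlMr// ler_pdivrMr.
split.
- move=> n; apply: is_CkM; first by apply: is_Ck_comp => //; exact: is_Ck_fst.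
  apply: is_Ck_comp => //; apply: is_CkM; first exact: is_Ck_snd.
  apply: (@is_Ck_comp n (fun x => (l x)^-1)); last exact: is_Ck_fst.
  by apply: CkV => // x; rewrite gt_eqF.
- have [M HM] := rect_bounded a b 0 0 cl1.
  apply: subclosed_compact (@closed_closure _ _)
    (compact_setX (@segment_compact R a b) (@segment_compact R 0 M)) (subset_trans sK _).
  move=> [x y] [/= xab /andP[y0 y1]]; split; rewrite /= in_itv//=.
  have lx := l0 x.
  apply/andP; split; first by apply: le_trans y0; rewrite mulr_ge0 ?ltW.
  apply: le_trans y1 _; apply: (@le_trans _ _ (l x)); first by rewrite ler_piMl ?gerBl ?ltW.
  by apply: le_trans (ler_norm _) _; apply: (HM x 0) => //; rewrite lexx.
- apply: subset_trans sK _.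
  pose U : set (R * R) := [set z | p < z.1 < q /\ 0 < z.2 < l z.1].
  have oU : open U.
    have -> : U = (((fun z => z.1) @^-1` [set t | p < t]) `&`
                 ((fun z => z.1) @^-1` [set t | t < q])) `&`
                (((fun z => z.2) @^-1` [set t | 0 < t]) `&`
                 ((fun z => l z.1 - z.2) @^-1` [set t | 0 < t])).
      apply/seteqP; split => z /=.
        by move=> [/andP[? ?] /andP[? ?]]; rewrite !subr_gt0.
      by rewrite !subr_gt0 => -[[p1 p2] [p3 p4]]; split; apply/andP.
    by apply: openI; apply: openI; apply: open_comp.
  have UD : U `<=` interior D.
    by move=> z Uz; apply: (filterS (P := U)); [case => x y [/=]; exact: DD|exact: open_nbhs_nbhs].
  move=> z [/andP[az zb] /andP[zt zt']]; apply: UD; split.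
    by rewrite (lt_le_trans pa az) (le_lt_trans zb bq).
  have lz := l0 z.1; rewrite (lt_le_trans _ zt) ?mulr_gt0//= (le_lt_trans zt')//.
  by rewrite gtr_pMl// gtrBl.
Qed.

End SmoothPlane.

(** * Square integrable functions *)

Section L2.
Context {R : realType}.
Notation mR2 := (measurableTypeR R * measurableTypeR R)%type.
Variable D : set (R * R).
Hypothesis mD : measurable (D : set mR2).
Implicit Types f g h : R * R -> R.

Definition ip f g : R := \int[lebesgue2]_(z in D) (f z * g z).

Definition sq_integrable f : Prop :=
  measurable_fun (T := mR2) D f /\
  (@lebesgue2 R).-integrable D (EFin \o (fun z => f z ^+ 2)).

Lemma L2norm_poweR f :
  (L2norm D f `^ 2)%E = (\int[lebesgue2]_(z in D) (f z ^+ 2)%:E)%E.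
Proof.
rewrite /L2norm poweR_Lnorm ?pnatr_eq0// [RHS]integral_mkcond.
apply: eq_integral => z _; rewrite /= patchE.
rewrite patchE; case: ifPn => _; last first.
  by rewrite normr0 powR0// pnatr_eq0.
by rewrite powR_mulrn// real_normK// num_real.
Qed.

Lemma in_L2_sq_integrable f : in_L2 D f -> sq_integrable f.
Proof.
move=> [mf fy]; split => //; apply/integrableP; split.
  by apply/measurable_EFinP; exact: measurable_funX.
under eq_integral do rewrite /= ger0_norm ?sqr_ge0//.
by rewrite -L2norm_poweR; apply: poweR_lty.
Qed.

Lemma sq_integrable_L2norm f : sq_integrable f ->
  L2norm D f = (Num.sqrt (ip f f))%:E.
Proof.
move=> [mf sf].
have E : (\int[lebesgue2]_(z in D) (f z ^+ 2)%:E)%E = (ip f f)%:E.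
  rewrite /ip /Rintegral; under [in RHS]eq_integral do rewrite -expr2.
  by rewrite fineK//; exact: integral_fune_fin_num.
have := L2norm_poweR f; rewrite E => /(congr1 (fun x => x `^ 2^-1)%E).
by rewrite -poweRrM mulfV ?pnatr_eq0// poweRe1 ?Lnorm_ge0// poweR_EFin powR12_sqrt//;
  apply: Rintegral_ge0 => z _; rewrite -expr2 sqr_ge0.
Qed.

Lemma ip_integrable f g : sq_integrable f -> sq_integrable g ->
  (@lebesgue2 R).-integrable D (EFin \o (fun z => f z * g z)).
Proof.
move=> [mf sf] [mg sg].
apply: (@le_integrable _ _ _ _ _ mD _ (EFin \o (fun z => f z ^+ 2 + g z ^+ 2))).
- by apply/measurable_EFinP; exact: measurable_funM.
- move=> z Dz /=; rewrite lee_fin normrM.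
  rewrite [leRHS]ger0_norm ?addr_ge0 ?sqr_ge0//.
  rewrite -[f z ^+ 2]real_normK ?num_real// -[g z ^+ 2]real_normK ?num_real//.
  have := sqr_ge0 (`|f z| - `|g z|); have := mulr_ge0 (normr_ge0 (f z)) (normr_ge0 (g z)).
  by rewrite sqrrB; lra.
- have := integrableD mD sf sg; apply: eq_integrable => // z _ /=.
Qed.

Lemma ipC f g : ip f g = ip g f.
Proof. by apply: eq_Rintegral => z _; rewrite mulrC. Qed.

Lemma ip_ge0 f : 0 <= ip f f.
Proof. by apply: Rintegral_ge0 => z _; rewrite -expr2 sqr_ge0. Qed.

Lemma sq_integrableZD f g k : sq_integrable f -> sq_integrable g ->
  sq_integrable (fun z => f z + k * g z).
Proof.
move=> sf sg; split.
  by apply: measurable_funD; [case: sf|apply: measurable_funM => //; case: sg].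
have ifg := ip_integrable sf sg.
have := integrableD mD (integrableD mD sf.2 (integrableZl mD (2 * k) ifg))
  (integrableZl mD (k ^+ 2) sg.2).
by apply: eq_integrable => // z _ /=; rewrite -!EFinM -!EFinD; congr EFin; ring.
Qed.

Lemma ipZD f g h k : sq_integrable f -> sq_integrable g -> sq_integrable h ->
  ip (fun z => f z + k * g z) h = ip f h + k * ip g h.
Proof.
move=> sf sg sh; rewrite /ip.
have i1 := ip_integrable sf sh; have i2 := ip_integrable sg sh.
rewrite -RintegralZl// -RintegralD//; last first.
  by have := integrableZl mD k i2; apply: eq_integrable.
by apply: eq_Rintegral => z _; ring.
Qed.

Lemma ip_CauchySchwarz f g : sq_integrable f -> sq_integrable g ->
  `|ip f g| <= Num.sqrt (ip f f) * Num.sqrt (ip g g).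
Proof.
move=> sf sg; set A := ip f g; set B := ip f f; set C := ip g g.
have B0 : 0 <= B := ip_ge0 f; have C0 : 0 <= C := ip_ge0 g.
have key t : 0 <= B + 2 * t * A + t ^+ 2 * C.
  have sfg := sq_integrableZD t sf sg.
  have := ip_ge0 (fun z => f z + t * g z).
  rewrite ipZD// [ip f _]ipC [ip g _]ipC !ipZD//.
  by rewrite (ipC g f) -/A -/B -/C; congr (0 <= _); ring.
have K : A ^+ 2 <= B * C.
  have [C00|Cn0] := eqVneq C 0.
    have [-> | An0] := eqVneq A 0; first by rewrite expr0n mulr_ge0.
    have := key (- (B + 1) / (2 * A)); rewrite C00 mulr0 addr0.
    have -> : 2 * (- (B + 1) / (2 * A)) * A = - (B + 1) by field.
    lra.
  have := key (- A / C).
  have -> : B + 2 * (- A / C) * A + (- A / C) ^+ 2 * C = (B * C - A ^+ 2) / C by field.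
  by rewrite pmulr_lge0 ?invr_gt0 ?lt0r ?Cn0// subr_ge0.
by rewrite -sqrtrM// -sqrtr_sqr ler_wsqrtr.
Qed.

Lemma L2_triangle f g : sq_integrable f -> sq_integrable g ->
  Num.sqrt (ip f f) <= Num.sqrt (ip g g) + Num.sqrt (ip (f \- g) (f \- g)).
Proof.
move=> sf sg.
have E : f \- g = (fun z => f z + -1 * g z) by apply/funext => z /=; rewrite mulN1r.
have sh : sq_integrable (f \- g) by rewrite E; exact: sq_integrableZD.
have F : f = (fun z => g z + 1 * (f \- g) z).
  by apply/funext => z /=; rewrite mul1r addrC subrK.
have := ip_CauchySchwarz sg sh; set h := f \- g in sh F *.
move=> CS.
have -> : ip f f = ip g g + 2 * ip g h + ip h h.
  rewrite {1}F ipZD// [ip g f]ipC [ip h f]ipC F !ipZD// (ipC h g); ring.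
rewrite -(ger0_norm (addr_ge0 (sqrtr_ge0 (ip g g)) (sqrtr_ge0 (ip h h)))).
rewrite -sqrtr_sqr ler_wsqrtr// sqrrD !sqr_sqrtr ?ip_ge0//.
have := ler_norm (ip g h); lra.
Qed.

End L2.

(** * The billiard *)

Section BilliardSet.
Context {R : realType}.
Notation mR2 := (measurableTypeR R * measurableTypeR R)%type.
Variables (B0 B1 L0 cL gamma : R) (L : R -> R).
Hypothesis HL : billiard_profile B0 B1 L0 cL gamma L.
Let D : set (R * R) := billiard B0 B1 L.
Let W : set (R * R) := wing B0 B1 L0 L.
Let B0_gt0 : 0 < B0 := profile_B0_gt0 HL.
Let B1_gt0 : 0 < B1 := profile_B1_gt0 HL.
Let L0_gt0 : 0 < L0 := profile_L0_gt0 HL.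
Implicit Types (F G phi psi f g : R * R -> R) (k E eta x y : R).

Lemma profile_derivable x : 0 < x < B1 -> derivable L x 1.
Proof. exact: (@profile_smooth _ _ _ _ _ _ _ HL 0%N x). Qed.

Lemma profile_continuous x : 0 < x < B1 -> {for x, continuous L}.
Proof. by move=> /profile_derivable dL; apply/differentiable_continuous/derivable1_diffP. Qed.

(** [L] is continuous on [(0, B1)] but arbitrary at [B1]. Hence the decomposition into the
    rectangle, the region below the graph over the open interval, and one vertical segment over
    [B1]. *)
Lemma billiard_measurable : measurable (D : set mR2).
Proof.
pose Lp := L \_ `]0, B1[.
have mLp : measurable_fun (setT : set (measurableTypeR R)) Lp.
  apply/(measurable_restrictT L _) => //.
  apply: open_continuous_measurable_fun => // x.
  by rewrite inE/= in_itv/=; exact: profile_continuous.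
pose A2 : set mR2 := (`]0, B1[%classic `*` setT) `&` ((fun z => z.2) @^-1` `[0, +oo[ `&`
  (fun z : mR2 => Lp z.1 - z.2) @^-1` `[0, +oo[).
have mA2 : measurable A2.
  apply: measurableI; first exact: measurableX.
  apply: measurableI.
    by rewrite -[X in measurable X]setTI; exact: measurable_snd.
  rewrite -[X in measurable X]setTI.
  have mf : measurable_fun (setT : set mR2) (fun z : mR2 => Lp z.1 - z.2).
    apply: measurable_funB; last exact: measurable_snd.
    by apply: (measurableT_comp mLp); exact: measurable_fst.
  exact: mf.
have -> : D = (`[- B0, 0]%classic `*` `[0, L0]%classic) `|` A2 `|`
    ([set B1] `*` `[0, L B1]%classic).
  apply/seteqP; split => [[x y] [/= /andP[x1 x2] y1]|[x y]].
    have [x0|x0] := leP x 0.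
      left; left; split; rewrite /= in_itv/= ?x1 ?x0//.
      by move: y1; rewrite (profile_flat HL) ?x1.
    move: x2; rewrite le_eqVlt => /orP[/eqP xB|xB].
      by right; split => //=; rewrite in_itv/= -xB.
    left; right; split; first by split; rewrite //= in_itv/= x0.
    split; rewrite /= in_itv/= andbT; first by case/andP: y1.
    by rewrite /Lp patchE mem_set ?subr_ge0 /= ?in_itv/= ?x0//; case/andP: y1.
  move=> [[[/=]|[[/=]]]|[/=]]; rewrite ?in_itv/=.
  - move=> /andP[x1 x2] y1; split => /=; first by rewrite x1 (le_trans x2) ?ltW.
    by rewrite (profile_flat HL) ?x1.
  - move=> /andP[x1 x2] _ []; rewrite !andbT => y1.
    rewrite /Lp patchE mem_set /= ?in_itv/= ?x1// subr_ge0 => y2; split => /=.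
      by rewrite (le_trans _ (ltW x1)) ?oppr_le0 ?ltW.
    by rewrite y1.
  - by move=> -> y1; split => //=; rewrite lexx (le_trans _ (ltW B1_gt0)) ?oppr_le0 ?ltW.
apply: measurableU; first by apply: measurableU => //; exact: measurableX.
exact: measurableX.
Qed.

Lemma wing_measurable : measurable (W : set mR2).
Proof.
apply: measurableD; first exact: billiard_measurable.
have -> : rectangle B0 L0 = `[- B0, 0]%classic `*` `[0, L0]%classic.
  by apply/seteqP; split => z; rewrite /rectangle/= !in_itv.
exact: measurableX.
Qed.

(** Monotonicity is available on [(0, B1)] only. The comparison with the flat part goes through the
    expansion at [0^+]: near 0 its error is at most [cL t^gamma], which is exactly the drop, so
    [L t <= L0] for small [t > 0]. *)
Lemma profile_le_L0 x : - B0 <= x < B1 -> L x <= L0.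
Proof.
move=> /andP[x1 x2]; have [x0|x0] := leP x 0; first by rewrite (profile_flat HL)// x1.
apply/ler_addgt0Pr => e e0.
have g0 : 0 < gamma by have := profile_gamma HL; lra.
have := profile_expansion HL.
move=> /eqoP/(_ cL (profile_cL_gt0 HL)) H.
near (0:R)^'+ => t.
have t0 : 0 < t by [].
have Ht : `|L t - (L0 - cL * t `^ gamma)| <= cL * `|t `^ gamma| by near: t; exact: H.
have tx : t <= x by near: t; exact: nbhs_right_le.
apply: le_trans (profile_noninc HL t0 tx x2) _.
move: Ht; rewrite (ger0_norm (powR_ge0 _ _)) ler_norml => /andP[_ Ht].
lra.
Unshelve. all: by end_near.
Qed.

Lemma interior_billiard x y : interior D (x, y) ->
  [/\ - B0 < x < B1, 0 < y & y < L x].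
Proof.
move=> /nbhs_ballP[e /= e0 H].
have e2 : 0 < e / 2 by lra.
have b0 (t : R) : ball t e t by exact: ballxx.
have bp (t : R) : ball t e (t + e / 2).
  by rewrite /ball/= opprD addNKr normrN gtr0_norm//; lra.
have bm (t : R) : ball t e (t - e / 2).
  by rewrite /ball/= opprB addrC subrK gtr0_norm//; lra.
have [/= H1 _] : D (x + e / 2, y) by apply: H; split => /=.
have [/= H2 _] : D (x - e / 2, y) by apply: H; split => /=.
have [/= _ H3] : D (x, y + e / 2) by apply: H; split => /=.
have [/= _ H4] : D (x, y - e / 2) by apply: H; split => /=.
by split; lra.
Qed.

Lemma interior_billiard_rect x y : interior D (x, y) ->
  (- B0 <= x <= B1) /\ (0 <= y <= L0).
Proof.
move=> /interior_billiard[/andP[x1 x2] y0 yL]; rewrite (ltW x1) (ltW x2) (ltW y0); split => //=.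
by apply: le_trans (ltW yL) _; apply: profile_le_L0; rewrite x2 ltW.
Qed.

(** Integration over the bounding rectangle. Test functions vanish off the interior of [D], so every
    pairing with one becomes an iterated integral of continuous functions over fixed intervals,
    whatever the shape of [D]. *)
Definition IT (F : R * R -> R) : R :=
  integ (- B0) B1 (fun x => integ 0 L0 (fun y => F (x, y))).

Lemma integral_billiard F : continuous F -> (forall z, ~ interior D z -> F z = 0) ->
  \int[lebesgue2]_(z in D) F z = IT F.
Proof.
move=> cF F0; rewrite /IT -integral_rect// Rintegral_mkcond [RHS]Rintegral_mkcond.
apply: eq_Rintegral => -[x y] _; rewrite !patchE; case: ifPn => H1; case: ifPn => H2 //.
- apply: F0 => /interior_billiard_rect[h1 h2]; move/negP: H2; apply; rewrite inE.
  by split; rewrite /= in_itv.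
- apply/esym; apply: F0 => H3; move/negP: H1; apply; rewrite inE.
  exact: interior_subset H3.
Qed.

Lemma test_continuous phi : test_function D phi -> continuous phi.
Proof. by case=> /(_ 0%N). Qed.

Lemma test_vanish phi z : test_function D phi -> ~ interior D z -> phi z = 0.
Proof.
move=> [_ _ sD] Dz; apply/eqP/negPn/negP => pz; apply: Dz; apply: sD.
exact: subset_closure.
Qed.

Lemma test_derive phi v : test_function D phi -> v = dirx \/ v = diry ->
  test_function D ('D_v phi).
Proof.
move=> [sm cpt sD] hv.
have cl : closure [set z | 'D_v phi z != 0] `<=` closure [set z | phi z != 0].
  rewrite [X in _ `<=` X](closure_id _).1; last exact: closed_closure.
  apply: closureS => z /= dz; apply: contrapT => nz; move/eqP: dz; apply.
  have n0 : \forall t \near z, phi t = 0.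
    have : nbhs z (~` closure [set z | phi z != 0]).
      by apply: open_nbhs_nbhs; split => //; apply: closed_openC; exact: closed_closure.
    apply: filterS => t nt; apply/eqP/negPn/negP => pt; apply: nt.
    exact: subset_closure.
  suff : is_derive z v phi 0 by move=> ?; exact: derive_val.
  apply: (near_eq_is_derive (f := fun _ => 0)).
  by apply: filterS n0 => t ->.
split.
- by move=> n; case: hv => ->; case: (sm n.+1).
- apply: subclosed_compact cpt cl; exact: closed_closure.
- exact: subset_trans cl sD.
Qed.

Lemma test_sq_integrable phi : test_function D phi -> sq_integrable D phi.
Proof.
move=> tp; have cp := test_continuous tp; split.
  by apply: measurable_funTS; exact: continuous_measurable_plane.
have H := rect_integrable (- B0) B1 0 L0 (@contX _ _ _ 2 cp).
apply/(integrable_mkcond _ billiard_measurable).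
move/(integrable_mkcond _ (rect_measurable _ _ _ _)): H.
congr (is_true (integrable _ _ _)); apply/funext => -[x y].
rewrite !patchE; case: ifPn => H1; case: ifPn => H2 //.
- apply/esym; rewrite /= (test_vanish tp) ?expr0n//.
  by move=> H3; move/negP: H2; apply; rewrite inE; exact: interior_subset H3.
- rewrite /= (test_vanish tp) ?expr0n//.
  move=> /interior_billiard_rect[h1 h2]; move/negP: H1; apply; rewrite inE.
  by split; rewrite /= in_itv.
Qed.

Lemma ip_test phi psi : continuous phi -> test_function D psi ->
  ip D phi psi = IT (fun z => phi z * psi z).
Proof.
move=> cphi tp; apply: integral_billiard; first exact: contM cphi (test_continuous tp).
by move=> z Dz; rewrite (test_vanish tp Dz) mulr0.
Qed.

Lemma Rintegral_subset_le (A : set mR2) (F : R * R -> R) :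
  measurable A -> A `<=` D ->
  (@lebesgue2 R).-integrable D (EFin \o F) -> (forall z, 0 <= F z) ->
  \int[lebesgue2]_(z in A) F z <= \int[lebesgue2]_(z in D) F z.
Proof.
move=> mA AD iF F0; have mD := billiard_measurable.
rewrite /Rintegral fine_le//.
- by apply: integral_fune_fin_num => //; exact: integrableS iF.
- exact: integral_fune_fin_num.
- apply: ge0_subset_integral => //; last by move=> z _; rewrite lee_fin.
  by case/integrableP: iF.
Qed.

Lemma sq_integrable_wing F : sq_integrable D F -> sq_integrable W F.
Proof.
move=> [mF sF]; have mD := billiard_measurable; have mW := wing_measurable.
split; first by apply: measurable_funS mF => //; exact: subDsetl.
by apply: integrableS sF => //; exact: subDsetl.
Qed.

Lemma ip_wing_le F : sq_integrable D F -> ip W F F <= ip D F F.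
Proof.
move=> sF; apply: Rintegral_subset_le.
- exact: wing_measurable.
- exact: subDsetl.
- exact: (ip_integrable billiard_measurable sF sF).
- by move=> z; rewrite -expr2 sqr_ge0.
Qed.

(** By difference: [D] is the disjoint union of the wing and the rectangle, and both for [D] and for
    the rectangle the integral is already an iterated one. *)
Lemma ip_wing_test phi : test_function D phi ->
  ip W phi phi = integ 0 B1 (fun x => integ 0 L0 (fun y => phi (x, y) ^+ 2)).
Proof.
move=> tp; have cp := test_continuous tp.
have cp2 : continuous (fun z => phi z * phi z) by cont.
have mD := billiard_measurable; have mW := wing_measurable.
have -> : integ 0 B1 (fun x => integ 0 L0 (fun y => phi (x, y) ^+ 2)) =
    IT (fun z => phi z * phi z) -
    integ (- B0) 0 (fun x => integ 0 L0 (fun y => phi (x, y) * phi (x, y))).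
  rewrite /IT (@integ_split _ (- B0) 0 B1); last 2 first.
    exact: (@integ_param_continuous _ (fun z => phi z * phi z) 0 L0 cp2).
    by rewrite oppr_le0 !ltW.
  by rewrite addrAC subrr add0r.
rewrite -ip_test//.
rewrite -(@integral_rect _ (fun z => phi z * phi z) (- B0) 0 0 L0)//.
have DE : D = W `|` (`[- B0, 0]%classic `*` `[0, L0]%classic).
  apply/seteqP; split => [z Dz|z [[]//|]].
    have [Rz|Rz] := pselect (rectangle B0 L0 z); last by left.
    by right; move: Rz => [? ?]; split; rewrite /= in_itv.
  case: z => x y [/=]; rewrite !in_itv/= => /andP[x1 x2] y1; split => /=.
    by rewrite x1 (le_trans x2) ?ltW.
  by rewrite (profile_flat HL) ?x1.
rewrite /ip [in RHS]DE Rintegral_setU//; last 3 first.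
- exact: rect_measurable.
- by rewrite -DE; have s := test_sq_integrable tp; exact: (ip_integrable mD s s).
- apply/disj_setPS => -[x y] [[_ nR] [/=]]; rewrite !in_itv/= => h1 h2.
  by apply: nR; split.
by rewrite addrK.
Qed.

(** The partial derivatives of [psi] are test functions again, so the definition of the weak
    gradient applies to them and moves one derivative of the Laplacian back onto [f]. *)
Lemma weak_helmholtz f g1 g2 E psi : sq_integrable D f ->
  weak_derivative D dirx f g1 -> weak_derivative D diry f g2 ->
  helmholtz D E f -> test_function D psi ->
  ip D g1 ('D_dirx psi) + ip D g2 ('D_diry psi) = E * ip D f psi.
Proof.
move=> sf w1 w2 hE tp.
have t1 := test_derive tp (or_introl erefl); have t2 := test_derive tp (or_intror erefl).
have t11 := test_derive t1 (or_introl erefl); have t22 := test_derive t2 (or_intror erefl).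
have <- : _ = E * ip D f psi := hE _ tp.
have -> : \int[lebesgue2]_(z in D) (f z * laplacian psi z) =
    ip D f ('D_dirx ('D_dirx psi)) + ip D f ('D_diry ('D_diry psi)).
  rewrite /ip -RintegralD.
  - by apply: eq_Rintegral => z _; rewrite mulrDr.
  - exact: billiard_measurable.
  - exact: (ip_integrable billiard_measurable sf (test_sq_integrable t11)).
  - exact: (ip_integrable billiard_measurable sf (test_sq_integrable t22)).
have e1 : ip D f ('D_dirx ('D_dirx psi)) = - ip D g1 ('D_dirx psi) := w1 _ t1.
have e2 : ip D f ('D_diry ('D_diry psi)) = - ip D g2 ('D_diry psi) := w2 _ t2.
have H (a b c d : R) : a = - c -> b = - d -> c + d = - (a + b) by move=> -> ->; ring.
exact: H e1 e2.
Qed.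

Lemma ITD F G : continuous F -> continuous G -> IT (fun z => F z + G z) = IT F + IT G.
Proof.
move=> cF cG; rewrite /IT -integD; try exact: integ_param_continuous.
by apply: eq_integ => x _; rewrite integD//; exact: cont_pair2.
Qed.

Lemma ITZ k F : continuous F -> IT (fun z => k * F z) = k * IT F.
Proof.
move=> cF; rewrite /IT -integZ; try exact: integ_param_continuous.
by apply: eq_integ => x _; rewrite integZ//; exact: cont_pair2.
Qed.

Lemma IT_form (a1 a2 b1 b2 c1 c2 : R * R -> R) E :
  continuous a1 -> continuous a2 -> continuous b1 -> continuous b2 ->
  continuous c1 -> continuous c2 ->
  IT (fun z => a1 z * a2 z + b1 z * b2 z - E * (c1 z * c2 z)) =
  IT (fun z => a1 z * a2 z) + IT (fun z => b1 z * b2 z) - E * IT (fun z => c1 z * c2 z).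
Proof.
move=> ca1 ca2 cb1 cb2 cc1 cc2.
rewrite -mulNr -(@ITZ (- E)); last by cont.
rewrite -ITD; [|by cont|by cont]; rewrite -ITD; [|by cont|by cont].
by rewrite /IT; apply: eq_integ => x _; apply: eq_integ => y _; ring.
Qed.

Lemma IT_le_cst F k : continuous F -> (forall z, F z <= k) ->
  IT F <= k * (L0 * (B1 + B0)).
Proof.
move=> cF Fk; have -> : k * (L0 * (B1 + B0)) = IT (fun _ => k).
  rewrite /IT; under eq_integ do rewrite integ_cst ?ltW//.
  by rewrite integ_cst; [ring|apply: le_trans (ltW B1_gt0); rewrite oppr_le0 ltW].
rewrite /IT; apply: le_integ; try exact: integ_param_continuous.
  by apply: integ_param_continuous; exact: cont_cst.
move=> x _; apply: le_integ => //; first exact: cont_pair2.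
exact: cont_cst.
Qed.

(** The weak equation is exact for [f] with its weak gradient. Replacing these by [phi] and its
    gradient costs [eta] times the norm of the other factor in each of the three pairings, by
    Cauchy-Schwarz. The error is therefore linear in [eta], with factors depending on [psi] and [E]
    only. *)
Lemma eigen_approx f E : 0 <= E -> in_H10 D f -> helmholtz D E f ->
  forall eta, 0 < eta -> exists phi,
  [/\ test_function D phi,
      Num.sqrt (ip D f f) <= Num.sqrt (ip D phi phi) + eta,
      Num.sqrt (ip D phi phi) <= Num.sqrt (ip D f f) + eta,
      Num.sqrt (ip W phi phi) <= Num.sqrt (ip W f f) + eta &
      forall psi, test_function D psi ->
        `|IT (fun z => 'D_dirx phi z * 'D_dirx psi z + 'D_diry phi z * 'D_diry psi z
            - E * (phi z * psi z))| <=
        eta * (Num.sqrt (ip D ('D_dirx psi) ('D_dirx psi)) +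
               Num.sqrt (ip D ('D_diry psi) ('D_diry psi)) +
               E * Num.sqrt (ip D psi psi))].
Proof.
move=> E0 [f2 [g1 [g2 [[g12 w1] [g22 w2] app]]]] hE eta eta0.
have mD := billiard_measurable; have mW := wing_measurable.
have [phi tp [a1 a2 a3]] := app eta eta0.
have sf := in_L2_sq_integrable f2.
have sg1 := in_L2_sq_integrable g12; have sg2 := in_L2_sq_integrable g22.
have t1 := test_derive tp (or_introl erefl); have t2 := test_derive tp (or_intror erefl).
have sp := test_sq_integrable tp.
have s1 := test_sq_integrable t1; have s2 := test_sq_integrable t2.
have sub (F G : R * R -> R) : sq_integrable D F -> sq_integrable D G -> sq_integrable D (F \- G)%R.
  move=> sF sG; have -> : (F \- G)%R = (fun z => F z + -1 * G z).
    by apply/funext => z /=; rewrite mulN1r.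
  exact: sq_integrableZD.
have small (F G : R * R -> R) : sq_integrable D F -> sq_integrable D G ->
    (L2norm D (F \- G)%R < eta%:E)%E ->
    Num.sqrt (ip D (F \- G) (F \- G)) <= eta.
  move=> sF sG; rewrite (sq_integrable_L2norm mD (sub _ _ sF sG)) lte_fin; exact: ltW.
have b1 := small _ _ sf sp a1; have b2 := small _ _ sg1 s1 a2; have b3 := small _ _ sg2 s2 a3.
have sym (A : set mR2) (F G : R * R -> R) : ip A (F \- G) (F \- G) = ip A (G \- F) (G \- F).
  by apply: eq_Rintegral => z _ /=; ring.
exists phi; split => //.
- by apply: le_trans (L2_triangle mD sf sp) _; rewrite lerD2l.
- by apply: le_trans (L2_triangle mD sp sf) _; rewrite lerD2l sym.
- apply: le_trans (L2_triangle mW (sq_integrable_wing sp) (sq_integrable_wing sf)) _.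
  rewrite lerD2l sym; apply: le_trans b1; rewrite ler_wsqrtr//.
  by apply: ip_wing_le; exact: sub.
move=> psi tps.
have u1 := test_derive tps (or_introl erefl); have u2 := test_derive tps (or_intror erefl).
have q0 := test_sq_integrable tps; have q1 := test_sq_integrable u1.
have q2 := test_sq_integrable u2.
have c0 := test_continuous tps; have c1 := test_continuous u1; have c2 := test_continuous u2.
have d0 := test_continuous tp; have d1 := test_continuous t1; have d2 := test_continuous t2.
have -> : IT (fun z => 'D_dirx phi z * 'D_dirx psi z + 'D_diry phi z * 'D_diry psi z
            - E * (phi z * psi z)) =
   ip D ('D_dirx phi) ('D_dirx psi) + ip D ('D_diry phi) ('D_diry psi)
   - E * ip D phi psi.
  by rewrite IT_form// (ip_test d1 u1) (ip_test d2 u2) (ip_test d0 tps).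
have dif (F G H : R * R -> R) : sq_integrable D F -> sq_integrable D G ->
    sq_integrable D H -> ip D G H = ip D F H - ip D (F \- G) H.
  move=> sF sG sH.
  have -> : (F \- G)%R = (fun z => F z + -1 * G z).
    by apply/funext => z /=; rewrite mulN1r.
  by rewrite ipZD//; ring.
have alg (i1 i2 i3 a b c : R) : i1 + i2 = E * i3 ->
    i1 - a + (i2 - b) - E * (i3 - c) = - a - b + E * c.
  by move=> h; rewrite mulrBr -h; ring.
rewrite (dif g1 _ _ sg1 s1 q1) (dif g2 _ _ sg2 s2 q2) (dif f _ _ sf sp q0).
rewrite (alg _ _ _ _ _ _ (weak_helmholtz sf w1 w2 hE tps)).
apply: le_trans (ler_normD _ _) _; rewrite !mulrDr; apply: lerD.
  apply: le_trans (ler_normB _ _) _; apply: lerD; rewrite ?normrN.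
    exact: le_trans (ip_CauchySchwarz mD (sub _ _ sg1 s1) q1)
      (ler_wpM2r (sqrtr_ge0 _) b2).
  exact: le_trans (ip_CauchySchwarz mD (sub _ _ sg2 s2) q2)
    (ler_wpM2r (sqrtr_ge0 _) b3).
rewrite normrM (ger0_norm E0) mulrCA; apply: ler_wpM2l => //.
exact: le_trans (ip_CauchySchwarz mD (sub _ _ sf sp) q0)
  (ler_wpM2r (sqrtr_ge0 _) b1).
Qed.

End BilliardSet.

(** * Sine series *)

Section SineSeries.
Context {R : realType}.
Implicit Types (a b p x y t s w mu : R) (f g : R -> R) (j k n K N : nat).

Lemma sin_npi k : sin (k%:R * pi) = 0 :> R.
Proof.
elim: k => [|k IH]; first by rewrite mul0r sin0.
by rewrite -natr1 mulrDl mul1r sinDpi IH oppr0.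
Qed.

Lemma sqr_cos_npi k : cos (k%:R * pi) ^+ 2 = 1 :> R.
Proof. by have := cos2Dsin2 (k%:R * pi : R); rewrite sin_npi expr0n/= addr0. Qed.

Lemma is_derive_sin_affine mu p x :
  is_derive x 1 (fun t => sin (mu * (t - p))) (mu * cos (mu * (x - p))).
Proof.
have d1 : is_derive x 1 (fun t => mu * (t - p)) mu.
  have := derZ mu (derD (derI x) (derC (- p) x)); rewrite addr0 mulr1; exact.
by rewrite mulrC; apply: (derComp d1); exact: is_derive_sin.
Qed.

Lemma is_derive_cos_affine mu p x :
  is_derive x 1 (fun t => cos (mu * (t - p))) (- (mu * sin (mu * (x - p)))).
Proof.
have d1 : is_derive x 1 (fun t => mu * (t - p)) mu.
  have := derZ mu (derD (derI x) (derC (- p) x)); rewrite addr0 mulr1; exact.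
by rewrite mulrC -mulNr; apply: (derComp d1); exact: is_derive_cos.
Qed.

Lemma cont_sin_affine mu p : continuous (fun t : R => sin (mu * (t - p))).
Proof. exact: der_cont (is_derive_sin_affine mu p). Qed.

Lemma cont_cos_affine mu p : continuous (fun t : R => cos (mu * (t - p))).
Proof. exact: der_cont (is_derive_cos_affine mu p). Qed.

Lemma integ_cos_affine mu p a : 0 <= a -> mu != 0 -> sin (mu * a) = 0 ->
  integ p (p + a) (fun t => cos (mu * (t - p))) = 0.
Proof.
move=> a0 mu0 s0.
have dF x : is_derive x 1 (fun t => mu^-1 * sin (mu * (t - p))) (cos (mu * (x - p))).
  have := derZ mu^-1 (is_derive_sin_affine mu p x); rewrite mulrA mulVf// mul1r; exact.
rewrite (integ_FTC _ (@cont_cos_affine mu p) dF); last by rewrite lerDl.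
have -> : p + a - p = a by ring.
by rewrite s0 (subrr p) !mulr0 sin0 mulr0 subrr.
Qed.

Section Bessel.
Variables (p q c : R) (e : nat -> R -> R).
Hypotheses (c_gt0 : 0 < c) (ce : forall k, continuous (e k)).
Hypothesis ortho : forall j k, (0 < j)%N -> (0 < k)%N ->
  integ p q (fun y => e j y * e k y) = (j == k)%:R * c.

(** Positivity of the integral of [(c g - h)^2], with [h] the sum of the [d k * e k]. The factor [c]
    on [g] avoids dividing by the norms: the square expands to [c (c G - S)], where [G] is the
    integral of [g^2] and [S] the sum of the squared coefficients. *)
Lemma bessel (r : seq nat) g : uniq r -> all (leq 1) r -> continuous g ->
  \sum_(k <- r) integ p q (fun y => g y * e k y) ^+ 2 <= c * integ p q (fun y => g y ^+ 2).
Proof.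
move=> ur pr cg; pose d k := integ p q (fun y => g y * e k y).
pose h y := \sum_(k <- r) d k * e k y.
have ch : continuous h by apply: cont_sum => k; cont.
have gh : integ p q (fun y => g y * h y) = \sum_(k <- r) d k ^+ 2.
  transitivity (integ p q (fun y => \sum_(k <- r) d k * (g y * e k y))).
    by apply: eq_integ => y _; rewrite mulr_sumr; apply: eq_bigr => k _; ring.
  rewrite integ_sum; last by move=> k; cont.
  by apply: eq_bigr => k _; rewrite integZ ?expr2//; cont.
have eh j : j \in r -> integ p q (fun y => e j y * h y) = c * d j.
  move=> jr; transitivity (integ p q (fun y => \sum_(k <- r) d k * (e j y * e k y))).
    by apply: eq_integ => y _; rewrite mulr_sumr; apply: eq_bigr => k _; ring.
  rewrite integ_sum; last by move=> k; cont.
  rewrite (bigD1_seq j)//= big_seq_cond big1 ?addr0.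
    rewrite integZ; last by cont.
    by rewrite ortho ?(allP pr _ jr)// eqxx mul1r mulrC.
  move=> k /andP[kr kj]; rewrite integZ; last by cont.
  by rewrite ortho ?(allP pr _ jr) ?(allP pr _ kr)// eq_sym (negbTE kj) mul0r mulr0.
have hh : integ p q (fun y => h y * h y) = c * \sum_(k <- r) d k ^+ 2.
  transitivity (integ p q (fun y => \sum_(k <- r) d k * (e k y * h y))).
    by apply: eq_integ => y _; rewrite {1}/h mulr_suml; apply: eq_bigr => k _; ring.
  rewrite integ_sum; last by move=> k; cont.
  rewrite mulr_sumr big_seq [RHS]big_seq; apply: eq_bigr => k kr.
  by rewrite integZ ?eh//; [ring|cont].
have : 0 <= integ p q (fun y => (c * g y - h y) ^+ 2).
  by apply: integ_ge0 => y _; exact: sqr_ge0.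
have -> : integ p q (fun y => (c * g y - h y) ^+ 2) =
   c * (c * integ p q (fun y => g y ^+ 2)) - 2 * c * integ p q (fun y => g y * h y)
   + integ p q (fun y => h y * h y).
  rewrite -!integZ; [|by cont..]; rewrite -integB; [|by cont..].
  by rewrite -integD; [|by cont..]; apply: eq_integ => y _; ring.
rewrite gh hh -/(d _); set S := \sum_(k <- r) _; set G := integ _ _ _.
have -> : c * (c * G) - 2 * c * S + c * S = c * (c * G - S) by ring.
by rewrite pmulr_rge0// subr_ge0.
Qed.

End Bessel.

Variables (p a : R).
Hypothesis a_gt0 : 0 < a.
Let w := pi / a.
Definition sinb k y : R := sin (k%:R * w * (y - p)).
Definition cosb k y : R := cos (k%:R * w * (y - p)).

Lemma sinb_cont k : continuous (sinb k). Proof. exact: cont_sin_affine. Qed.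
Lemma cosb_cont k : continuous (cosb k). Proof. exact: cont_cos_affine. Qed.

Lemma wa : w * a = pi.
Proof. by rewrite /w divfK// gt_eqF. Qed.

Lemma w_gt0 : 0 < w.
Proof. by rewrite divr_gt0// pi_gt0. Qed.

Lemma sin_kwa k : sin (k%:R * w * a) = 0.
Proof. by rewrite -mulrA wa sin_npi. Qed.

Lemma integ_cosbB j k : integ p (p + a) (fun y => cos ((j%:R - k%:R) * w * (y - p))) =
  (j == k)%:R * a.
Proof.
case: eqVneq => [->|jk].
  rewrite mul1r; transitivity (integ p (p + a) (fun _ => 1)).
    by apply: eq_integ => y _; rewrite subrr !mul0r cos0.
  by rewrite integ_cst ?lerDl ?ltW// mul1r addrAC subrr add0r.
rewrite mul0r; apply: integ_cos_affine; first exact: ltW.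
  by rewrite mulf_eq0 subr_eq0 eqr_nat (negbTE jk) gt_eqF ?w_gt0.
by rewrite -mulrA wa mulrBl sinB !sin_npi mul0r mulr0 subrr.
Qed.

Lemma integ_cosbD j k : (0 < j + k)%N ->
  integ p (p + a) (fun y => cos ((j%:R + k%:R) * w * (y - p))) = 0.
Proof.
move=> jk; apply: integ_cos_affine; first exact: ltW.
  apply: mulf_neq0; last by rewrite gt_eqF ?w_gt0.
  by rewrite -natrD pnatr_eq0 -lt0n.
by rewrite -natrD sin_kwa.
Qed.

Lemma sinb_ortho j k : (0 < j)%N -> (0 < k)%N ->
  integ p (p + a) (fun y => sinb j y * sinb k y) = (j == k)%:R * (a / 2).
Proof.
move=> j0 k0; transitivity (integ p (p + a) (fun y =>
    2^-1 * (cos ((j%:R - k%:R) * w * (y - p)) - cos ((j%:R + k%:R) * w * (y - p))))).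
  apply: eq_integ => y _; rewrite /sinb.
  rewrite mulrBl mulrBl mulrDl mulrDl cosB cosD; by field.
rewrite integZ; last by apply: contD; [|apply: contN]; exact: cont_cos_affine.
rewrite integB; [|exact: cont_cos_affine|exact: cont_cos_affine].
by rewrite integ_cosbB integ_cosbD ?addn_gt0 ?j0// subr0; by field.
Qed.

Lemma cosb_ortho j k : (0 < j)%N || (0 < k)%N ->
  integ p (p + a) (fun y => cosb j y * cosb k y) = (j == k)%:R * (a / 2).
Proof.
move=> j0; transitivity (integ p (p + a) (fun y =>
    2^-1 * (cos ((j%:R - k%:R) * w * (y - p)) + cos ((j%:R + k%:R) * w * (y - p))))).
  apply: eq_integ => y _; rewrite /cosb.
  rewrite mulrBl mulrBl mulrDl mulrDl cosB cosD; by field.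
rewrite integZ; last by apply: contD; exact: cont_cos_affine.
rewrite integD; [|exact: cont_cos_affine|exact: cont_cos_affine].
by rewrite integ_cosbB integ_cosbD ?addn_gt0 ?j0// addr0; by field.
Qed.

Lemma sinb_bessel (r : seq nat) g : uniq r -> all (leq 1) r -> continuous g ->
  \sum_(k <- r) integ p (p + a) (fun y => g y * sinb k y) ^+ 2 <=
  a / 2 * integ p (p + a) (fun y => g y ^+ 2).
Proof.
by apply: bessel; [rewrite divr_gt0|exact: sinb_cont|exact: sinb_ortho].
Qed.

Lemma cosb_bessel (r : seq nat) g : uniq r -> all (leq 1) r -> continuous g ->
  \sum_(k <- r) integ p (p + a) (fun y => g y * cosb k y) ^+ 2 <=
  a / 2 * integ p (p + a) (fun y => g y ^+ 2).
Proof.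
apply: bessel; [by rewrite divr_gt0|exact: cosb_cont|].
by move=> j k j0 _; apply: cosb_ortho; rewrite j0.
Qed.

Definition cospoly N f : Prop :=
  exists c : nat -> R, forall s, f s = \sum_(j < N) c j * cos (j%:R * s).

Lemma cospolyD N f g : cospoly N f -> cospoly N g -> cospoly N (fun s => f s + g s).
Proof.
move=> [c Hc] [d Hd]; exists (fun j => c j + d j) => s.
by rewrite Hc Hd -big_split; apply: eq_bigr => j _; rewrite mulrDl.
Qed.

Lemma cospolyZ N f (m : R) : cospoly N f -> cospoly N (fun s => m * f s).
Proof.
move=> [c Hc]; exists (fun j => m * c j) => s.
by rewrite Hc mulr_sumr; apply: eq_bigr => j _; rewrite mulrA.
Qed.

Lemma cospoly_cos N j : (j < N)%N -> cospoly N (fun s => cos (j%:R * s)).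
Proof.
move=> jN; exists (fun i => (i == j)%:R) => s.
rewrite (bigD1 (Ordinal jN))//= eqxx mul1r big1 ?addr0// => i ij.
by rewrite (_ : (nat_of_ord i == j) = false) ?mul0r//; apply/negbTE.
Qed.

Lemma cospoly_sum N n (F : nat -> R -> R) : (forall j, (j < n)%N -> cospoly N (F j)) ->
  cospoly N (fun s => \sum_(j < n) F j s).
Proof.
elim: n => [|n IH] HF.
  by exists (fun _ => 0) => s; rewrite big_ord0 big1// => j _; rewrite mul0r.
have [c Hc] := cospolyD (IH (fun j jn => HF j (ltnW jn))) (HF n (ltnSn n)).
by exists c => s; rewrite -Hc big_ord_recr.
Qed.

(** This is [cos(s/2)^(2K)], up to normalisation the de la Vallee-Poussin kernel: non-negative,
    concentrated at 0, and a cosine polynomial of degree [K]. Each extra factor raises the degree by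
    one through the product-to-sum formula. *)
Lemma cospoly_kernel K : cospoly K.+1 (fun s => ((1 + cos s) / 2) ^+ K).
Proof.
elim: K => [|K [c Hc]].
  exists (fun _ => 1) => s; rewrite big_ord_recl big_ord0 mul0r cos0.
  by rewrite expr0 addr0 mul1r.
suff [d Hd] : cospoly K.+2 (fun s => \sum_(j < K.+1)
    (c j / 2) * (cos (j%:R * s) + (cos (j%:R * s) * cos s))).
  exists d => s; rewrite -Hd exprS Hc mulr_sumr; apply: eq_bigr => j _; by field.
apply: (@cospoly_sum _ _ (fun j s => (c j / 2) * (cos (j%:R * s) + (cos (j%:R * s) * cos s)))).
move=> j jK; apply: cospolyZ; apply: cospolyD.
  by apply: cospoly_cos; rewrite (ltn_trans jK).
case: j jK => [|j] jK.
  have [d Hd] := @cospoly_cos K.+2 1 isT.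
  by exists d => s; rewrite -Hd mul0r cos0 !mul1r.
have [d Hd] := cospolyD (cospolyZ 2^-1 (@cospoly_cos K.+2 j.+2 jK))
  (cospolyZ 2^-1 (@cospoly_cos K.+2 j (ltn_trans (ltnSn j) (ltn_trans jK (ltnSn _))))).
exists d => s; rewrite -Hd.
rewrite -[j.+2]addn1 -[j in X in _ + X](addnK 1%N).
have -> : (j.+1 + 1)%:R * s = j.+1%:R * s + s by rewrite natrD; ring.
have -> : (j + 1 - 1)%:R * s = j.+1%:R * s - s by rewrite addnK -natr1; ring.
rewrite cosD cosB; by field.
Qed.

Let u s : R := (1 + cos s) / 2.

Let u_ge0 s : 0 <= u s.
Proof. by rewrite /u divr_ge0//; have := cos_geN1 s; lra. Qed.

Let u_le1 s : u s <= 1.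
Proof. by rewrite /u; have := cos_le1 s; lra. Qed.

Definition kmass K : R := integ p (p + a) (fun t => u (w * (t - p)) ^+ K).

Let cont_u : continuous (fun t => u (w * (t - p))).
Proof.
have c := @cont_cos_affine w p.
by rewrite /u; cont.
Qed.

Lemma kmass0 : kmass 0 = a.
Proof.
rewrite /kmass; under eq_integ do rewrite expr0.
by rewrite integ_cst ?lerDl ?ltW//; ring.
Qed.

(* The antiderivative is [sin s * u s ^+ K.+1], which vanishes at both ends. *)
Lemma kmassS K : (2 * K%:R + 2) * kmass K.+1 = (2 * K%:R + 1) * kmass K.
Proof.
apply/eqP; rewrite -subr_eq0; apply/eqP.
have cu := cont_u.
rewrite /kmass -!integZ; [|by cont|by cont]; rewrite -integB; [|by cont|by cont].
have du x : is_derive x 1 (fun t => u (w * (t - p))) (- (w * sin (w * (x - p))) / 2).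
  have := derZ 2^-1 (derD (derC 1 x) (is_derive_cos_affine w p x)).
  by rewrite add0r mulrC; under eq_fun do rewrite mulrC.
have dX n x : is_derive x 1 (fun t => u (w * (t - p)) ^+ n.+1)
    (n.+1%:R * u (w * (x - p)) ^+ n * (- (w * sin (w * (x - p))) / 2)).
  elim: n => [|n IH]; first by rewrite expr0 !mul1r.
  have := derM (du x) IH.
  rewrite (_ : (fun x => _ * _ ^+ n.+1) = fun t => u (w * (t - p)) ^+ n.+2); last first.
    by apply/funext => t; rewrite [RHS]exprS.
  congr is_derive; rewrite -[n.+2%:R]natr1 exprS; ring.
have dF x : is_derive x 1 (fun t => (w^-1 * sin (w * (t - p))) * u (w * (t - p)) ^+ K)
   ((2 * K%:R + 2) * u (w * (x - p)) ^+ K.+1 - (2 * K%:R + 1) * u (w * (x - p)) ^+ K).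
  have wn0 : w != 0 by rewrite gt_eqF ?w_gt0.
  have ds := derZ w^-1 (is_derive_sin_affine w p x).
  have s2 : sin (w * (x - p)) ^+ 2 = 4 * (u (w * (x - p)) * (1 - u (w * (x - p)))).
    have := cos2Dsin2 (w * (x - p)) => /(canRL (addKr _)) ->; rewrite /u; by field.
  case: (K) => [|n].
    under eq_fun do rewrite expr0 mulr1.
    have := ds; congr is_derive; rewrite expr1 expr0 mulrA mulVf// /u; by field.
  have := derM ds (dX n x); congr is_derive.
  rewrite !exprS -natr1; set c := cos _; set v := u _; set v' := v ^+ n.
  have -> : c = 2 * v - 1 by rewrite /v /u /c; by field.
  have -> : w^-1 * (w * (2 * v - 1)) = 2 * v - 1 by rewrite mulrA mulVf// mul1r.
  have -> : w^-1 * sin (w * (x - p)) * ((n%:R + 1) * v' * (- (w * sin (w * (x - p))) / 2)) =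
    - ((n%:R + 1) * v' * sin (w * (x - p)) ^+ 2 / 2) by field.
  rewrite s2 -/v; by field.
rewrite (integ_FTC _ _ dF); [|by rewrite lerDl ltW|by cont].
have -> : p + a - p = a by ring.
have -> : p - p = 0 by ring.
by rewrite wa mulr0 sin0 sinpi !mulr0 !mul0r subrr.
Qed.

Lemma kmass_gt0 K : 0 < kmass K.
Proof.
elim: K => [|K IH]; first by rewrite kmass0.
have k0 : 0 <= K%:R :> R by [].
have : 0 < (2 * K%:R + 2) * kmass K.+1 by rewrite kmassS mulr_gt0//; lra.
by rewrite pmulr_rgt0//; lra.
Qed.

(** Any linear lower bound serves. Up to [pi / 4] the cosine is at least 1/2 and is integrated;
    beyond, monotonicity gives [sin x >= pi / 8]. *)
Lemma sin_ge_quarter x : 0 <= x <= pi / 2 -> x / 4 <= sin x.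
Proof.
have pi0 := pi_gt0 R.
have c4 : 2^-1 <= cos (pi / 4 : R).
  have c0 : 0 < cos (pi / 4 : R) by apply: cos_gt0_pihalf; lra.
  have : cos (pi / 4 : R) ^+ 2 = 2^-1.
    have := cosD (pi / 4 : R) (pi / 4); rewrite (_ : pi / 4 + pi / 4 = pi / 2); last by field.
    by rewrite cos_pihalf -!expr2; have := cos2Dsin2 (pi / 4 : R); lra.
  nra.
have small y : 0 <= y <= pi / 4 -> y / 2 <= sin y.
  move=> /andP[y0 y4].
  have := @integ_FTC _ 0 y (@cos R) (@sin R) y0 (@continuous_cos R) (@is_derive_sin R).
  rewrite sin0 subr0 => <-; rewrite mulrC -[X in _ * X]subr0 -integ_cst//.
  apply: le_integ; [exact: cont_cst|exact: continuous_cos|].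
  move=> t /andP[t0 ty]; apply: le_trans c4 _.
  rewrite leNgt ltr_cos ?in_itv/= -?leNgt; [|apply/andP; split; lra|apply/andP; split; lra].
  lra.
move=> /andP[x0 x2]; have [x4|x4] := leP x (pi / 4).
  by apply: le_trans (small x _); lra.
have s4 := small (pi / 4).
have : sin (pi / 4) <= sin x.
  rewrite leNgt ltr_sin ?in_itv/= -?leNgt; [|apply/andP; split; lra|apply/andP; split; lra].
  lra.
have : pi / 4 / 2 <= sin (pi / 4 : R) by apply: s4; lra.
lra.
Qed.

(** [1 - u s] equals [sin(s/2)^2], and [sin(s/2) >= s / 8]; whence 64. *)
Lemma sqr_le_oneBu s : 0 <= s <= pi -> s ^+ 2 <= 64 * (1 - u s).
Proof.
move=> /andP[s0 s1].
have := @sin_ge_quarter (s / 2); have -> : 0 <= s / 2 <= pi / 2 by lra.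
move=> /(_ isT) h.
have -> : 1 - u s = sin (s / 2) ^+ 2.
  have := cosD (s / 2) (s / 2); rewrite (_ : s / 2 + s / 2 = s); last by field.
  by have := cos2Dsin2 (s / 2); rewrite /u -!expr2; lra.
have h0 : 0 <= s / 2 / 4 by lra.
have : (s / 2 / 4) ^+ 2 <= sin (s / 2) ^+ 2 by rewrite ler_pXn2r ?nnegrE//; lra.
have -> : (s / 2 / 4) ^+ 2 = s ^+ 2 / 64 by field.
lra.
Qed.

(** The kernel at [y - t] and at the sum of the distances of [y] and [t] to [p], that is, after
    reflecting [t] at [p]. The sum of the two is a kernel in the cosines of [[p, p + a]] and the
    difference one in its sines. *)
Let JM K y t : R := u (w * (y - t)) ^+ K.
Let JP K y t : R := u (w * ((y - p) + (t - p))) ^+ K.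

Lemma integ_cosb k : integ p (p + a) (cosb k) = (k == 0)%N%:R * a.
Proof.
rewrite -(integ_cosbB k 0); apply: eq_integ => y _.
by rewrite /cosb subr0.
Qed.

(** The expansions are the addition formulas applied term by term. The bound on the coefficients is
    where positivity enters: for [j > 0], [c j * (a / 2)] is the integral of the kernel against a
    cosine, hence at most its mass [c 0 * a]. *)
Lemma kernel_expansion K : exists c : nat -> R,
  [/\ c 0%N * a = kmass K,
      forall j, (j < K.+1)%N -> c j <= 2 * c 0%N,
      forall y t, JM K y t + JP K y t = \sum_(j < K.+1) 2 * c j * (cosb j y * cosb j t) &
      forall y t, JM K y t - JP K y t = \sum_(j < K.+1) 2 * c j * (sinb j y * sinb j t)].
Proof.
have [c Hc] := cospoly_kernel K.
have cc := cosb_cont.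
have c0 : c 0%N * a = kmass K.
  rewrite /kmass; transitivity (integ p (p + a) (fun t => \sum_(j < K.+1) c j * cosb j t)).
    rewrite (integ_sum _ _ _ _ (F := fun (j : 'I_K.+1) t => c j * cosb j t)); last by move=> j; cont.
    rewrite big_ord_recl big1 ?addr0.
      by rewrite integZ// integ_cosb mul1r.
    by move=> j _; rewrite integZ// integ_cosb mul0r mulr0.
  by apply: eq_integ => t _; rewrite /u Hc; apply: eq_bigr => j _; rewrite /cosb mulrA.
exists c; split => //.
- move=> j jK; case: j jK => [|j] jK; first by have := kmass_gt0 K; rewrite -c0 pmulr_lgt0//; lra.
  have cu := cont_u.
  have e1 : integ p (p + a) (fun t => u (w * (t - p)) ^+ K * cosb j.+1 t) = c j.+1 * (a / 2).
    transitivity (integ p (p + a) (fun t => \sum_(i < K.+1) c i * (cosb i t * cosb j.+1 t))).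
      apply: eq_integ => t _; rewrite /u Hc mulr_suml; apply: eq_bigr => i _.
      by rewrite /cosb mulrA [in RHS]mulrA.
    rewrite (integ_sum _ _ _ _ (F := fun (i : 'I_K.+1) t => c i * (cosb i t * cosb j.+1 t)));
      last by move=> i; cont.
    rewrite (bigD1 (Ordinal jK))//= integZ; last by cont.
    rewrite cosb_ortho ?orbT// eqxx mul1r big1 ?addr0// => i ij.
    rewrite integZ; last by cont.
    rewrite cosb_ortho ?orbT// (_ : (nat_of_ord i == j.+1) = false) ?mul0r ?mulr0//.
    by apply/negbTE.
  have : integ p (p + a) (fun t => u (w * (t - p)) ^+ K * cosb j.+1 t) <= kmass K.
    rewrite /kmass; apply: le_integ; [by cont|by cont|].
    move=> t _; rewrite ler_piMr ?exprn_ge0//; exact: cos_le1.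
  by rewrite e1 -c0 mulrA ler_pdivrMr// mulrAC -ler_pdivlMr// mulfK ?gt_eqF// mulrC.
- move=> y t; rewrite /JM /JP /u !Hc -big_split; apply: eq_bigr => j _.
  rewrite /= -mulrDr /cosb.
  have -> : j%:R * (w * (y - t)) = j%:R * w * (y - p) - j%:R * w * (t - p) by ring.
  have -> : j%:R * (w * (y - p + (t - p))) = j%:R * w * (y - p) + j%:R * w * (t - p) by ring.
  by rewrite cosB cosD; ring.
- move=> y t; rewrite /JM /JP /u !Hc -sumrB; apply: eq_bigr => j _.
  rewrite /= -mulrBr /sinb.
  have -> : j%:R * (w * (y - t)) = j%:R * w * (y - p) - j%:R * w * (t - p) by ring.
  have -> : j%:R * (w * (y - p + (t - p))) = j%:R * w * (y - p) + j%:R * w * (t - p) by ring.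
  by rewrite cosB cosD; ring.
Qed.

Lemma integ_JMP K y : integ p (p + a) (fun t => JM K y t + JP K y t) = 2 * kmass K.
Proof.
have [c [c0 _ HP _]] := kernel_expansion K; have cc := cosb_cont.
transitivity (integ p (p + a) (fun t => \sum_(j < K.+1) (2 * c j * cosb j y) * cosb j t)).
  by apply: eq_integ => t _; rewrite HP; apply: eq_bigr => j _; ring.
rewrite (integ_sum _ _ _ _ (F := fun (j : 'I_K.+1) t => (2 * c j * cosb j y) * cosb j t));
  last by move=> j; cont.
rewrite big_ord_recl big1 ?addr0.
  by rewrite integZ// integ_cosb mul1r -c0 /cosb !mul0r cos0; ring.
by move=> j _; rewrite integZ// integ_cosb mul0r mulr0.
Qed.

(** From [d <= b + d^2 / b] and [d^2 <= 64 / w^2 * (1 - u (w * d))]. It trades a distance for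
    [1 - u], which multiplies the kernel of order [K] into the difference of the kernels of orders
    [K] and [K + 1], whose masses are known. *)
Lemma kernel_near b d : 0 < b -> 0 <= d <= a -> d <= b + 64 / w ^+ 2 * (1 - u (w * d)) / b.
Proof.
move=> b0 /andP[d0 da]; have w0 := w_gt0.
have h : (w * d) ^+ 2 <= 64 * (1 - u (w * d)).
  apply: sqr_le_oneBu; apply/andP; split; first by rewrite mulr_ge0// ltW.
  by rewrite -wa ler_pM2l.
have d2 : d ^+ 2 <= 64 / w ^+ 2 * (1 - u (w * d)).
  by rewrite mulrAC ler_pdivlMr ?exprn_gt0// mulrC -exprMn.
rewrite -lerBlDl ler_pdivlMr//; apply: le_trans d2.
have := sqr_ge0 (d - b); rewrite sqrrB; nra.
Qed.

(* [J(y - t) (g y - g t)^2 + J(y + t) (g y + g t)^2] integrates to the defect in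
   Parseval's identity, up to the weights [c j <= 2 c 0]. *)
Lemma parseval_defect K g (G b : R) : continuous g -> g p = 0 -> g (p + a) = 0 ->
  0 <= G -> 0 < b ->
  (forall y t, p <= y <= p + a -> p <= t <= p + a -> (g y - g t) ^+ 2 <= G * `|y - t|) ->
  integ p (p + a) (fun y => g y ^+ 2) <=
  2 / a * (\sum_(j < K.+1) integ p (p + a) (fun y => g y * sinb j y) ^+ 2) +
  G * a * (b + 64 / w ^+ 2 / (b * (2 * K%:R + 2))).
Proof.
move=> cg g0 ga G0 b0 gG.
have [c [c0 c2 HP HM]] := kernel_expansion K.
have cc := cosb_cont; have cs := sinb_cont.
pose A := 64 / w ^+ 2.
have A0 : 0 <= A by rewrite divr_ge0// sqr_ge0.
have p_a : p <= p + a by rewrite lerDl ltW.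
pose I2 := integ p (p + a) (fun y => g y ^+ 2).
pose h j := integ p (p + a) (fun y => g y * sinb j y).
pose Phi y t := JM K y t * (g y - g t) ^+ 2 + JP K y t * (g y + g t) ^+ 2.
have cJM n y : continuous (JM n y).
  have c1 := @cont_cos_affine w y.
  have -> : JM n y = fun t => ((1 + cos (w * (t - y))) / 2) ^+ n.
    by apply/funext => t; rewrite /JM /u -cosN -mulrN opprB.
  by cont.
have cJP n y : continuous (JP n y).
  have c1 := @cont_cos_affine w (- (y - p) + p).
  have -> : JP n y = fun t => ((1 + cos (w * (t - (- (y - p) + p)))) / 2) ^+ n.
    by apply/funext => t; rewrite /JP /u; congr (((1 + cos (w * _)) / 2) ^+ n); ring.
  by cont.
pose gc j := integ p (p + a) (fun t => g t ^+ 2 * cosb j t).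
have inner y : integ p (p + a) (Phi y) = 2 * kmass K * g y ^+ 2 +
    \sum_(j < K.+1) 2 * c j * gc j * cosb j y -
    \sum_(j < K.+1) 4 * c j * h j * (g y * sinb j y).
  have cM := cJM K y; have cP := cJP K y.
  transitivity (integ p (p + a) (fun t => g y ^+ 2 * (JM K y t + JP K y t) +
      (\sum_(j < K.+1) (2 * c j * cosb j y) * (g t ^+ 2 * cosb j t) -
       \sum_(j < K.+1) (4 * c j * (g y * sinb j y)) * (g t * sinb j t)))).
    apply: eq_integ => t _.
    have -> : \sum_(j < K.+1) (2 * c j * cosb j y) * (g t ^+ 2 * cosb j t) =
       g t ^+ 2 * (JM K y t + JP K y t).
      by rewrite HP mulr_sumr; apply: eq_bigr => j _; ring.
    have -> : \sum_(j < K.+1) (4 * c j * (g y * sinb j y)) * (g t * sinb j t) =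
       2 * (g y * g t) * (JM K y t - JP K y t).
      by rewrite HM mulr_sumr; apply: eq_bigr => j _; ring.
    by rewrite /Phi; ring.
  have s1 : continuous (fun t => \sum_(j < K.+1) (2 * c j * cosb j y) * (g t ^+ 2 * cosb j t)).
    by apply: cont_sum => j; cont.
  have s2 : continuous (fun t => \sum_(j < K.+1) (4 * c j * (g y * sinb j y)) * (g t * sinb j t)).
    by apply: cont_sum => j; cont.
  rewrite integD; [|by cont|by cont]; rewrite integB//.
  rewrite integZ; last by cont.
  rewrite integ_JMP.
  rewrite (integ_sum _ _ _ _ (F := fun (j : 'I_K.+1) t => (2 * c j * cosb j y) * (g t ^+ 2 * cosb j t)));
    last by move=> j; cont.
  rewrite (integ_sum _ _ _ _ (F := fun (j : 'I_K.+1) t => (4 * c j * (g y * sinb j y)) * (g t * sinb j t)));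
    last by move=> j; cont.
  rewrite -addrA; congr (_ + _); first by ring.
  congr (_ - _); apply: eq_bigr => j _; rewrite integZ; try by cont.
    by rewrite /gc; ring.
  by rewrite /h; ring.
have outer : integ p (p + a) (fun y => integ p (p + a) (Phi y)) =
    4 * kmass K * I2 - \sum_(j < K.+1) 4 * c j * h j ^+ 2.
  rewrite (eq_integ (fun y _ => inner y)).
  have s1 : continuous (fun y => \sum_(j < K.+1) 2 * c j * gc j * cosb j y).
    by apply: cont_sum => j; cont.
  have s2 : continuous (fun y => \sum_(j < K.+1) 4 * c j * h j * (g y * sinb j y)).
    by apply: cont_sum => j; cont.
  rewrite integB; [|by cont|by cont]; rewrite integD; [|by cont|by cont].
  rewrite integZ; last by cont.
  rewrite (integ_sum _ _ _ _ (F := fun (j : 'I_K.+1) y => 2 * c j * gc j * cosb j y));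
    last by move=> j; cont.
  rewrite (integ_sum _ _ _ _ (F := fun (j : 'I_K.+1) y => 4 * c j * h j * (g y * sinb j y)));
    last by move=> j; cont.
  rewrite [X in _ + X - _]big_ord_recl [X in _ + (_ + X) - _]big1 ?addr0; last first.
    by move=> j _; rewrite integZ// integ_cosb mul0r mulr0.
  rewrite integZ// integ_cosb mul1r.
  have -> : gc 0%N = I2.
    by apply: eq_integ => t _; rewrite /cosb !mul0r cos0 mulr1.
  congr (_ - _); first by rewrite -c0 /I2 /=; ring.
  apply: eq_bigr => j _; rewrite integZ; last by cont.
  by rewrite -/(h j) expr2; ring.
(* The majorant of [Phi] that results from [kernel_near]: the factor [1 - u] has become a difference
   of consecutive kernels, so that its integral in [t] is explicit and does not depend on [y]. *)
pose Psi y t := 2 * G * b * (JM K y t + JP K y t) +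
  2 * G * (A / b) * ((JM K y t + JP K y t) - (JM K.+1 y t + JP K.+1 y t)).
have PhiPsi y t : p <= y <= p + a -> p <= t <= p + a -> Phi y t <= Psi y t.
  move=> py pt.
  have j0 : 0 <= JM K y t by rewrite exprn_ge0.
  have j1 : 0 <= JP K y t by rewrite exprn_ge0.
  have m1 : (g y - g t) ^+ 2 <= 2 * G * (b + A / b * (1 - u (w * (y - t)))).
    apply: le_trans (gG y t py pt) _.
    have d1 : 0 <= `|y - t| <= a by rewrite normr_ge0 ler_norml; lra.
    have := kernel_near b0 d1.
    have -> : u (w * `|y - t|) = u (w * (y - t)).
      have [s0|s0] := leP 0 (y - t); first by rewrite ger0_norm.
      by rewrite ltr0_norm// mulrN /u cosN.
    rewrite -/A mulrAC => dd; apply: le_trans (ler_wpM2l G0 dd) _.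
    have : 0 <= G * (b + A / b * (1 - u (w * (y - t)))).
      apply: mulr_ge0 => //; apply: addr_ge0; first exact: ltW.
      by apply: mulr_ge0; [exact: divr_ge0 A0 (ltW b0)|rewrite subr_ge0].
    set X := (b + _); lra.
  have m2 : (g y + g t) ^+ 2 <= 2 * G * (b + A / b * (1 - u (w * ((y - p) + (t - p))))).
    (* As [g] vanishes at both ends, each of [g y] and [g t] is a difference with the value at an
       end. The end is chosen so that the sum [d] of the distances of [y] and [t] to it is at most
       [a]; by evenness and periodicity the kernel takes the same value at [d]. *)
    have [d [d1 d2 d3]] : exists d, [/\ 0 <= d <= a, (g y + g t) ^+ 2 <= 2 * G * d &
        u (w * d) = u (w * ((y - p) + (t - p)))].
      have sq (A1 A2 : R) : (A1 + A2) ^+ 2 <= 2 * (A1 ^+ 2 + A2 ^+ 2).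
        by have := sqr_ge0 (A1 - A2); rewrite sqrrB sqrrD; lra.
      have [s0|s0] := leP ((y - p) + (t - p)) a.
        exists ((y - p) + (t - p)); split => //; first by lra.
        apply: le_trans (sq _ _) _.
        have := gG y p py; rewrite lexx lerDl ltW// => /(_ isT).
        have := gG t p pt; rewrite lexx lerDl ltW// => /(_ isT).
        rewrite g0 !subr0 !ger0_norm; [|lra|lra]; nra.
      exists (2 * a - ((y - p) + (t - p))); split.
      - by lra.
      - apply: le_trans (sq _ _) _.
        have := gG y (p + a) py; rewrite lexx lerDl ltW// => /(_ isT).
        have := gG t (p + a) pt; rewrite lexx lerDl ltW// => /(_ isT).
        rewrite ga !subr0 !ler0_norm; [|lra|lra]; nra.
      - rewrite /u mulrBr (_ : w * (2 * a) = pi *+ 2); last by rewrite mulrCA wa mulr_natl.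
        by rewrite -cosN opprB cosB cos2pi sin2pi mulr1 mulr0 addr0.
    apply: le_trans d2 _; have := kernel_near b0 d1; rewrite d3 -/A mulrAC => dd.
    by rewrite ler_wpM2l// mulr_ge0.
  rewrite /Phi /Psi; apply: le_trans (lerD (ler_wpM2l j0 m1) (ler_wpM2l j1 m2)) _.
  rewrite /JM /JP !exprS; set X := _ ^+ K; set Y := _ ^+ K; rewrite le_eqVlt; apply/orP; left.
  by apply/eqP; ring.
(* The masses satisfy [kmass K - kmass K.+1 = kmass K / (2 K + 2)]: this is the source of the decay
   in [K]. *)
have PsiI y : integ p (p + a) (Psi y) =
    4 * G * kmass K * (b + A / (b * (2 * K%:R + 2))).
  have cM := cJM K y; have cP := cJP K y; have cM' := cJM K.+1 y; have cP' := cJP K.+1 y.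
  rewrite /Psi integD; [|by cont|by cont].
  rewrite integZ; last by cont.
  rewrite integZ; last by cont.
  rewrite integB; [|by cont|by cont]; rewrite !integ_JMP.
  have k2 : 2 * K%:R + 2 != 0 :> R by rewrite gt_eqF// ltr_wpDl// mulr_ge0.
  have -> : kmass K.+1 = (2 * K%:R + 1) * kmass K / (2 * K%:R + 2).
    by rewrite -kmassS [X in _ = X / _]mulrC mulfK.
  have bn0 : b != 0 by rewrite gt_eqF.
  by field; rewrite bn0 k2.
have cPhi : continuous (fun y => integ p (p + a) (Phi y)).
  have -> : (fun y => integ p (p + a) (Phi y)) = fun y => 2 * kmass K * g y ^+ 2 +
    \sum_(j < K.+1) 2 * c j * gc j * cosb j y -
    \sum_(j < K.+1) 4 * c j * h j * (g y * sinb j y) by apply/funext.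
  have s1 : continuous (fun y => \sum_(j < K.+1) 2 * c j * gc j * cosb j y).
    by apply: cont_sum => j; cont.
  have s2 : continuous (fun y => \sum_(j < K.+1) 4 * c j * h j * (g y * sinb j y)).
    by apply: cont_sum => j; cont.
  by cont.
have le1 : integ p (p + a) (fun y => integ p (p + a) (Phi y)) <=
   4 * G * kmass K * (b + A / (b * (2 * K%:R + 2))) * a.
  rewrite -[X in _ * X](_ : p + a - p = a); last by ring.
  rewrite -integ_cst//; apply: le_integ => //; first exact: cont_cst.
  move=> y py; rewrite -(PsiI y); apply: le_integ.
  - have := cJM K y; have := cJP K y => ? ?; rewrite /Phi; cont.
  - have := cJM K y; have := cJP K y; have := cJM K.+1 y; have := cJP K.+1 y => ? ? ? ?.
    by rewrite /Psi; cont.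
  - by move=> t pt; exact: PhiPsi.
have c0gt : 0 < c 0%N by have := kmass_gt0 K; rewrite -c0 pmulr_lgt0.
(* With [c j <= 2 * c 0] the weighted sum is at most the plain one, and division by [4 * c 0 * a]
   gives Parseval's constant [2 / a] without loss. *)
have le2 : \sum_(j < K.+1) 4 * c j * h j ^+ 2 <= 8 * c 0%N * \sum_(j < K.+1) h j ^+ 2.
  rewrite mulr_sumr; apply: ler_sum => j _.
  by rewrite ler_wpM2r ?sqr_ge0//; have := c2 j (ltn_ord j); lra.
move: le1 le2; rewrite outer -c0 => le1 le2.
set S := \sum_(j < K.+1) h j ^+ 2 in le2 *; set X := b + _ in le1 *.
have : 4 * c 0%N * (a * I2) <= 4 * c 0%N * (2 * S + G * a ^+ 2 * X).
  have : 4 * (c 0%N * a) * I2 <= 8 * c 0%N * S + 4 * G * (c 0%N * a) * X * a by lra.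
  by congr (_ <= _); ring.
rewrite ler_pM2l ?mulr_gt0// -/I2 => H.
rewrite -(ler_pM2l a_gt0); apply: le_trans H _.
rewrite le_eqVlt; apply/orP; left; apply/eqP; have an0 : a != 0 by rewrite gt_eqF.
by rewrite /X; field; rewrite an0 /=; rewrite !gt_eqF ?w_gt0//= ltr_wpDl// mulr_ge0.
Qed.

End SineSeries.

(** * Cutoffs *)

Section Cutoff.
Context {R : realType}.
Implicit Types (b c f : R -> R) (p q x sg : R).

Lemma continuous_bounded f p q : continuous f ->
  exists2 M : R, 0 <= M & forall x, p <= x <= q -> `|f x| <= M.
Proof.
move=> cf; have c2 : continuous (fun z : R * R => f z.1).
  by apply: cont_comp => //; exact: cont_fst.
have [M HM] := rect_bounded p q 0 0 c2.
exists `|M| => // x pxq; apply: le_trans (ler_norm M).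
by apply: (HM x 0) => //; rewrite lexx.
Qed.

Lemma lipschitz_itv f df p q (M : R) : (forall x, is_derive x 1 f (df x)) -> continuous df ->
  (forall x, p <= x <= q -> `|df x| <= M) ->
  forall x y, p <= x -> x <= y -> y <= q -> `|f y - f x| <= M * (y - x).
Proof.
move=> fd cdf HM x y px xy yq; rewrite -(integ_FTC xy cdf fd).
by apply: integ_norm_le => // t /andP[xt ty]; apply: HM; lra.
Qed.

Lemma is_derive_step_affine (m d x : R) :
  is_derive x 1 (fun t => step (m * t + d)) (m * derive1 step (m * x + d)).
Proof.
have d1 : is_derive x 1 (fun t => m * t + d) m.
  by have := derD (derZ m (derI x)) (derC d x); rewrite addr0 mulr1.
by rewrite mulrC; apply: (derComp d1); exact: (CkSP (step_Ck 1)).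
Qed.

Lemma step_der0 x : x < 0 -> derive1 (@step R) x = 0.
Proof.
move=> x0; apply: is_derive_derive1; apply: der_vanish.
near=> t; apply: step0; apply: ltW; near: t; exact: lt_nbhsl.
Unshelve. all: by end_near.
Qed.

Lemma step_der1 x : 1 < x -> derive1 (@step R) x = 0.
Proof.
move=> x1; apply: is_derive_derive1.
apply: (near_eq_is_derive (f := fun _ : R => 1 : R)).
near=> t; rewrite step1//; apply: ltW; near: t; exact: lt_nbhsr.
Unshelve. all: by end_near.
Qed.

Lemma left_layer : exists2 Ms : R, 0 <= Ms & forall p sg, 0 < sg -> exists s d : R -> R,
  [/\ forall n, Ck n s, forall x, is_derive x 1 s (d x), forall x, 0 <= s x <= 1,
      (forall x, x <= p + sg -> s x = 0) /\ (forall x, p + 2 * sg <= x -> s x = 1) &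
      (forall x, p + 2 * sg < x -> d x = 0) /\ (forall x, `|d x| <= Ms / sg)].
Proof.
have [Ms Ms0 HMs] := @step_der_bounded R.
exists Ms => // p sg sg0; have sgn0 : sg != 0 by rewrite gt_eqF.
have a1 x : sg^-1 * x + (- (p / sg) - 1) = (x - p - sg) / sg by field.
exists (fun x => step (sg^-1 * x + (- (p / sg) - 1))).
exists (fun x => sg^-1 * derive1 step (sg^-1 * x + (- (p / sg) - 1))); split.
- by move=> n; apply: Ck_comp; [exact: step_Ck|exact: Ck_affine].
- by move=> x; exact: is_derive_step_affine.
- by move=> x; exact: step_ge0_le1.
- split=> x h.
    by apply: step0; rewrite a1 ler_pdivrMr// mul0r; lra.
  by apply: step1; rewrite a1 ler_pdivlMr//; lra.
- split=> x => [h|].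
    by rewrite step_der1 ?mulr0// a1 ltr_pdivlMr//; lra.
  rewrite normrM [`|sg^-1|]ger0_norm ?invr_ge0 ?(ltW sg0)// mulrC.
  by apply: ler_wpM2r => //; rewrite invr_ge0 (ltW sg0).
Qed.

Lemma normrM_le (x y M1 M2 : R) : `|x| <= M1 -> `|y| <= M2 -> `|x * y| <= M1 * M2.
Proof. by move=> h1 h2; rewrite normrM; apply: ler_pM. Qed.

(* The derivative of the cutoff costs a factor [1 / sg] on a layer of width
   [sg], where [b = O(sg)]: hence the bound [M] is uniform in [sg]. *)
Lemma cutoff_exists b p q : p < q -> (forall n, Ck n b) -> b p = 0 -> b q = 0 ->
  exists2 M, 0 <= M & forall sg, 0 < sg -> exists c,
  [/\ forall n, Ck n c,
      forall x, ~~ (p + sg <= x <= q - sg) -> c x = 0,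
      forall x, p + 2 * sg < x < q - 2 * sg -> c x = b x /\ derive1 c x = derive1 b x,
      forall x, `|c x| <= M & forall x, `|derive1 c x| <= M].
Proof.
move=> pq cb bp bq.
have db : forall x, is_derive x 1 b (derive1 b x) := CkSP (cb 1).
have cdb : continuous (derive1 b) by case: (cb 1).
have [M0 M00 HM0] := continuous_bounded p q (Ck_continuous (cb 0%N)).
have [M1 M10 HM1] := continuous_bounded p q cdb.
have [Ms Ms0 layer] := left_layer.
have bl x : p <= x <= q -> `|b x| <= M1 * (x - p).
  move=> /andP[px xq]; have := lipschitz_itv db cdb HM1 (lexx p) px xq.
  by rewrite bp subr0.
have br x : p <= x <= q -> `|b x| <= M1 * (q - x).
  move=> /andP[px xq]; have := lipschitz_itv db cdb HM1 px xq (lexx q).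
  by rewrite bq sub0r normrN.
have T0 : 0 <= M1 * Ms by exact: mulr_ge0.
exists (M0 + M1 + 4 * (M1 * Ms)); first by lra.
move=> sg sg0; have sgn0 : sg != 0 by rewrite gt_eqF.
have [s1 [d1 [c1 D1 s1b [s1z s1o] [d1o d1b]]]] := layer p sg sg0.
(* The layer at the right end [q] is a left layer at [- q] composed with [x -> - x]. *)
have [s2 [d2 [c2 D2 s2b [s2z s2o] [d2o d2b]]]] := layer (- q) sg sg0.
pose c x := b x * s1 x * s2 (- x).
have D2' x : is_derive x 1 (fun x => s2 (- x)) (d2 (- x) * -1).
  by apply: (derComp (derN (derI x))); exact: D2.
have dc x : is_derive x 1 c
    ((derive1 b x * s1 x + b x * d1 x) * s2 (- x) + b x * s1 x * (d2 (- x) * -1)).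
  exact: derM (derM (db x) (D1 x)) (D2' x).
have c0 x : ~~ (p + sg <= x <= q - sg) -> c x = 0.
  rewrite negb_and -!ltNge /c => /orP[h|h].
    by rewrite s1z ?mulr0 ?mul0r// ltW.
  by rewrite s2z ?mulr0//; lra.
have s1n x : `|s1 x| <= 1 by have /andP[? ?] := s1b x; rewrite ger0_norm.
have s2n x : `|s2 x| <= 1 by have /andP[? ?] := s2b x; rewrite ger0_norm.
exists c; split => //.
- move=> n; apply: CkM; first by apply: CkM.
  by apply: Ck_comp => //; apply: CkN; exact: Ck_id.
- move=> x /andP[h1 h2]; rewrite (is_derive_derive1 (dc x)) /c.
  rewrite s1o ?s2o ?d1o ?d2o//; [|lra..].
  by rewrite mul0r !mulr0 !mulr1 !addr0.
- move=> x; have [xpq|xpq] := boolP (p + sg <= x <= q - sg); last by rewrite c0// normr0; lra.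
  have h : `|b x| <= M0 by apply: HM0; lra.
  have := normrM_le (normrM_le h (s1n x)) (s2n (- x)).
  rewrite -/(c x); lra.
- move=> x; have [xpq|xpq] := boolP (p + sg <= x <= q - sg); last first.
    by rewrite (derive1_outside c0 xpq) normr0; lra.
  have xpq' : p <= x <= q by lra.
  rewrite (is_derive_derive1 (dc x)).
  have fE : (M1 * (2 * sg)) * (Ms / sg) = 2 * (M1 * Ms) by field.
  have e1 : `|b x * d1 x| <= 2 * (M1 * Ms).
    have [h|h] := leP x (p + 2 * sg); last by rewrite d1o// mulr0 normr0; lra.
    rewrite -fE; apply: normrM_le (d1b x); apply: le_trans (bl x xpq') _.
    by apply: ler_wpM2l => //; lra.
  have e2 : `|b x * d2 (- x)| <= 2 * (M1 * Ms).
    have [h|h] := leP (- x) (- q + 2 * sg); last by rewrite d2o// mulr0 normr0; lra.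
    rewrite -fE; apply: normrM_le (d2b _); apply: le_trans (br x xpq') _.
    by apply: ler_wpM2l => //; lra.
  have t1 := normrM_le (normrM_le (HM1 x xpq') (s1n x)) (s2n (- x)).
  have t2 := normrM_le e1 (s2n (- x)); have t3 := normrM_le e2 (s1n x).
  rewrite (_ : _ + _ = derive1 b x * s1 x * s2 (- x) + (b x * d1 x) * s2 (- x) -
    (b x * d2 (- x)) * s1 x); last by ring.
  apply: le_trans (ler_normB _ _) _; apply: le_trans (lerD (ler_normD _ _) (lexx _)) _.
  lra.
Qed.

(** The integrands for [b] and for its cutoff differ only on two layers of width [2 sg] at the ends.
    The difference is bounded there by a [T] independent of [sg], thanks to the uniform bound [M],
    so it contributes at most [4 T sg]. *)
Lemma cutoff_limit b p q (M N : R) (A B : R -> R) : p < q -> (forall n, Ck n b) ->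
  continuous A -> continuous B -> 0 <= M ->
  (forall sg, 0 < sg -> exists c,
  [/\ forall n, Ck n c,
      forall x, ~~ (p + sg <= x <= q - sg) -> c x = 0,
      forall x, p + 2 * sg < x < q - 2 * sg -> c x = b x /\ derive1 c x = derive1 b x,
      (forall x, `|c x| <= M) /\ (forall x, `|derive1 c x| <= M) &
      `|integ p q (fun x => derive1 c x * A x + c x * B x)| <= N]) ->
  `|integ p q (fun x => derive1 b x * A x + b x * B x)| <= N.
Proof.
move=> pq cb cA cB M0 H.
have cb0 := Ck_continuous (cb 0%N).
have cdb : continuous (derive1 b) by case: (cb 1).
have [MA MA0 HMA] := continuous_bounded p q cA.
have [MB MB0 HMB] := continuous_bounded p q cB.
have [M1 M10 HM1] := continuous_bounded p q cb0.
have [M2 M20 HM2] := continuous_bounded p q cdb.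
pose T := (M + M2) * MA + (M + M1) * MB.
have T0 : 0 <= T by rewrite addr_ge0// mulr_ge0// addr_ge0.
apply/ler_addgt0Pr => e e0.
(* The first entry keeps the two layers apart, the second makes their contribution at most [e]; the
   added 1 covers [T = 0]. *)
pose sg := Num.min ((q - p) / 8) (e / (4 * T + 1)).
have sg0 : 0 < sg by rewrite lt_min !divr_gt0//; [lra|lra].
have sg1 : sg <= (q - p) / 8 by rewrite ge_min lexx.
have sg2 : 4 * T * sg <= e.
  have : sg <= e / (4 * T + 1) by rewrite ge_min lexx orbT.
  rewrite ler_pdivlMr; [nra|lra].
have [c [cc c0 cE [c1 c2] cN]] := H sg sg0.
have cc0 := Ck_continuous (cc 0%N).
have cdc : continuous (derive1 c) by case: (cc 1).
pose F x := (derive1 c x - derive1 b x) * A x + (c x - b x) * B x.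
have cF : continuous F by rewrite /F; cont.
have FT x : p <= x <= q -> `|F x| <= T.
  move=> xpq; apply: le_trans (ler_normD _ _) _; rewrite !normrM; apply: lerD.
    exact: ler_pM (le_trans (ler_normB _ _) (lerD (c2 x) (HM2 x xpq))) (HMA x xpq).
  exact: ler_pM (le_trans (ler_normB _ _) (lerD (c1 x) (HM1 x xpq))) (HMB x xpq).
have F0 x : p + 2 * sg < x < q - 2 * sg -> F x = 0.
  by move=> h; have [E1 E2] := cE x h; rewrite /F E1 E2 !subrr !mul0r addr0.
have mid : integ (p + 2 * sg) (q - 2 * sg) F = 0.
  rewrite /integ -Rintegral_itv_obnd_cbnd; last first.
    apply: integrableS (continuous_integrable (p + 2 * sg) (q - 2 * sg) cF) => //.
    by apply: subset_itvr; rewrite bnd_simp.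
  rewrite -Rintegral_itv_bndo_bndc; last first.
    apply: integrableS (continuous_integrable (p + 2 * sg) (q - 2 * sg) cF) => //.
    by apply: subset_itvW.
  rewrite -[RHS](integ0 0 1) /integ /Rintegral; congr fine.
  rewrite [RHS]integral0; apply: integral0_eq => x /=; rewrite in_itv/= => h.
  by rewrite F0.
have FI : `|integ p q F| <= 4 * T * sg.
  rewrite (@integ_split _ p (p + 2 * sg) q)//; last by lra.
  rewrite (@integ_split _ (p + 2 * sg) (q - 2 * sg) q)//; last by lra.
  rewrite mid add0r; apply: le_trans (ler_normD _ _) _.
  have h1 : `|integ p (p + 2 * sg) F| <= T * (p + 2 * sg - p).
    by apply: integ_norm_le => //; [lra|move=> x h; apply: FT; lra].
  have h2 : `|integ (q - 2 * sg) q F| <= T * (q - (q - 2 * sg)).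
    by apply: integ_norm_le => //; [lra|move=> x h; apply: FT; lra].
  lra.
have -> : integ p q (fun x => derive1 b x * A x + b x * B x) =
  integ p q (fun x => derive1 c x * A x + c x * B x) - integ p q F.
  rewrite -integB; [|by cont|by []].
  by apply: eq_integ => x _; rewrite /F; ring.
apply: le_trans (ler_normB _ _) _; lra.
Qed.

End Cutoff.

(** * Fibered test functions *)

Lemma form_continuous (R : realType) (a1 a2 b1 b2 c1 c2 : R * R -> R) (E : R) :
  continuous a1 -> continuous a2 -> continuous b1 -> continuous b2 ->
  continuous c1 -> continuous c2 ->
  continuous (fun z => a1 z * a2 z + b1 z * b2 z - E * (c1 z * c2 z)).
Proof. by move=> ? ? ? ? ? ?; cont. Qed.

Section FiberedTest.
Context {R : realType}.
Variables (B0 B1 L0 cL gamma : R) (L : R -> R).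
Hypothesis HL : billiard_profile B0 B1 L0 cL gamma L.
Let D : set (R * R) := billiard B0 B1 L.

Variables (p q : R) (l dl : R -> R).
Hypotheses (pq : p < q) (Bp : - B0 <= p) (qB : q <= B1).
Hypotheses (l_gt0 : forall x, 0 < l x) (l_le : forall x, l x <= L0).
Hypotheses (dll : forall x : R, is_derive x 1 l (dl x)) (cdl : continuous dl).
Hypothesis l_smooth : forall n x, p < x < q -> derivable (derive1n n l) x 1.
Hypothesis l_D : forall x y, p < x < q -> 0 < y < l x -> D (x, y).

(** On the whole line [l] is only [C^1]; its higher derivatives are uncontrolled at [p] and [q].
    Away from these ends it is kept, and near them it is blended into the constant [L0]; a convex
    combination of [l] and [L0] stays positive. *)
Lemma smooth_extension sg : 0 < sg -> exists m : R -> R,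
  [/\ forall n, Ck n m, forall x, 0 < m x & forall x, p + sg <= x <= q - sg -> m x = l x].
Proof.
move=> sg0; have sgn0 : sg != 0 by rewrite gt_eqF.
have L00 : 0 < L0 := lt_le_trans (l_gt0 0) (l_le 0).
pose h := sg / 2; have h0 : 0 < h by rewrite /h; lra.
have hn0 : h != 0 by rewrite gt_eqF.
pose s1 x := step (h^-1 * x + (- (p / h) - 1)).
pose s2 x := step ((- h^-1) * x + (q / h - 1)).
have a1 x : h^-1 * x + (- (p / h) - 1) = (x - p - h) / h by field.
have a2 x : (- h^-1) * x + (q / h - 1) = (q - x - h) / h by field.
pose c x := s1 x * s2 x.
have c01 x : 0 <= c x <= 1.
  have /andP[u1 u2] := step_ge0_le1 (h^-1 * x + (- (p / h) - 1)).
  have /andP[v1 v2] := step_ge0_le1 ((- h^-1) * x + (q / h - 1)).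
  by rewrite /c mulr_ge0//= mulr_ile1.
have c0 x : ~~ (p + h <= x <= q - h) -> c x = 0.
  rewrite negb_and -!ltNge /c /s1 /s2 => /orP[H|H].
    by rewrite (step0 (x := _ + _)) ?mul0r// a1 ler_pdivrMr// mul0r; lra.
  by rewrite [X in _ * X]step0 ?mulr0// a2 ler_pdivrMr// mul0r; lra.
have cc n : Ck n c.
  by apply: CkM; apply: Ck_comp; do ?[exact: step_Ck]; exact: Ck_affine.
exists (fun x => L0 + c x * (l x - L0)); split.
- move=> n; apply: CkD; first exact: Ck_cst.
  apply: (@Ck_cutoffM _ p q (p + h) (q - h) c (fun x => l x - L0)); [exact: cc|lra|lra|exact: c0|].
  move=> [|m] x xpq.
    exact: (@ex_derive _ _ _ _ _ _ _ (derD (dll x) (derC (- L0) x))).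
  have -> : derive1n m.+1 (fun x => l x - L0) = derive1n m.+1 l.
    rewrite !derive1Sn; congr (derive1n m _); apply/funext => t.
    rewrite (is_derive_derive1 (dll t)); apply: is_derive_derive1.
    by have := derD (dll t) (derC (- L0) t); rewrite addr0.
  exact: l_smooth.
- move=> x; have /andP[u1 u2] := c01 x.
  have -> : L0 + c x * (l x - L0) = (1 - c x) * L0 + c x * l x by ring.
  have [c1|c1] := ltP (c x) 1.
    by apply: ltr_pwDl; [rewrite mulr_gt0// subr_gt0|rewrite mulr_ge0// ltW].
  have -> : c x = 1 by apply/eqP; rewrite eq_le u2 c1.
  by rewrite subrr mul0r add0r mul1r.
- move=> x xpq; rewrite /c /s1 /s2 !step1 ?a1 ?a2 ?ler_pdivlMr//; rewrite /h; [by ring|lra|lra].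
Qed.

Lemma fibered_test (c s : R -> R) sg tau : (forall n, Ck n c) -> (forall n, Ck n s) ->
  0 < sg -> 0 < tau ->
  (forall x, ~~ (p + sg <= x <= q - sg) -> c x = 0) ->
  (forall t, ~~ (tau <= t <= 1 - tau) -> s t = 0) ->
  test_function D (fun z => c z.1 * s (z.2 / l z.1)).
Proof.
move=> cc cs sg0 tau0 c0 s0.
have sg20 : 0 < sg / 2 by lra.
have [m [cm m0 mE]] := smooth_extension sg20.
have -> : (fun z : R * R => c z.1 * s (z.2 / l z.1)) = (fun z => c z.1 * s (z.2 / m z.1)).
  apply/funext => -[x y] /=; have [xpq|xpq] := boolP (p + sg <= x <= q - sg).
    by rewrite mE//; lra.
  by rewrite c0// !mul0r.
apply: (@test_function_fibered R D c s m (p + sg / 2) (p + sg) (q - sg) (q - sg / 2) tau) => //.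
- by lra.
- by lra.
- by move=> x y xpq; rewrite mE => [h|]; [apply: l_D => //; lra|lra].
Qed.

Hypothesis l_int : forall x y, p <= x <= q -> interior D (x, y) -> 0 < y < l x.

(** Over [[p, q]] the support is compact, and [y] and [l x - y] are continuous and positive on it,
    hence bounded below. The margin leaves room to cut [S] off near 0 and 1 without affecting the
    pairing with [phi]. *)
Lemma support_margin phi : test_function D phi -> exists2 tau, 0 < tau &
  forall x y, p <= x <= q -> closure [set z | phi z != 0] (x, y) ->
    tau <= y <= l x - tau.
Proof.
move=> [_ cpt sD].
have cl1 : continuous (fun z : R * R => l z.1).
  by apply: cont_comp; [exact: der_cont dll|exact: cont_fst].
have c1 := @cont_fst R; have c2 := @cont_snd R.
have c3 : continuous (fun z : R * R => l z.1 - z.2) by cont.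
pose K : set (R * R) := closure [set z | phi z != 0] `&` [set z | p <= z.1 <= q].
have cK : compact K.
  apply: (@subclosed_compact _ _ (closure [set z | phi z != 0])) => //; last by move=> z [].
  apply: closedI; first exact: closed_closure.
  have -> : [set z : R * R | p <= z.1 <= q] = ((fun z => z.1) @^-1` [set t | p <= t]) `&`
                 ((fun z => z.1) @^-1` [set t | t <= q]).
    by apply/seteqP; split => z /=; [move=> /andP[-> ->]|move=> [-> ->]].
  by apply: closedI; apply: preimage_closed.
have pos (h : R * R -> R) : continuous h -> (forall z, K z -> 0 < h z) ->
    exists2 tau, 0 < tau & forall z, K z -> tau <= h z.
  move=> ch h0.
  (* The bound comes from 0 lying off the closed set [h(K)] rather than from a minimum, so that an
     empty [K] is covered. *)
  have cH : compact (h @` K) by apply: continuous_compact => //; exact: continuous_subspaceT.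
  have clH : closed (h @` K) by apply: compact_closed => //; exact: Rhausdorff.
  have n0 : (~` (h @` K)) 0 by move=> [z Kz /eqP]; rewrite gt_eqF// h0.
  have /nbhs_ballP[e /= e0 He] : nbhs 0 (~` (h @` K)).
    by apply: open_nbhs_nbhs; split => //; exact: closed_openC.
  exists e => // z Kz; rewrite leNgt; apply/negP => hz.
  apply: (He (h z)); last by exists z.
  by rewrite /ball/= sub0r normrN gtr0_norm// h0.
have [t1 t10 H1] := pos _ c2 (fun z Kz => (andP (l_int (x := z.1) (y := z.2) Kz.2
  (sD _ (eq_ind _ _ Kz.1 _ (surjective_pairing z))))).1).
have [t2 t20 H2] : exists2 tau, 0 < tau & forall z, K z -> tau <= l z.1 - z.2.
  apply: pos => // -[x y] [k1 k2]; rewrite subr_gt0.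
  by have /andP[] := l_int k2 (sD _ k1).
exists (Num.min t1 t2); first by rewrite lt_min t10.
move=> x y xpq xy; have h1 := H1 (x, y) (conj xy xpq); have h2 := H2 (x, y) (conj xy xpq).
rewrite /= in h1 h2; rewrite ge_min h1/=.
have : Num.min t1 t2 <= t2 by rewrite ge_min lexx orbT.
lra.
Qed.

Variable E : R.
Hypothesis E_ge0 : 0 <= E.
Variables (b S : R -> R).
Hypotheses (cb : forall n, Ck n b) (cS : forall n, Ck n S).
Hypotheses (bp : b p = 0) (bq : b q = 0) (S0 : S 0 = 0) (S1 : S 1 = 0).

(* The densities against [b'] and [b] in the quadratic form tested on
   [b(x) S(y / l(x))]. *)
Definition densA (phix : R * R -> R) : R -> R :=
  fun x => integ 0 L0 (fun y => phix (x, y) * S (y / l x)).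

Definition densB (phi phix phiy : R * R -> R) : R -> R :=
  fun x => integ 0 L0 (fun y =>
    - (phix (x, y) * (derive1 S (y / l x) * (y * (dl x / l x ^+ 2))))
    + phiy (x, y) * (derive1 S (y / l x) / l x) - E * (phi (x, y) * S (y / l x))).

Let integrandA (phix : R * R -> R) : R * R -> R := fun z => phix z * S (z.2 / l z.1).
Let integrandB (phi phix phiy : R * R -> R) : R * R -> R := fun z =>
   - (phix z * (derive1 S (z.2 / l z.1) * (z.2 * (dl z.1 / l z.1 ^+ 2))))
    + phiy z * (derive1 S (z.2 / l z.1) / l z.1) - E * (phi z * S (z.2 / l z.1)).

Let cont_l1 : continuous (fun z : R * R => l z.1).
Proof. by apply: cont_comp; [exact: der_cont dll|exact: cont_fst]. Qed.
Let cont_dl1 : continuous (fun z : R * R => dl z.1).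
Proof. by apply: cont_comp; [exact: cdl|exact: cont_fst]. Qed.
Let cont_iv : continuous (fun z : R * R => (l z.1)^-1).
Proof. by apply: contV => // z; rewrite gt_eqF. Qed.
Let cont_iv2 : continuous (fun z : R * R => (l z.1 ^+ 2)^-1).
Proof.
apply: contV; first by have := cont_l1 => ?; cont.
by move=> z; rewrite gt_eqF ?exprn_gt0.
Qed.
Let cont_ratio : continuous (fun z : R * R => z.2 / l z.1).
Proof. by have c1 := @cont_snd R; have c2 := cont_iv; cont. Qed.
Let cont_S1 : continuous (fun z : R * R => S (z.2 / l z.1)).
Proof. by apply: cont_comp cont_ratio; exact: Ck_continuous (cS 0%N). Qed.
Let cont_S2 : continuous (fun z : R * R => derive1 S (z.2 / l z.1)).
Proof. by apply: cont_comp cont_ratio; case: (cS 1). Qed.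

Let cont_integrandA phix : continuous phix -> continuous (integrandA phix).
Proof. by move=> c; have c1 := cont_S1; rewrite /integrandA; cont. Qed.

Let cont_integrandB phi phix phiy : continuous phi -> continuous phix -> continuous phiy ->
  continuous (integrandB phi phix phiy).
Proof.
move=> c1 c2 c3; have c4 := cont_S1; have c5 := cont_S2; have c6 := cont_iv.
by have c7 := cont_iv2; have c8 := cont_dl1; have c9 := @cont_snd R; rewrite /integrandB; cont.
Qed.

Lemma densA_cont phix : continuous phix -> continuous (densA phix).
Proof. by move=> c; exact: (@integ_param_continuous _ _ 0 L0 (cont_integrandA c)). Qed.

Lemma densB_cont phi phix phiy : continuous phi -> continuous phix -> continuous phiy ->
  continuous (densB phi phix phiy).
Proof. by move=> c1 c2 c3; exact: (@integ_param_continuous _ _ 0 L0 (cont_integrandB c1 c2 c3)). Qed.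

Definition fibered_psi (c s : R -> R) : R * R -> R := fun z => c z.1 * s (z.2 / l z.1).

Lemma fibered_psi_dx (c s : R -> R) (x y : R) : (forall n, Ck n c) -> (forall n, Ck n s) ->
  'D_dirx (fibered_psi c s) (x, y) =
  derive1 c x * s (y / l x) - c x * (derive1 s (y / l x) * (y * (dl x / l x ^+ 2))).
Proof.
move=> cc cs; suff : is_derive (x, y) dirx (fibered_psi c s)
  (derive1 c x * s (y / l x) - c x * (derive1 s (y / l x) * (y * (dl x / l x ^+ 2)))).
  by move=> ?; rewrite derive_val.
apply/is_derive_dirx.
have ln0 : l x != 0 by rewrite gt_eqF.
have d1 : is_derive x 1 (fun t => y / l t) (y * - (dl x / l x ^+ 2)).
  by have := derZ y (derV (dll x) ln0).
have d2 : is_derive x 1 (fun t => s (y / l t)) (derive1 s (y / l x) * (y * - (dl x / l x ^+ 2))).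
  by apply: (derComp d1); exact: (CkSP (cs 1)).
have := derM (CkSP (cc 1) x) d2; congr is_derive; ring.
Qed.

Lemma fibered_psi_dy (c s : R -> R) (x y : R) : (forall n, Ck n c) -> (forall n, Ck n s) ->
  'D_diry (fibered_psi c s) (x, y) = c x * (derive1 s (y / l x) / l x).
Proof.
move=> cc cs; suff : is_derive (x, y) diry (fibered_psi c s) (c x * (derive1 s (y / l x) / l x)).
  by move=> ?; rewrite derive_val.
apply/is_derive_diry.
have d1 : is_derive y 1 (fun t => t / l x) ((l x)^-1).
  have := derZ (l x)^-1 (derI y); rewrite mulr1.
  by congr is_derive; apply/funext => t; rewrite mulrC.
apply: (derZ (c x)); apply: (derComp d1); exact: (CkSP (cs 1)).
Qed.

Notation N phi psi := (IT B0 B1 L0 (fun z => 'D_dirx phi z * 'D_dirx psi z +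
  'D_diry phi z * 'D_diry psi z - E * (phi z * psi z))).

Lemma test_closure_vanish phi z : test_function D phi ->
  ~ closure [set z | phi z != 0] z ->
  [/\ phi z = 0, 'D_dirx phi z = 0 & 'D_diry phi z = 0].
Proof.
move=> tp nz.
have n0 : \forall t \near z, phi t = 0.
  have : nbhs z (~` closure [set z | phi z != 0]).
    by apply: open_nbhs_nbhs; split => //; apply: closed_openC; exact: closed_closure.
  apply: filterS => t nt; apply/eqP/negPn/negP => pt; apply: nt.
  exact: subset_closure.
have d v : is_derive z v phi 0.
  apply: (near_eq_is_derive (f := fun _ => 0)).
  by apply: filterS n0 => t ->.
by split; [exact: nbhs_singleton n0| |]; exact: derive_val.
Qed.

(** On the support of [phi] the ratio [y / l x] lies between [tau / L0] and [1 - tau / L0], as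
    [l <= L0]; there [s] and [S] agree together with their derivatives. Off the support [phi] and
    its gradient vanish. *)
Lemma fibered_form phi c s tau sg : test_function D phi ->
  (forall n, Ck n c) -> (forall n, Ck n s) -> 0 < tau ->
  (forall x y, p <= x <= q -> closure [set z | phi z != 0] (x, y) -> tau <= y <= l x - tau) ->
  0 < sg -> (forall x, ~~ (p + sg <= x <= q - sg) -> c x = 0) ->
  (forall t, tau / L0 <= t <= 1 - tau / L0 -> s t = S t /\ derive1 s t = derive1 S t) ->
  test_function D (fibered_psi c s) ->
  N phi (fibered_psi c s) =
  integ p q (fun x => derive1 c x * densA ('D_dirx phi) x +
    c x * densB phi ('D_dirx phi) ('D_diry phi) x).
Proof.
move=> tp cc cs tau0 Htau sg0 c0 sE tps.
have L00 : 0 < L0 := lt_le_trans (l_gt0 0) (l_le 0).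
have c'0 := derive1_outside c0.
pose F (z : R * R) : R := 'D_dirx phi z * 'D_dirx (fibered_psi c s) z +
  'D_diry phi z * 'D_diry (fibered_psi c s) z - E * (phi z * fibered_psi c s z).
have F0 x y : ~~ (p + sg <= x <= q - sg) -> F (x, y) = 0.
  move=> h; rewrite /F fibered_psi_dx// fibered_psi_dy// /fibered_psi/= c0// c'0//.
  by ring.
have t1 := test_derive tp (or_introl erefl); have t2 := test_derive tp (or_intror erefl).
have k0 := test_continuous tp; have k1 := test_continuous t1; have k2 := test_continuous t2.
have cA := densA_cont k1; have cB := densB_cont k0 k1 k2.
have cc0 := Ck_continuous (cc 0%N).
have cdc : continuous (derive1 c) by case: (cc 1).
have inner x : p <= x <= q -> integ 0 L0 (fun y => F (x, y)) =
    derive1 c x * densA ('D_dirx phi) x + c x * densB phi ('D_dirx phi) ('D_diry phi) x.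
  move=> xpq; rewrite /densA /densB.
  have cAx := @cont_pair2 _ _ x (cont_integrandA k1).
  have cBx := @cont_pair2 _ _ x (cont_integrandB k0 k1 k2).
  rewrite /integrandA /integrandB /= in cAx cBx.
  rewrite -(integZ _ _ _ cAx) -(integZ _ _ _ cBx) -integD;
    [|exact: contM (@cont_cst _ _ _) cAx|exact: contM (@cont_cst _ _ _) cBx].
  apply: eq_integ => y _; rewrite /F fibered_psi_dx// fibered_psi_dy// /fibered_psi/=.
  have [cxy|cxy] := pselect (closure [set z | phi z != 0] (x, y)); last first.
    by have [-> -> ->] := test_closure_vanish tp cxy; rewrite !mul0r; ring.
  have /andP[y1 y2] := Htau x y xpq cxy.
  have lx := l_gt0 x; have lL := l_le x.
  have [-> ->] : s (y / l x) = S (y / l x) /\ derive1 s (y / l x) = derive1 S (y / l x).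
    apply: sE.
    have h : tau / L0 <= tau / l x by apply: ler_wpM2l; [exact: ltW|rewrite lef_pV2 ?posrE].
    have h1 : tau / l x <= y / l x by rewrite ler_pM2r ?invr_gt0.
    have h2 : y / l x <= (l x - tau) / l x by rewrite ler_pM2r ?invr_gt0.
    have h3 : (l x - tau) / l x = 1 - tau / l x by rewrite mulrBl divff ?gt_eqF.
    lra.
  ring.
have cIF : continuous (fun x => integ 0 L0 (fun y => F (x, y))).
  apply: (@integ_param_continuous _ F).
  have v0 := test_continuous tps.
  have v1 := test_continuous (test_derive tps (or_introl erefl)).
  have v2 := test_continuous (test_derive tps (or_intror erefl)).
  exact: (@form_continuous _ _ _ _ _ _ _ E k1 v1 k2 v2 k0 v0).
transitivity (integ (- B0) B1 (fun x => integ 0 L0 (fun y => F (x, y)))); first exact: erefl.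
have h1 : - B0 <= p <= B1 by rewrite Bp (le_trans (ltW pq) qB).
have h2 : p <= q <= B1 by rewrite (ltW pq) qB.
rewrite (@integ_split _ _ _ _ _ cIF h1) (@integ_split _ _ _ _ _ cIF h2).
have z1 : integ (- B0) p (fun x => integ 0 L0 (fun y => F (x, y))) = 0.
  rewrite -[RHS](integ0 (- B0) p); apply: eq_integ => x h.
  by rewrite -[RHS](integ0 0 L0); apply: eq_integ => y _; apply: F0; lra.
have z2 : integ q B1 (fun x => integ 0 L0 (fun y => F (x, y))) = 0.
  rewrite -[RHS](integ0 q B1); apply: eq_integ => x h.
  by rewrite -[RHS](integ0 0 L0); apply: eq_integ => y _; apply: F0; lra.
rewrite z1 z2 add0r addr0; exact: eq_integ.
Qed.

(** The last property of [eigen_approx], for the fixed energy [E]: [phi] solves the weak equation up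
    to [eta], measured by the [H^1] size of the test function. *)
Definition near_solution (phi : R * R -> R) (eta : R) : Prop := forall psi, test_function D psi ->
  `|N phi psi| <= eta * (Num.sqrt (ip D ('D_dirx psi) ('D_dirx psi)) +
     Num.sqrt (ip D ('D_diry psi) ('D_diry psi)) + E * Num.sqrt (ip D psi psi)).

Lemma sqrt_ip_le psi (M : R) : 0 <= M -> test_function D psi -> (forall z, `|psi z| <= M) ->
  Num.sqrt (ip D psi psi) <= M * Num.sqrt (L0 * (B1 + B0)).
Proof.
move=> M0 tp H; have cp := test_continuous tp.
rewrite (ip_test HL cp tp).
have h : IT B0 B1 L0 (fun z => psi z * psi z) <= M ^+ 2 * (L0 * (B1 + B0)).
  apply: (IT_le_cst HL); first by cont.
  by move=> z; rewrite -expr2 -real_normK ?num_real// ler_sqr ?nnegrE.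
have A0 : 0 <= L0 * (B1 + B0).
  have h1 := profile_L0_gt0 HL; have h2 := profile_B0_gt0 HL; have h3 := profile_B1_gt0 HL.
  by rewrite mulr_ge0 ?addr_ge0 ?ltW.
apply: le_trans (ler_wsqrtr h) _.
by rewrite sqrtrM ?sqr_ge0// sqrtr_sqr ger0_norm.
Qed.

(** The constant has to be chosen before [phi], whereas the cutoff of [S] depends on the margin of
    the support of [phi]. This is possible because the cutoffs and their derivatives are bounded
    uniformly in the layer width. The cutoff in [y] changes nothing in the pairing; the one in [x]
    is removed by [cutoff_limit]. *)
Lemma fibered_bound : exists2 C, 0 <= C & forall phi eta, test_function D phi ->
  0 <= eta -> near_solution phi eta ->
  `|integ p q (fun x => derive1 b x * densA ('D_dirx phi) x +
      b x * densB phi ('D_dirx phi) ('D_diry phi) x)| <= eta * C.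
Proof.
have L00 : 0 < L0 := lt_le_trans (l_gt0 0) (l_le 0).
have [Mb Mb0 cutb] := cutoff_exists pq cb bp bq.
have [Ms Ms0 cuts] := cutoff_exists ltr01 cS S0 S1.
have ci : continuous (fun x => (l x)^-1).
  by apply: contV => [|x]; [exact: der_cont dll|rewrite gt_eqF].
have cm : continuous (fun x => dl x / l x ^+ 2).
  have cl := der_cont dll; apply: contM; first by [].
  by apply: contV => [|x]; [cont|rewrite gt_eqF ?exprn_gt0].
have [Mi Mi0 HMi] := continuous_bounded p q ci.
have [Mm Mm0 HMm] := continuous_bounded p q cm.
pose M0 := Mb * Ms; pose M2 := Mb * (Ms * Mi); pose M1 := M0 + Mb * (Ms * (L0 * Mm)).
have M00 : 0 <= M0 by rewrite mulr_ge0.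
have M20 : 0 <= M2 by rewrite !mulr_ge0.
have M10 : 0 <= M1 by rewrite addr_ge0// !mulr_ge0// ltW.
pose A := Num.sqrt (L0 * (B1 + B0)).
exists (M1 * A + M2 * A + E * (M0 * A)).
  by rewrite !addr_ge0// !mulr_ge0// sqrtr_ge0.
move=> phi eta tp eta0 ns.
have [tau tau0 Htau] := support_margin tp.
have k0 := test_continuous tp.
have k1 := test_continuous (test_derive tp (or_introl erefl)).
have k2 := test_continuous (test_derive tp (or_intror erefl)).
(* Layers end at twice this width, thus strictly below the margin [tau / L0]. *)
have t40 : 0 < tau / (4 * L0) by rewrite divr_gt0// mulr_gt0.
have [s [cs s0 sE s1 s2]] := cuts _ t40.
have s'0 := derive1_outside s0.
apply: (@cutoff_limit _ b p q Mb _ _ _ pq cb (densA_cont k1) (densB_cont k0 k1 k2) Mb0).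
move=> sg sg0; have [c [cc c0 cE c1 c2]] := cutb sg sg0.
have c'0 := derive1_outside c0.
exists c; split => //.
have tps : test_function D (fibered_psi c s).
  apply: (fibered_test cc cs sg0 t40 c0) => t h; apply: s0.
  by move: h; rewrite add0r.
rewrite -(fibered_form tp cc cs tau0 Htau sg0 c0 _ tps); last first.
  move=> t ht; apply: sE; have e : tau / L0 = 4 * (tau / (4 * L0)) by field; rewrite gt_eqF.
  by rewrite e in ht; lra.
apply: le_trans (ns _ tps) _; apply: ler_wpM2l => //.
have out x y : ~~ (0 <= y <= L0) -> s (y / l x) = 0 /\ derive1 s (y / l x) = 0.
  move=> h; have lx := l_gt0 x; have lL := l_le x.
  suff h2 : ~~ (0 + tau / (4 * L0) <= y / l x <= 1 - tau / (4 * L0)) by rewrite s0// s'0.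
  apply/negP => /andP[h3 h4]; move/negP: h; apply; apply/andP; split.
    have h5 : 0 <= y / l x by lra.
    by move: h5; rewrite ler_pdivlMr// mul0r.
  have h5 : y / l x <= 1 by lra.
  by move: h5; rewrite ler_pdivrMr// mul1r => h6; lra.
have b0 z : `|fibered_psi c s z| <= M0 by apply: normrM_le.
have outx x : ~~ (p + sg <= x <= q - sg) -> c x = 0 /\ derive1 c x = 0.
  by move=> h; rewrite c0// c'0.
have inx x : p + sg <= x <= q - sg -> p <= x <= q by move=> h; lra.
have b2 z : `|'D_diry (fibered_psi c s) z| <= M2.
  case: z => x y; rewrite fibered_psi_dy//.
  have [h|h] := boolP (p + sg <= x <= q - sg); last first.
    by have [-> _] := outx x h; rewrite mul0r normr0.
  by apply: normrM_le => //; apply: normrM_le => //; apply: HMi; exact: inx.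
have b1 z : `|'D_dirx (fibered_psi c s) z| <= M1.
  case: z => x y; rewrite fibered_psi_dx//.
  have [h|h] := boolP (p + sg <= x <= q - sg); last first.
    by have [-> ->] := outx x h; rewrite !mul0r subr0 normr0.
  have [hy|hy] := boolP (0 <= y <= L0); last first.
    by have [-> ->] := out x y hy; rewrite mul0r !mulr0 subr0 normr0.
  apply: le_trans (ler_normB _ _) _; apply: lerD; first by apply: normrM_le.
  apply: normrM_le => //; apply: normrM_le => //; apply: normrM_le; last first.
    by apply: HMm; exact: inx.
  by have /andP[y0 yL] := hy; rewrite ger0_norm.
have u1 := test_derive tps (or_introl erefl); have u2 := test_derive tps (or_intror erefl).
have r0 := sqrt_ip_le M00 tps b0; have r1 := sqrt_ip_le M10 u1 b1; have r2 := sqrt_ip_le M20 u2 b2.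
apply: lerD; first by apply: lerD.
exact: ler_wpM2l.
Qed.

End FiberedTest.

(** * Transverse modes *)

Section ModeBound.
Context {R : realType}.
Variables (B0 B1 L0 cL gamma : R) (L : R -> R).
Hypothesis HL : billiard_profile B0 B1 L0 cL gamma L.
Let D : set (R * R) := billiard B0 B1 L.

Lemma test_vanish_top phi (x : R) : test_function D phi -> phi (x, L0) = 0.
Proof.
move=> tp; apply: (test_vanish tp) => /interior_billiard[/andP[x1 x2] _].
by apply/negP; rewrite -leNgt; apply: (profile_le_L0 HL); rewrite x2 ltW.
Qed.

Lemma test_vanish_bottom phi (x : R) : test_function D phi -> phi (x, 0) = 0.
Proof.
by move=> tp; apply: (test_vanish tp) => /interior_billiard[_]; rewrite ltxx.
Qed.

Lemma test_vanish_left phi (x y : R) : test_function D phi -> x <= - B0 -> phi (x, y) = 0.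
Proof.
move=> tp xB; apply: (test_vanish tp) => /interior_billiard[/andP[x1 x2] _ _].
by move: x1; rewrite ltNge xB.
Qed.

Lemma test_vanish_right phi (x y : R) : test_function D phi -> B1 <= x -> phi (x, y) = 0.
Proof.
move=> tp xB; apply: (test_vanish tp) => /interior_billiard[/andP[x1 x2] _ _].
by move: x2; rewrite ltNge xB.
Qed.

Lemma test_dx phi (x y : R) : test_function D phi ->
  is_derive x 1 (fun t => phi (t, y)) ('D_dirx phi (x, y)).
Proof. by move=> [/(_ 1) /is_Ck_derx]. Qed.

Lemma test_dy phi (x y : R) : test_function D phi ->
  is_derive y 1 (fun t => phi (x, t)) ('D_diry phi (x, y)).
Proof. by move=> [/(_ 1) /is_Ck_dery]. Qed.

Variables (l dl : R -> R) (k : nat).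
Hypotheses (l_gt0 : forall x, 0 < l x) (l_le : forall x, l x <= L0).
Hypotheses (dll : forall x : R, is_derive x 1 l (dl x)) (cdl : continuous dl).

(** The sine coefficient on the fibre of height [l x], not normalised. The upper limit is [L0] and
    not [l x]: in a window [phi] vanishes above the graph, and a fixed range allows differentiation
    under the integral sign. *)
Definition modeF (phi : R * R -> R) (x : R) : R :=
  integ 0 L0 (fun y => phi (x, y) * sin (k%:R * pi * (y / l x))).

(* [modeG] collects what comes from differentiating [y / l x] in [x]. *)
Definition modeG (phi : R * R -> R) (x : R) : R :=
  integ 0 L0 (fun y => phi (x, y) *
    (k%:R * pi * cos (k%:R * pi * (y / l x)) * (y * (dl x / l x ^+ 2)))).

Let S (t : R) : R := sin (k%:R * pi * t).
Let dS (t : R) : R := k%:R * pi * cos (k%:R * pi * t).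

Let der_S (t : R) : is_derive t 1 S (dS t).
Proof.
have := is_derive_sin_affine (k%:R * pi) 0 t.
have -> : (fun t => sin (k%:R * pi * (t - 0))) = S by apply/funext => s; rewrite subr0.
by rewrite subr0.
Qed.

Let der_dS (t : R) : is_derive t 1 dS (- ((k%:R * pi) ^+ 2 * S t)).
Proof.
have := derZ (k%:R * pi) (is_derive_cos_affine (k%:R * pi) 0 t).
have -> : (fun t => k%:R * pi * cos (k%:R * pi * (t - 0))) = dS.
  by apply/funext => s; rewrite subr0.
by rewrite subr0 /S; congr is_derive; ring.
Qed.

Let cont_l1 : continuous (fun z : R * R => l z.1).
Proof. by apply: cont_comp; [exact: der_cont dll|exact: cont_fst]. Qed.
Let cont_ratio : continuous (fun z : R * R => z.2 / l z.1).
Proof.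
have c1 := @cont_snd R; have c2 : continuous (fun z : R * R => (l z.1)^-1).
  by apply: contV => // z; rewrite gt_eqF.
by cont.
Qed.
Let cont_S : continuous (fun z : R * R => S (z.2 / l z.1)).
Proof. exact: cont_comp (der_cont der_S) cont_ratio. Qed.
Let cont_dS : continuous (fun z : R * R => dS (z.2 / l z.1)).
Proof. exact: cont_comp (der_cont der_dS) cont_ratio. Qed.
Let cont_fac : continuous (fun z : R * R => z.2 * (dl z.1 / l z.1 ^+ 2)).
Proof.
have c1 := @cont_snd R; have c2 : continuous (fun z : R * R => (l z.1 ^+ 2)^-1).
  apply: contV; first exact: (@contX _ _ _ 2 cont_l1).
  by move=> z; rewrite gt_eqF ?exprn_gt0.
by have c3 := @cont_comp _ _ _ _ cdl (@cont_fst R); cont.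
Qed.

Let cont_F (phi : R * R -> R) : continuous phi ->
  continuous (fun z => phi z * S (z.2 / l z.1)).
Proof. by move=> c; have c1 := cont_S; cont. Qed.
Let cont_G (phi : R * R -> R) : continuous phi ->
  continuous (fun z => phi z * (dS (z.2 / l z.1) * (z.2 * (dl z.1 / l z.1 ^+ 2)))).
Proof.
move=> c; apply: (contM c); exact: contM cont_dS cont_fac.
Qed.

Lemma modeF_cont phi : continuous phi -> continuous (modeF phi).
Proof. by move=> c; exact: (@integ_param_continuous _ _ 0 L0 (cont_F c)). Qed.

Lemma modeG_cont phi : continuous phi -> continuous (modeG phi).
Proof. by move=> c; exact: (@integ_param_continuous _ _ 0 L0 (cont_G c)). Qed.

Lemma modeF_derive phi (x : R) : test_function D phi ->
  is_derive x 1 (modeF phi) (modeF ('D_dirx phi) x - modeG phi x).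
Proof.
move=> tp; have c0 := test_continuous tp.
have c1 := test_continuous (test_derive tp (or_introl erefl)).
rewrite /modeF /modeG -integB; [|exact: (@cont_pair2 _ _ x (cont_F c1))
  |exact: (@cont_pair2 _ _ x (cont_G c0))].
apply: (@integ_param_derive _ (fun z => phi z * S (z.2 / l z.1))
  (fun z => 'D_dirx phi z * S (z.2 / l z.1) -
     phi z * (dS (z.2 / l z.1) * (z.2 * (dl z.1 / l z.1 ^+ 2))))).
- exact: cont_F.
- apply: contD; first exact: cont_F.
  by apply: contN; exact: cont_G.
- move=> {}x y.
  have d1 := derZ y (derV (dll x) (lt0r_neq0 (l_gt0 x))).
  have := derM (test_dx x y tp) (derComp d1 (der_S (y * (l x)^-1))).
  by congr is_derive; rewrite /=; ring.
Qed.

(** One integration by parts in [y]; the boundary terms vanish with [phi] at [y = 0] and [y = L0],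
    so no normal derivative of [phi] appears. *)
Lemma modeF_dy phi (x : R) : test_function D phi ->
  integ 0 L0 (fun y => 'D_diry phi (x, y) * (dS (y / l x) / l x)) =
  (k%:R * pi / l x) ^+ 2 * modeF phi x.
Proof.
move=> tp; have c0 := test_continuous tp.
have c2 := test_continuous (test_derive tp (or_intror erefl)).
have L00 : 0 < L0 := lt_le_trans (l_gt0 0) (l_le 0).
have l0 : l x != 0 by rewrite gt_eqF.
have dq (y : R) : is_derive y 1 (fun t => t / l x) (l x)^-1.
  have := derZ (l x)^-1 (derI y); rewrite mulr1.
  by congr is_derive; apply/funext => t; rewrite mulrC.
have dd (y : R) : is_derive y 1 (fun t => dS (t / l x) / l x)
    (- ((k%:R * pi / l x) ^+ 2 * S (y / l x))).
  have := derZ (l x)^-1 (derComp (dq y) (der_dS (y / l x))).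
  have -> : (fun t => (l x)^-1 * dS (t / l x)) = (fun t => dS (t / l x) / l x).
    by apply/funext => t; rewrite mulrC.
  by congr is_derive; field.
have cF := @cont_pair2 _ _ x (cont_F c0); rewrite /= in cF.
have cS := @cont_pair2 _ _ x cont_S; rewrite /= in cS.
have cdd : continuous (fun y : R => - ((k%:R * pi / l x) ^+ 2 * S (y / l x))) by cont.
have := integ_by_parts (ltW L00) (@cont_pair2 _ _ x c2) cdd (fun y => test_dy x y tp) dd.
rewrite (test_vanish_top _ tp) (test_vanish_bottom _ tp) !mul0r subrr sub0r => H.
rewrite -[LHS]opprK -H -integN; last first.
  by have c3 := @cont_pair2 _ _ x c0; cont.
rewrite /modeF -integZ//.
by apply: eq_integ => y _; rewrite /S; ring.
Qed.

Variables (p q E : R) (b : R -> R).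
Hypotheses (pq : p < q) (Bp : - B0 <= p) (qB : q <= B1).
Hypothesis l_smooth : forall n x, p < x < q -> derivable (derive1n n l) x 1.
Hypothesis l_D : forall x y, p < x < q -> 0 < y < l x -> D (x, y).
Hypothesis l_int : forall x y, p <= x <= q -> interior D (x, y) -> 0 < y < l x.
Hypothesis E_ge0 : 0 <= E.
Hypotheses (cb : forall n, Ck n b) (bp : b p = 0) (bq : b q = 0).

(** The weak equation tested against [b x * sin (k pi y / l x)]. The [x]-derivative of the
    coefficient is integrated by parts onto [b'], which brings out the traces at [p] and [q] with
    weights [b' q] and [- b' p]. The [modeG] terms record the variation of [l]; in one of them a
    derivative of [phi] is left. *)
Lemma mode_bound : exists2 C, 0 <= C & forall phi eta, test_function D phi ->
  0 <= eta -> near_solution B0 B1 L0 L E phi eta ->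
  `|derive1 b q * modeF phi q - derive1 b p * modeF phi p +
    integ p q (fun x => (((k%:R * pi / l x) ^+ 2 - E) * b x - derive1 (derive1 b) x) *
       modeF phi x + derive1 b x * modeG phi x - b x * modeG ('D_dirx phi) x)| <= eta * C.
Proof.
have cS n : Ck n S.
  have -> : S = fun t => sin (k%:R * pi * t + 0) by apply/funext => t; rewrite addr0.
  by apply: Ck_sin; exact: Ck_affine.
have S0 : S 0 = 0 by rewrite /S mulr0 sin0.
have S1 : S 1 = 0 by rewrite /S mulr1 sin_npi.
have dSE (t : R) : derive1 S t = dS t by exact: is_derive_derive1.
have [C C0 HC] := fibered_bound HL pq Bp qB l_gt0 l_le dll cdl l_smooth l_D l_int
  E_ge0 cb cS bp bq S0 S1.
exists C => // phi eta tp eta0 ns.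
have := HC phi eta tp eta0 ns.
have c0 := test_continuous tp.
have c1 := test_continuous (test_derive tp (or_introl erefl)).
have c2 := test_continuous (test_derive tp (or_intror erefl)).
have cF0 := modeF_cont c0; have cF1 := modeF_cont c1.
have cG0 := modeG_cont c0; have cG1 := modeG_cont c1.
have cb0 := Ck_continuous (cb 0%N).
have cb1 : continuous (derive1 b) by case: (cb 1).
have cb2 : continuous (derive1 (derive1 b)) by case: (cb 2) => _ [].
have db := CkSP (cb 1); have ddb : forall x : R, is_derive x 1 (derive1 b) (derive1 (derive1 b) x).
  by apply: (@CkSP _ 0); case: (cb 2).
have BE x : densB L0 l dl E S phi ('D_dirx phi) ('D_diry phi) x =
    - modeG ('D_dirx phi) x + ((k%:R * pi / l x) ^+ 2 - E) * modeF phi x.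
  rewrite /densB mulrBl -modeF_dy//.
  have k1 := @cont_pair2 _ _ x (cont_G c1); have k2 := @cont_pair2 _ _ x (cont_F c0).
  have k3 := @cont_pair2 _ _ x c2; have k4 := @cont_pair2 _ _ x cont_dS.
  rewrite /= in k1 k2 k3 k4.
  have k5 : continuous (fun y => 'D_diry phi (x, y) * (dS (y / l x) / l x)).
    exact: contM k3 (contM k4 (@cont_cst _ _ (l x)^-1)).
  have cE := contM (@cont_cst _ _ E) k2.
  have eG : - modeG ('D_dirx phi) x = integ 0 L0 (fun y => - ('D_dirx phi (x, y) *
      (dS (y / l x) * (y * (dl x / l x ^+ 2))))) by rewrite (integN _ _ k1).
  have eF : E * modeF phi x = integ 0 L0 (fun y => E * (phi (x, y) * S (y / l x))).
    by rewrite (integZ _ _ _ k2).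
  rewrite eG eF -(integB _ _ k5 cE) -(integD _ _ (contN k1) (contD k5 (contN cE))).
  by apply: eq_integ => y _; rewrite dSE addrA.
have dF x := modeF_derive x tp.
have := integ_by_parts (ltW pq) cb2 (fun x => (contD cF1 (contN cG0)) x) ddb dF.
move=> ibp.
have ci : continuous (fun x => (l x)^-1).
  by apply: contV => [|x]; [exact: der_cont dll|rewrite gt_eqF].
pose w x := (k%:R * pi / l x) ^+ 2 - E.
have cw : continuous w.
  by apply: contD; [apply: (@contX _ _ _ 2); cont|exact: cont_cst].
rewrite (_ : integ p q _ = derive1 b q * modeF phi q - derive1 b p * modeF phi p +
    integ p q (fun x => (w x * b x - derive1 (derive1 b) x) *
       modeF phi x + derive1 b x * modeG phi x - b x * modeG ('D_dirx phi) x)) //.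
have cI := contD (contD (contM (contM cw cb0) cF0) (contM cb1 cG0)) (contN (contM cb0 cG1)).
have E1 : integ p q (fun x => (w x * b x - derive1 (derive1 b) x) *
       modeF phi x + derive1 b x * modeG phi x - b x * modeG ('D_dirx phi) x) =
   integ p q (fun x => w x * b x * modeF phi x + derive1 b x * modeG phi x -
     b x * modeG ('D_dirx phi) x) - integ p q (fun x => derive1 (derive1 b) x * modeF phi x).
  by rewrite -(integB _ _ cI (contM cb2 cF0)); apply: eq_integ => x _; ring.
have cA : continuous (fun x => derive1 b x * (modeF ('D_dirx phi) x - modeG phi x)).
  exact: contM cb1 (contD cF1 (contN cG0)).
rewrite E1 addrCA -ibp -(integD _ _ cI cA).
by apply: eq_integ => x _; rewrite BE /densA -/(modeF ('D_dirx phi) x) -/(w x); ring.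
Qed.

End ModeBound.

(** * Double sine coefficients on the rectangle *)

Section RectangleModes.
Context {R : realType}.
Variables (B0 B1 L0 cL gamma : R) (L : R -> R).
Hypothesis HL : billiard_profile B0 B1 L0 cL gamma L.
Let D : set (R * R) := billiard B0 B1 L.
Let B0_gt0 : 0 < B0 := profile_B0_gt0 HL.
Let B1_gt0 : 0 < B1 := profile_B1_gt0 HL.
Let L0_gt0 : 0 < L0 := profile_L0_gt0 HL.

Lemma cst_smooth n (c x : R) : derivable (derive1n n (fun _ : R => c)) x 1.
Proof.
have h m : derive1n m.+1 (fun _ : R => c) = fun _ => 0.
  elim: m => [|m IH].
    by rewrite derive1n1; apply/funext => t; apply: is_derive_derive1; exact: derC.
  by rewrite derive1nS IH; apply/funext => t; apply: is_derive_derive1; exact: derC.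
case: n => [|m]; last rewrite h.
  exact: (@ex_derive _ _ _ _ _ _ _ (derC c x)).
exact: (@ex_derive _ _ _ _ _ _ _ (derC 0 x)).
Qed.

Lemma sinb_Ck (p a : R) k n : Ck n (sinb p a k).
Proof.
have -> : sinb p a k = fun t => sin (k%:R * (pi / a) * t + - (k%:R * (pi / a) * p)).
  by apply/funext => t; rewrite /sinb mulrBr.
by apply: Ck_sin; exact: Ck_affine.
Qed.

(** [mode_bound] with constant [l] and [b] the [j]-th sine on [[- B0, 0]]. Since [b'' = - lam^2 b],
    the integral reduces to a multiple of the sine coefficient; the [modeG] terms vanish, as does
    the trace at [- B0], and the trace at 0 has weight [b' 0 = lam cos (j pi)]. *)
Lemma rect_mode_identity (E : R) k j : 0 <= E -> exists2 C, 0 <= C &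
  forall phi eta, test_function D phi -> 0 <= eta -> near_solution B0 B1 L0 L E phi eta ->
  `|j%:R * (pi / B0) * cos (j%:R * pi) * modeF L0 (fun _ => L0) k phi 0 +
    ((j%:R * (pi / B0)) ^+ 2 - (E - (k%:R * pi / L0) ^+ 2)) *
      integ (- B0) 0 (fun x => modeF L0 (fun _ => L0) k phi x * sinb (- B0) B0 j x)|
    <= eta * C.
Proof.
move=> E0; set lam := j%:R * (pi / B0).
have B0n : B0 != 0 by rewrite gt_eqF.
pose b := sinb (- B0) B0 j.
have db (x : R) : is_derive x 1 b (lam * cos (lam * (x - - B0))) by exact: is_derive_sin_affine.
have ddb (x : R) : is_derive x 1 (fun x => lam * cos (lam * (x - - B0))) (- (lam ^+ 2 * b x)).
  have := derZ lam (is_derive_cos_affine lam (- B0) x).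
  by congr is_derive; rewrite /b /sinb -/lam; ring.
have b1 : derive1 b = fun x => lam * cos (lam * (x - - B0)).
  by apply/funext => x; exact: is_derive_derive1.
have b2 : derive1 (derive1 b) = fun x => - (lam ^+ 2 * b x).
  by rewrite b1; apply/funext => x; exact: is_derive_derive1.
have lB : lam * B0 = j%:R * pi by rewrite /lam; field.
have bp : b (- B0) = 0 by rewrite /b /sinb subrr mulr0 sin0.
have bq : b 0 = 0 by rewrite /b /sinb sub0r opprK -/lam lB sin_npi.
have NB : - B0 < 0 by rewrite oppr_lt0.
have dl (x : R) : is_derive x 1 (fun _ : R => L0) 0 by exact: derC.
have lD (x y : R) : - B0 < x < 0 -> 0 < y < L0 -> D (x, y).
  have B1' : 0 < B1 by []; move=> hx hy; split => /=; first by lra.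
  by rewrite (profile_flat HL); lra.
have lI (x y : R) : - B0 <= x <= 0 -> interior D (x, y) -> 0 < y < L0.
  move=> hx /interior_billiard[h1 h2]; rewrite (profile_flat HL)//; lra.
have [C C0 HC] := mode_bound HL k (fun _ => L0_gt0) (fun _ => lexx L0) dl
  (@cont_cst _ _ 0) NB (lexx _) (ltW B1_gt0) (fun n x _ => @cst_smooth n L0 x) lD lI E0
  (@sinb_Ck _ _ j) bp bq.
exists C => // phi eta tp eta0 ns.
have := HC phi eta tp eta0 ns.
have c0 := test_continuous tp.
have c1 := test_continuous (test_derive tp (or_introl erefl)).
have F0 : modeF L0 (fun _ => L0) k phi (- B0) = 0.
  rewrite -[RHS](integ0 0 L0); apply: eq_integ => y _.
  by rewrite (test_vanish_left _ tp) ?mul0r.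
have G0 psi x : modeG L0 (fun _ => L0) (fun _ => 0) k psi x = 0.
  rewrite -[RHS](integ0 0 L0); apply: eq_integ => y _.
  by rewrite mul0r !mulr0.
have cF : continuous (modeF L0 (fun _ => L0) k phi).
  exact: (modeF_cont (fun _ => L0_gt0) dl c0).
have cb := @sinb_cont R (- B0) B0 j.
rewrite F0 mulr0 subr0 -/b b2 b1 sub0r opprK lB -integZ; last by cont.
congr (`| _ + _ | <= _); apply: eq_integ => x _.
by rewrite !G0 -/(b x) !mulr0 subr0 addr0; ring.
Qed.

End RectangleModes.

(** * Bessel inequalities on fibres and the window multiplier *)

Section WindowModes.
Context {R : realType}.
Implicit Types (a b x y m M delta om : R) (g : R -> R) (r : seq nat).

Lemma integ_vanish_beyond a b g : continuous g -> 0 < a -> a <= b ->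
  (forall y : R, a <= y -> g y = 0) -> integ 0 b g = integ 0 a g.
Proof.
move=> cg a0 ab g0; have h : 0 <= a <= b by rewrite (ltW a0).
rewrite (integ_split cg h) [X in _ + X](_ : _ = 0) ?addr0//.
rewrite -[RHS](integ0 a b); apply: eq_integ => y /andP[ay _]; exact: g0.
Qed.

Lemma sin_mode_bessel a b r g : 0 < a -> a <= b -> uniq r -> all (leq 1) r ->
  continuous g -> (forall y : R, a <= y -> g y = 0) ->
  \sum_(k <- r) integ 0 b (fun y => g y * sin (k%:R * pi * (y / a))) ^+ 2 <=
    b / 2 * integ 0 b (fun y => g y ^+ 2).
Proof.
move=> a0 ab ur r1 cg g0; have an0 : a != 0 by rewrite gt_eqF.
have H := sinb_bessel 0 a0 ur r1 cg.
have -> : integ 0 b (fun y => g y ^+ 2) = integ 0 a (fun y => g y ^+ 2).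
  by apply: integ_vanish_beyond => //; [cont|move=> y ay; rewrite g0 ?expr0n].
apply: le_trans (le_trans _ H) _; last first.
  rewrite add0r; apply: ler_wpM2r; last by lra.
  by apply: integ_ge0 => y _; exact: sqr_ge0.
rewrite le_eqVlt; apply/orP; left; apply/eqP.
apply: eq_bigr => k _; rewrite add0r; congr (_ ^+ 2).
have -> : (fun y => g y * sin (k%:R * pi * (y / a))) = (fun y => g y * sinb 0 a k y).
  apply/funext => y; rewrite /sinb; congr (_ * sin _); rewrite subr0.
  by field.
apply: integ_vanish_beyond => //; last by move=> y ay; rewrite g0 ?mul0r.
by have c := @sinb_cont R 0 a k; cont.
Qed.

(** The factor [y] is attached to [g] and [k pi m] is pulled out, which leaves coefficients of
    [y g(y)] in the orthogonal cosines of [[0, a]]. In the constant, [b^3 / 2] is [b / 2] from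
    Bessel times [b^2] from [y^2]. *)
Lemma cos_mode_bessel a b m M r g : 0 < a -> a <= b -> uniq r -> all (leq 1) r ->
  continuous g -> (forall y : R, a <= y -> g y = 0) -> 0 <= M ->
  (forall k, k \in r -> (k%:R * pi) ^+ 2 <= M) ->
  \sum_(k <- r) integ 0 b (fun y => g y *
      (k%:R * pi * cos (k%:R * pi * (y / a)) * (y * m))) ^+ 2 <=
    M * m ^+ 2 * (b ^+ 3 / 2) * integ 0 b (fun y => g y ^+ 2).
Proof.
move=> a0 ab ur r1 cg g0 M0 kM; have an0 : a != 0 by rewrite gt_eqF.
have b0 : 0 < b := lt_le_trans a0 ab.
have cid : continuous (fun y : R => y) by move=> y; exact: cvg_id.
have cgy : continuous (fun y => g y * y) by cont.
have H := cosb_bessel 0 a0 ur r1 cgy.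
have Mm0 : 0 <= M * m ^+ 2 by rewrite mulr_ge0// sqr_ge0.
have I0 : 0 <= integ 0 a (fun y => (g y * y) ^+ 2) by apply: integ_ge0 => y _; exact: sqr_ge0.
have H2 : integ 0 a (fun y => (g y * y) ^+ 2) <= b ^+ 2 * integ 0 b (fun y => g y ^+ 2).
  rewrite -(@integ_vanish_beyond a b)//; [|by cont|by move=> y ay; rewrite g0// mul0r expr0n].
  rewrite -integZ; last by cont.
  apply: le_integ; [by cont|by cont|move=> y /andP[y0 yb]].
  rewrite exprMn mulrC; apply: ler_wpM2r; first exact: sqr_ge0.
  by rewrite ler_sqr ?nnegrE// (ltW b0).
have H3 : \sum_(k <- r) integ 0 a (fun y => g y * y * cosb 0 a k y) ^+ 2 <=
    b ^+ 3 / 2 * integ 0 b (fun y => g y ^+ 2).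
  rewrite add0r in H; apply: le_trans H _.
  apply: le_trans (ler_wpM2r I0 (_ : a / 2 <= b / 2)) _; first by lra.
  have -> : b ^+ 3 / 2 * integ 0 b (fun y => g y ^+ 2) =
     b / 2 * (b ^+ 2 * integ 0 b (fun y => g y ^+ 2)) by field.
  by apply: ler_wpM2l => //; lra.
rewrite -mulrA; apply: le_trans (ler_wpM2l Mm0 H3).
rewrite mulr_sumr big_seq [leRHS]big_seq; apply: ler_sum => k kr.
have -> : (fun y => g y * (k%:R * pi * cos (k%:R * pi * (y / a)) * (y * m))) =
    (fun y => k%:R * pi * m * (g y * y * cosb 0 a k y)).
  apply/funext => y; rewrite /cosb subr0.
  rewrite (_ : k%:R * (pi / a) * y = k%:R * pi * (y / a)); last by field.
  by ring.
have cc := @cosb_cont R 0 a k.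
rewrite integZ; last by cont.
rewrite (@integ_vanish_beyond a b)//; [|by cont|by move=> y ay; rewrite g0// !mul0r].
rewrite exprMn; apply: ler_wpM2r; first exact: sqr_ge0.
by rewrite exprMn; apply: ler_wpM2r; [exact: sqr_ge0|exact: kM].
Qed.

Lemma sin_div_le om x : 0 < om -> 0 <= x -> `|sin (om * x) / om| <= x.
Proof.
move=> om0 x0; have omn : om != 0 by rewrite gt_eqF.
have d (t : R) : is_derive t 1 (fun t => om^-1 * sin (om * (t - 0))) (cos (om * (t - 0))).
  by have := derZ om^-1 (is_derive_sin_affine om 0 t); rewrite mulKf.
have := lipschitz_itv d (@cont_cos_affine _ om 0) (fun t _ => cos_max _) (lexx 0) x0 (lexx x).
by rewrite !subr0 mulr0 sin0 mulr0 subr0 mul1r mulrC.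
Qed.

(* [sin (om x) / om] cut off at [delta] so as to stay a multiplier of size [delta]. *)
Lemma window_function delta om : 0 < delta -> 0 < om -> exists w : R -> R,
  [/\ forall n, Ck n w, w 0 = 0 /\ w delta = 0, derive1 w 0 = 1 /\ derive1 w delta = 0 &
      forall x, 0 <= x <= delta ->
      [/\ `|w x| <= delta, `|derive1 w x| <= 3 &
          `|derive1 (derive1 w) x + om ^+ 2 * w x| <= 6 / delta]].
Proof.
move=> d0 om0; have dn : delta != 0 by rewrite gt_eqF.
have omn : om != 0 by rewrite gt_eqF.
pose s (x : R) := om^-1 * sin (om * (x - 0)).
pose v (x : R) := 1 - delta^-1 * x.
(* The square makes [w'] vanish at [delta] as well, so that [mode_bound] leaves no trace at the far
   end of the window. *)
pose w (x : R) := s x * v x ^+ 2.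
pose w1 (x : R) := cos (om * (x - 0)) * v x ^+ 2 + s x * (2 * v x * (- delta^-1)).
have ds (x : R) : is_derive x 1 s (cos (om * (x - 0))).
  by have := derZ om^-1 (is_derive_sin_affine om 0 x); rewrite mulKf.
have dv (x : R) : is_derive x 1 v (- delta^-1).
  have := derD (derC 1 x) (derN (derZ delta^-1 (derI x))).
  by rewrite add0r mulr1.
have dw (x : R) : is_derive x 1 w (w1 x) by exact: derM (ds x) (derX2 (dv x)).
(* Beyond [- om^2 w] only the terms with derivatives of the cutoff remain. As [|s| <= delta], they
   have size [6 / delta] uniformly in [om], however close to 0 the mode energy is. *)
have dw1 (x : R) : is_derive x 1 w1 (- om ^+ 2 * w x - 4 / delta * cos (om * (x - 0)) * v x
    + 2 / delta ^+ 2 * s x).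
  have h1 := derM (is_derive_cos_affine om 0 x) (derX2 (dv x)).
  have h2 := derM (ds x) (derM (derZ 2 (dv x)) (derC (- delta^-1) x)).
  have := derD h1 h2; congr is_derive.
  by rewrite /w /s; field; rewrite dn omn.
have E1 : derive1 w = w1 by apply/funext => x; exact: is_derive_derive1.
have E2 x : derive1 (derive1 w) x = - om ^+ 2 * w x - 4 / delta * cos (om * (x - 0)) * v x
    + 2 / delta ^+ 2 * s x by rewrite E1; exact: is_derive_derive1.
have cs n : Ck n s.
  have -> : s = fun x => om^-1 * sin (om * x + 0) by apply/funext => x; rewrite /s subr0 addr0.
  by apply: CkM; [exact: Ck_cst|apply: Ck_sin; exact: Ck_affine].
have cv n : Ck n v.
  have -> : v = fun x => - delta^-1 * x + 1 by apply/funext => x; rewrite /v; ring.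
  exact: Ck_affine.
exists w; split.
- by move=> n; apply: (CkM (cs n)); exact: CkM (cv n) (cv n).
- rewrite /w /s subr0 mulr0 sin0 mulr0 mul0r; split => //.
  by rewrite /v mulVf// subrr expr0n mulr0.
- rewrite E1 /w1; split; last by rewrite /v mulVf// subrr expr0n/= !(mulr0, mul0r) addr0.
  by rewrite /s /v subrr !mulr0 sin0 cos0 subr0 expr1n mulr0 mul0r addr0 mulr1.
move=> x /andP[x0 xd].
have s0 : `|s x| <= delta.
  apply: le_trans xd; rewrite /s subr0 mulrC; exact: sin_div_le.
have v01 : 0 <= v x <= 1.
  have h1 : 0 <= delta^-1 * x by rewrite mulr_ge0// invr_ge0 ltW.
  have h2 : delta^-1 * x <= 1 by rewrite mulrC ler_pdivrMr// mul1r.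
  by rewrite /v; lra.
have v0 : `|v x| <= 1 by have /andP[? ?] := v01; rewrite ger0_norm.
have v2 : `|v x ^+ 2| <= 1 by have := normrM_le v0 v0; rewrite mulr1 -expr2.
have c0 : `|cos (om * (x - 0))| <= 1 by exact: cos_max.
have di : `|delta^-1| <= delta^-1 by rewrite ger0_norm// invr_ge0 ltW.
split.
- by have := normrM_le s0 v2; rewrite mulr1.
- rewrite E1 /w1; apply: le_trans (ler_normD _ _) _.
  have h1 := normrM_le c0 v2; rewrite mulr1 in h1.
  have h2 : `|s x * (2 * v x * - delta^-1)| <= 2.
    have -> : s x * (2 * v x * - delta^-1) = - (2 * (s x * (v x * delta^-1))) by ring.
    rewrite normrN normrM ger0_norm//.
    have := normrM_le s0 (normrM_le v0 di); rewrite mul1r mulfV//; lra.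
  by lra.
- rewrite E2 (_ : _ + om ^+ 2 * w x = 2 / delta ^+ 2 * s x - 4 / delta * (cos (om * (x - 0)) * v x));
    last by ring.
  apply: le_trans (ler_normB _ _) _.
  have h1 := normrM_le c0 v0; rewrite mulr1 in h1.
  have p1 : 0 <= 2 / delta ^+ 2 by rewrite divr_ge0// sqr_ge0.
  have p2 : 0 <= 4 / delta by rewrite divr_ge0// ltW.
  rewrite (normrM (2 / _)) (normrM (4 / _)) (ger0_norm p1) (ger0_norm p2).
  have k1 := ler_wpM2l p1 s0; have k2 := ler_wpM2l p2 h1.
  have e1 : 2 / delta ^+ 2 * delta = 2 / delta by field.
  rewrite e1 in k1; lra.
Qed.

End WindowModes.

(** * Traces controlled through the window *)

Section WindowBound.
Context {R : realType}.
Variables (B0 B1 L0 cL gamma : R) (L : R -> R).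
Hypothesis HL : billiard_profile B0 B1 L0 cL gamma L.
Let D : set (R * R) := billiard B0 B1 L.

Variables (l dl : R -> R) (delta : R).
Hypotheses (delta_gt0 : 0 < delta) (delta_le : delta <= B1) (l0 : l 0 = L0).
Hypotheses (l_gt0 : forall x, 0 < l x) (l_le : forall x, l x <= L0).
Hypotheses (dll : forall x : R, is_derive x 1 l (dl x)) (cdl : continuous dl).
Hypothesis l_smooth : forall n x, 0 < x < delta -> derivable (derive1n n l) x 1.
Hypothesis l_D : forall x y, 0 < x < delta -> 0 < y < l x -> D (x, y).
Hypothesis l_int : forall x y, 0 <= x <= delta -> interior D (x, y) -> 0 < y < l x.

Variables (E m1 m2 : R) (r : seq nat).
Hypothesis E_gt0 : 0 < E.
Hypothesis dl_le : forall x, 0 <= x <= delta -> `|dl x / l x ^+ 2| <= m1.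
Hypothesis l_near : forall x, 0 <= x <= delta -> `|(l x ^+ 2)^-1 - (L0 ^+ 2)^-1| <= m2.
Hypotheses (r_uniq : uniq r) (r_pos : all (leq 1) r).
Hypothesis r_le : forall k, k \in r -> (k%:R * pi / L0) ^+ 2 < E.

Let L0_gt0 : 0 < L0 := profile_L0_gt0 HL.

Lemma window_vanish phi (x y : R) : test_function D phi -> 0 <= x <= delta -> l x <= y ->
  phi (x, y) = 0.
Proof.
move=> tp hx ly; apply: (test_vanish tp) => /(l_int hx)/andP[_].
by rewrite ltNge ly.
Qed.

Let kpi_le k : k \in r -> (k%:R * pi) ^+ 2 <= E * L0 ^+ 2.
Proof.
move=> /r_le /ltW; rewrite expr_div_n ler_pdivrMr ?exprn_gt0//.
Qed.

Lemma integ_fiber_le (psi : R * R -> R) : continuous psi ->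
  integ 0 delta (fun x => integ 0 L0 (fun y => psi (x, y) ^+ 2)) <=
  integ 0 B1 (fun x => integ 0 L0 (fun y => psi (x, y) ^+ 2)).
Proof.
move=> c; have c2 : continuous (fun x => integ 0 L0 (fun y => psi (x, y) ^+ 2)).
  by apply: (@integ_param_continuous _ (fun z => psi z ^+ 2)); exact: contX.
have h : 0 <= delta <= B1 by rewrite (ltW delta_gt0).
rewrite (integ_split c2 h) lerDl; apply: integ_ge0 => x _.
by apply: integ_ge0 => y _; exact: sqr_ge0.
Qed.

Lemma window_sumF phi : test_function D phi ->
  \sum_(k <- r) integ 0 delta (fun x => modeF L0 l k phi x ^+ 2) <=
  L0 / 2 * integ 0 B1 (fun x => integ 0 L0 (fun y => phi (x, y) ^+ 2)).
Proof.
move=> tp; have c0 := test_continuous tp.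
have cF k : continuous (modeF L0 l k phi) := modeF_cont l_gt0 dll c0.
have cI : continuous (fun x => integ 0 L0 (fun y => phi (x, y) ^+ 2)).
  by apply: (@integ_param_continuous _ (fun z => phi z ^+ 2)); exact: contX.
have cF2 k : continuous (fun x => modeF L0 l k phi x ^+ 2) by have := cF k => ?; cont.
rewrite -integ_sum//.
have L20 : 0 <= L0 / 2 by rewrite divr_ge0// (ltW L0_gt0).
apply: le_trans (ler_wpM2l L20 (integ_fiber_le c0)).
rewrite -integZ//; apply: le_integ; [exact: cont_sum|by cont|].
move=> x hx; apply: sin_mode_bessel => //; first exact: cont_pair2.
by move=> y ly; apply: window_vanish.
Qed.

Lemma window_sumG psi : test_function D psi ->
  \sum_(k <- r) integ 0 delta (fun x => modeG L0 l dl k psi x ^+ 2) <=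
  E * L0 ^+ 2 * m1 ^+ 2 * (L0 ^+ 3 / 2) *
    integ 0 B1 (fun x => integ 0 L0 (fun y => psi (x, y) ^+ 2)).
Proof.
move=> tp; have c0 := test_continuous tp.
have cF k : continuous (modeG L0 l dl k psi) := modeG_cont l_gt0 dll cdl c0.
have cI : continuous (fun x => integ 0 L0 (fun y => psi (x, y) ^+ 2)).
  by apply: (@integ_param_continuous _ (fun z => psi z ^+ 2)); exact: contX.
have cF2 k : continuous (fun x => modeG L0 l dl k psi x ^+ 2) by have := cF k => ?; cont.
rewrite -integ_sum//.
have EL : 0 <= E * L0 ^+ 2 by rewrite mulr_ge0 ?sqr_ge0// ltW.
have L30 : 0 <= L0 ^+ 3 / 2 by rewrite divr_ge0// exprn_ge0// (ltW L0_gt0).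
have c00 : 0 <= E * L0 ^+ 2 * m1 ^+ 2 * (L0 ^+ 3 / 2).
  by apply: mulr_ge0 => //; apply: mulr_ge0 => //; exact: sqr_ge0.
apply: le_trans (ler_wpM2l c00 (integ_fiber_le c0)).
rewrite -integZ//; apply: le_integ; [exact: cont_sum|by cont|].
move=> x hx.
have cx := @cont_pair2 _ _ x c0.
have vx (y : R) : l x <= y -> psi (x, y) = 0 by exact: window_vanish.
have I0 : 0 <= integ 0 L0 (fun y => psi (x, y) ^+ 2).
  by apply: integ_ge0 => y _; exact: sqr_ge0.
apply: le_trans (cos_mode_bessel (dl x / l x ^+ 2) (l_gt0 x) (l_le x) r_uniq r_pos cx vx EL kpi_le) _.
apply: ler_wpM2r => //; apply: ler_wpM2r => //; apply: ler_wpM2l => //.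
rewrite -real_normK ?num_real// ler_sqr ?nnegrE//; first exact: dl_le.
exact: le_trans (dl_le hx).
Qed.

(** [mode_bound] on [[0, delta]] with the multiplier [w], for which [w' 0 = 1] singles out the
    trace. The coefficient of [modeF] is at most [E L0^2 m2 delta + 6 / delta], those of the two
    [modeG] terms at most 3 and [delta]. The factor [6 delta] is 2 from splitting off the error in
    [eta], 3 from the three terms, and [delta] from Cauchy-Schwarz in [x]. The sum over [k] is taken
    fibre by fibre with Bessel, so the number of modes does not enter. *)
Lemma window_bound : exists2 C, 0 <= C & forall phi eta, test_function D phi ->
  0 <= eta -> near_solution B0 B1 L0 L E phi eta ->
  \sum_(k <- r) modeF L0 (fun _ => L0) k phi 0 ^+ 2 <=
  eta ^+ 2 * C + 6 * delta *
    (((E * L0 ^+ 2 * m2 * delta + 6 / delta) ^+ 2 * (L0 / 2) +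
      9 * (E * L0 ^+ 2 * m1 ^+ 2 * (L0 ^+ 3 / 2))) *
       integ 0 B1 (fun x => integ 0 L0 (fun y => phi (x, y) ^+ 2)) +
     delta ^+ 2 * (E * L0 ^+ 2 * m1 ^+ 2 * (L0 ^+ 3 / 2)) *
       integ 0 B1 (fun x => integ 0 L0 (fun y => 'D_dirx phi (x, y) ^+ 2))).
Proof.
have EL : 0 <= E * L0 ^+ 2 by rewrite mulr_ge0 ?sqr_ge0// ltW.
have B00 := profile_B0_gt0 HL.
have m20 : 0 <= m2 by apply: le_trans (l_near (x := 0) _); rewrite ?lexx ?(ltW delta_gt0).
pose A := E * L0 ^+ 2 * m2 * delta + 6 / delta.
have A0 : 0 <= A by rewrite addr_ge0// ?divr_ge0// ?mulr_ge0// ltW.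
(* Membership in [r] is placed after the existential so that [choice] yields one function of [k];
   outside [r] the constant is irrelevant. *)
have modes (k : nat) : exists C : R, k \in r -> 0 <= C /\ forall phi eta,
    test_function D phi -> 0 <= eta -> near_solution B0 B1 L0 L E phi eta ->
    modeF L0 l k phi 0 ^+ 2 <= eta ^+ 2 * (2 * C ^+ 2) + 6 * delta *
     integ 0 delta (fun x => A ^+ 2 * modeF L0 l k phi x ^+ 2 + 9 * modeG L0 l dl k phi x ^+ 2 +
        delta ^+ 2 * modeG L0 l dl k ('D_dirx phi) x ^+ 2).
  have [kr|kr] := boolP (k \in r); last by exists 0.
  have om2 : 0 < E - (k%:R * pi / L0) ^+ 2 by rewrite subr_gt0 r_le.
  pose om := Num.sqrt (E - (k%:R * pi / L0) ^+ 2).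
  have om0 : 0 < om by rewrite sqrtr_gt0.
  have omE : om ^+ 2 = E - (k%:R * pi / L0) ^+ 2 by rewrite sqr_sqrtr ?ltW.
  have [w [cw [w0 wd] [dw0 dwd] wb]] := window_function delta_gt0 om0.
  have Bp : - B0 <= 0 by rewrite oppr_le0 ltW.
  have [C C0 HC] := mode_bound HL k l_gt0 l_le dll cdl delta_gt0 Bp delta_le
    l_smooth l_D l_int (ltW E_gt0) cw w0 wd.
  exists C => _; split => // phi eta tp eta0 ns.
  have := HC phi eta tp eta0 ns.
  have c0 := test_continuous tp.
  have c1 := test_continuous (test_derive tp (or_introl erefl)).
  have cF : continuous (modeF L0 l k phi) := modeF_cont l_gt0 dll c0.
  have cG : continuous (modeG L0 l dl k phi) := modeG_cont l_gt0 dll cdl c0.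
  have cH : continuous (modeG L0 l dl k ('D_dirx phi)) := modeG_cont l_gt0 dll cdl c1.
  move: (modeF L0 l k phi) (modeG L0 l dl k phi) (modeG L0 l dl k ('D_dirx phi)) cF cG cH.
  move=> F G H cF cG cH.
  rewrite dwd dw0 mul0r mul1r sub0r.
  have cw0 := Ck_continuous (cw 0%N).
  have cw1 : continuous (derive1 w) by case: (cw 1).
  have cw2 : continuous (derive1 (derive1 w)) by case: (cw 2) => _ [].
  have ci : continuous (fun x => (l x)^-1).
    by apply: contV => [|x]; [exact: der_cont dll|rewrite gt_eqF].
  pose al x := ((k%:R * pi / l x) ^+ 2 - E) * w x - derive1 (derive1 w) x.
  have cal : continuous al.
    have c3 : continuous (fun x => (k%:R * pi / l x) ^+ 2) by apply: (@contX _ _ _ 2); cont.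
    by rewrite /al; cont.
  have alA x : 0 <= x <= delta -> `|al x| <= A.
    move=> hx; have [h1 h2 h3] := wb x hx.
    have -> : al x = (k%:R * pi) ^+ 2 * ((l x ^+ 2)^-1 - (L0 ^+ 2)^-1) * w x -
        (derive1 (derive1 w) x + om ^+ 2 * w x).
      by rewrite omE /al; field; rewrite !gt_eqF.
    apply: le_trans (ler_normB _ _) _; apply: lerD => //.
    apply: normrM_le => //; apply: normrM_le; last exact: l_near.
    by rewrite ger0_norm ?sqr_ge0// kpi_le.
  pose u x := al x * F x + derive1 w x * G x - w x * H x.
  have cu : continuous u by rewrite /u; cont.
  rewrite -[X in `|_ + X|]/(integ 0 delta u) => h.
  have d0 : 0 <= delta := ltW delta_gt0.
  have h1 : integ 0 delta u ^+ 2 <= delta * integ 0 delta (fun x => u x ^+ 2).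
    have := integ_CauchySchwarz 0 delta cu (@cont_cst _ _ (1 : R)).
    rewrite (_ : (fun x => u x * 1) = u); last by apply/funext => x; rewrite mulr1.
    by rewrite (_ : integ 0 delta (fun _ => 1 ^+ 2) = delta) 1?mulrC// integ_cst// expr1n mul1r subr0.
  have h2 : integ 0 delta (fun x => u x ^+ 2) <=
      3 * integ 0 delta (fun x => A ^+ 2 * F x ^+ 2 + 9 * G x ^+ 2 + delta ^+ 2 * H x ^+ 2).
    rewrite -integZ; last by cont.
    apply: le_integ; [by cont|by cont|move=> x hx].
    have [k1 k2 _] := wb x hx; have k3 := alA x hx.
    have sq (a b : R) : 0 <= b -> `|a| <= b -> a ^+ 2 <= b ^+ 2.
      by move=> b0 ab; rewrite -real_normK ?num_real// ler_sqr ?nnegrE.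
    have q1 : (al x * F x) ^+ 2 <= A ^+ 2 * F x ^+ 2.
      by rewrite exprMn; apply: ler_wpM2r; [exact: sqr_ge0|exact: sq].
    have q2 : (derive1 w x * G x) ^+ 2 <= 9 * G x ^+ 2.
      rewrite exprMn; apply: ler_wpM2r; first exact: sqr_ge0.
      by apply: le_trans (sq _ _ (ler0n R 3) k2) _; rewrite expr2 -natrM.
    have q3 : (w x * H x) ^+ 2 <= delta ^+ 2 * H x ^+ 2.
      by rewrite exprMn; apply: ler_wpM2r; [exact: sqr_ge0|exact: sq].
    rewrite /u; move: (al x * F x) (derive1 w x * G x) (w x * H x) q1 q2 q3 => X Y Z q1 q2 q3.
    have := sqr_ge0 (X - Y); have := sqr_ge0 (X + Z); have := sqr_ge0 (Y + Z).
    move: (A ^+ 2 * F x ^+ 2) (9 * G x ^+ 2) (delta ^+ 2 * H x ^+ 2) q1 q2 q3 => ? ? ? ? ? ?.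
    nra.
  have h3 : F 0 ^+ 2 <= 2 * (eta * C) ^+ 2 + 2 * integ 0 delta u ^+ 2.
    have e0 : 0 <= eta * C by rewrite mulr_ge0.
    move: h; rewrite ler_norml => /andP[g1 g2].
    move: (eta * C) (integ 0 delta u) e0 g1 g2 => c I e0 g1 g2.
    have g3 : (- F 0 + I) ^+ 2 <= c ^+ 2 by rewrite -real_normK ?num_real// ler_sqr ?nnegrE// ler_norml g1.
    have := sqr_ge0 (- F 0 + I + I); nra.
  have h4 := ler_wpM2l d0 h2.
  rewrite (_ : eta ^+ 2 * (2 * C ^+ 2) = 2 * (eta * C) ^+ 2); last by ring.
  move: (integ 0 delta (fun x => A ^+ 2 * F x ^+ 2 + 9 * G x ^+ 2 + delta ^+ 2 * H x ^+ 2)) h4 => J h4.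
  move: (integ 0 delta u ^+ 2) (integ 0 delta (fun x => u x ^+ 2)) h1 h3 h4 => I1 I2 h1 h3 h4.
  apply: le_trans h3 _; rewrite lerD2l.
  by rewrite (_ : 6 * delta * J = 2 * (delta * (3 * J))); [lra|ring].
have [C HC] := choice modes.
exists (\sum_(k <- r) 2 * C k ^+ 2).
  by apply: sumr_ge0 => k _; rewrite mulr_ge0// sqr_ge0.
move=> phi eta tp eta0 ns.
have c0 := test_continuous tp.
have t1 := test_derive tp (or_introl erefl).
have c1 := test_continuous t1.
have cF k : continuous (modeF L0 l k phi) := modeF_cont l_gt0 dll c0.
have cG k : continuous (modeG L0 l dl k phi) := modeG_cont l_gt0 dll cdl c0.
have cH k : continuous (modeG L0 l dl k ('D_dirx phi)) := modeG_cont l_gt0 dll cdl c1.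
have sF := window_sumF tp; have sG := window_sumG tp; have sH := window_sumG t1.
have F0E k : modeF L0 (fun _ => L0) k phi 0 = modeF L0 l k phi 0 by rewrite /modeF l0.
under eq_bigr do rewrite F0E.
have S1 : \sum_(k <- r) modeF L0 l k phi 0 ^+ 2 <= \sum_(k <- r) (eta ^+ 2 * (2 * C k ^+ 2) +
   6 * delta * (A ^+ 2 * integ 0 delta (fun x => modeF L0 l k phi x ^+ 2) +
     9 * integ 0 delta (fun x => modeG L0 l dl k phi x ^+ 2) +
     delta ^+ 2 * integ 0 delta (fun x => modeG L0 l dl k ('D_dirx phi) x ^+ 2))).
  rewrite big_seq [leRHS]big_seq; apply: ler_sum => k kr.
  have [Ck0 HCk] := HC k kr.
  apply: le_trans (HCk phi eta tp eta0 ns) _.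
  have k1 := cF k; have k2 := cG k; have k3 := cH k.
  move: (modeF L0 l k phi) (modeG L0 l dl k phi) (modeG L0 l dl k ('D_dirx phi)) k1 k2 k3.
  move=> F G H k1 k2 k3.
  have k4 : continuous (fun x => F x ^+ 2) by cont.
  have k5 : continuous (fun x => G x ^+ 2) by cont.
  have k6 : continuous (fun x => H x ^+ 2) by cont.
  rewrite (@integD _ _ _ (fun x => A ^+ 2 * F x ^+ 2 + 9 * G x ^+ 2)); [|by cont|by cont].
  by rewrite (@integD _ _ _ (fun x => A ^+ 2 * F x ^+ 2)) ?integZ//; cont.
apply: le_trans S1 _; rewrite big_split/= -!mulr_sumr lerD2l.
have sumE (f g h : nat -> R) u v w : \sum_(k <- r) (u * f k + v * g k + w * h k) =
    u * (\sum_(k <- r) f k) + v * (\sum_(k <- r) g k) + w * (\sum_(k <- r) h k).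
  by rewrite !mulr_sumr -!big_split.
rewrite (sumE (fun k => integ 0 delta (fun x => modeF L0 l k phi x ^+ 2))
  (fun k => integ 0 delta (fun x => modeG L0 l dl k phi x ^+ 2))
  (fun k => integ 0 delta (fun x => modeG L0 l dl k ('D_dirx phi) x ^+ 2))).
have d0 : 0 <= delta := ltW delta_gt0.
apply: ler_wpM2l; first by rewrite mulr_ge0.
rewrite [X in _ <= X + _]mulrDl; apply: lerD; first apply: lerD.
- by rewrite -mulrA; apply: ler_wpM2l sF; exact: sqr_ge0.
- by rewrite -mulrA; apply: ler_wpM2l sG.
- by rewrite -mulrA; apply: ler_wpM2l sH; exact: sqr_ge0.
Qed.

End WindowBound.

(** * The profile near the junction *)

Section ProfileExtension.
Context {R : realType}.
Implicit Types (f g df : R -> R) (x c : R).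

Lemma derive1n_local f g (a b : R) : (forall x, a < x < b -> f x = g x) ->
  (forall n x, a < x < b -> derivable (derive1n n g) x 1) ->
  forall n x, a < x < b -> derivable (derive1n n f) x 1.
Proof.
move=> fg dg.
have near_in x : a < x < b -> \forall t \near x, a < t < b.
  move=> /andP[ax xb]; near=> t; apply/andP; split; near: t;
    [exact: lt_nbhsr|exact: lt_nbhsl].
have E n : forall x, a < x < b -> derive1n n f x = derive1n n g x.
  elim: n => [|n IH] x hx; first exact: fg.
  rewrite !derive1nS; apply: is_derive_derive1.
  apply: (near_eq_is_derive (f := derive1n n g)).
    by apply: filterS (near_in x hx) => t ht; rewrite IH.
  exact: derivable_is_derive (dg n x hx).
move=> n x hx.
suff : is_derive x 1 (derive1n n f) (derive1 (derive1n n g) x) by move=> ?; exact: ex_derive.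
apply: (near_eq_is_derive (f := derive1n n g)).
  by apply: filterS (near_in x hx) => t ht; rewrite E.
exact: derivable_is_derive (dg n x hx).
Unshelve. all: by end_near.
Qed.

(** The last hypothesis makes both the difference quotient and [df] tend to 0 from the right, which
    matches the constant on the left to first order. *)
Lemma glue_at_zero f df c : (forall x, x <= 0 -> f x = c) -> (forall x, x <= 0 -> df x = 0) ->
  (forall x, 0 < x -> is_derive x 1 f (df x)) -> (forall x, 0 < x -> {for x, continuous df}) ->
  (forall e : R, 0 < e -> exists2 d, 0 < d & forall x, 0 < x < d ->
     `|f x - c| <= e * x /\ `|df x| <= e) ->
  (forall x, is_derive x 1 f (df x)) /\ continuous df.
Proof.
move=> f0 df0 fd dfc H.
have neg x : x < 0 -> \forall t \near x, t <= 0.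
  by move=> x0; near=> t; apply: ltW; near: t; exact: lt_nbhsl.
split=> x; have [x0|x0|->] := ltgtP x 0.
- rewrite df0 ?ltW//; apply: (near_eq_is_derive (f := fun _ : R => c)).
  by apply: filterS (neg x x0) => t t0; rewrite f0.
- exact: fd.
- have lim : h^-1 *: (f (h *: 1 + 0) - f 0) @[h --> 0^'] --> (0 : R).
    apply/cvgrPdist_le => e e0; have [d d0 Hd] := H e e0; near=> h.
    rewrite sub0r normrN addr0 /GRing.scale/= mulr1 (f0 0)//.
    have hn0 : h != 0 by near: h; exact: nbhs_dnbhs_neq.
    have hd : `|h| < d by near: h; exact: dnbhs0_lt.
    have [h0|h0] := leP h 0; first by rewrite f0// subrr mulr0 normr0 ltW.
    rewrite gtr0_norm// in hd; have [h1 _] := Hd h (introT andP (conj h0 hd)).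
    by rewrite normrM normfV (gtr0_norm h0) ler_pdivrMl// mulrC.
  rewrite df0//; apply: DeriveDef; first by apply/cvg_ex; exists 0.
  exact/cvg_lim.
- have n0 : \forall t \near x, df t = 0 by apply: filterS (neg x x0) => t t0; rewrite df0.
  apply/cvgrPdist_le => e e0; rewrite df0 ?ltW//.
  by apply: filterS n0 => t ->; rewrite subrr normr0 ltW.
- exact: dfc.
- apply/cvgrPdist_le => e e0; have [d d0 Hd] := H e e0.
  have nd : \forall h \near (0 : R), `|h| < d by exact: nbhs0_lt.
  apply: filterS nd => h hd; rewrite df0// sub0r normrN.
  have [h0|h0] := leP h 0; first by rewrite df0// normr0 ltW.
  by rewrite gtr0_norm// in hd; case: (Hd h (introT andP (conj h0 hd))).
Unshelve. all: by end_near.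
Qed.

Lemma inv_sqr_near (a b : R) : 0 < b -> b / 2 <= a -> a <= b ->
  `|(a ^+ 2)^-1| <= 4 / b ^+ 2 /\ `|(a ^+ 2)^-1 - (b ^+ 2)^-1| <= 8 / b ^+ 3 * `|a - b|.
Proof.
move=> b0 ba ab; have a0 : 0 < a by lra.
have e1 : `|(a ^+ 2)^-1| <= 4 / b ^+ 2.
  rewrite ger0_norm ?invr_ge0 ?sqr_ge0//.
  have -> : 4 / b ^+ 2 = ((b / 2) ^+ 2)^-1 by field; rewrite gt_eqF.
  rewrite lef_pV2 ?posrE ?exprn_gt0//; last by lra.
  by rewrite ler_sqr ?nnegrE//; lra.
split => //.
have -> : (a ^+ 2)^-1 - (b ^+ 2)^-1 = - ((a ^+ 2)^-1 * ((a + b) / b ^+ 2) * (a - b)).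
  by field; rewrite !gt_eqF.
have e2 : `|(a + b) / b ^+ 2| <= 2 / b.
  have s0 : 0 <= (a + b) / b ^+ 2 by rewrite divr_ge0 ?sqr_ge0//; lra.
  rewrite (ger0_norm s0) ler_pdivrMr ?exprn_gt0//.
  have -> : 2 / b * b ^+ 2 = b + b by field; rewrite gt_eqF.
  exact: lerD.
rewrite normrN normrM; apply: ler_wpM2r => //.
have -> : 8 / b ^+ 3 = 4 / b ^+ 2 * (2 / b) by field; rewrite gt_eqF.
exact: normrM_le.
Qed.

End ProfileExtension.

Section ProfileWindow.
Context {R : realType}.
Variables (B0 B1 L0 cL gamma : R) (L : R -> R).
Hypothesis HL : billiard_profile B0 B1 L0 cL gamma L.

Lemma profile_asymptotics : exists d C : R, [/\ 0 < d <= 1, d < B1, 0 < C &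
  forall x, 0 < x < d -> [/\ `|L x - L0| <= C * x `^ gamma,
    `|derive1 L x| <= C * x `^ (gamma - 1) & L0 / 2 <= L x]].
Proof.
have g := profile_gamma HL; have c0 := profile_cL_gt0 HL.
have B10 := profile_B1_gt0 HL; have L00 := profile_L0_gt0 HL.
have /eqoP/(_ 1 ltr01) H1 := profile_expansion HL.
have /eqoP/(_ 1 ltr01) H2 := profile_expansion' HL.
have H : nbhs (0 : R) [set x | 0 < x ->
    `|L x - (L0 - cL * x `^ gamma)| <= 1 * `|x `^ gamma| /\
    `|derive1 L x + cL * gamma * x `^ (gamma - 1)| <= 1 * `|x `^ (gamma - 1)|].
  exact: filterI H1 H2.
have /nbhs_ballP[d /= d0 Hd] := H.
pose C := cL + cL * gamma + 1.
have cg : 0 < cL * gamma by rewrite mulr_gt0//; lra.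
have C0 : 0 < C by rewrite /C; lra.
(* For [x < m] one has [x^gamma <= x] because [m <= 1], hence [C x^gamma <= L0 / 2], and [L] stays
   above [L0 / 2]. *)
pose m := Num.min (Num.min 1 (B1 / 2)) (Num.min d (L0 / (2 * C))).
have m0 : 0 < m.
  by rewrite !lt_min ltr01 d0 divr_gt0//= divr_gt0// mulr_gt0.
have [m1 m2 m3 m4] : [/\ m <= 1, m <= B1 / 2, m <= d & m <= L0 / (2 * C)].
  by rewrite /m !ge_min !lexx ?orbT.
exists m, C; split => //; [by rewrite m0|lra|].
move=> x /andP[x0 xm].
have xb : ball (0:R) d x by rewrite /ball/= sub0r normrN gtr0_norm//; lra.
have [k1 k2] := Hd x xb x0.
rewrite !mul1r !(ger0_norm (powR_ge0 _ _)) in k1 k2.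
have p1 := powR_ge0 x gamma; have p2 := powR_ge0 x (gamma - 1).
have e1 : `|L x - L0| <= C * x `^ gamma.
  move: k1; rewrite !ler_norml => /andP[k3 k4]; move: (x `^ gamma) p1 k3 k4 => z z0 k3 k4.
  have : 0 <= cL * gamma * z by rewrite mulr_ge0// ltW.
  have : 0 <= cL * z by rewrite mulr_ge0// ltW.
  by rewrite /C => *; apply/andP; split; lra.
split=> //.
  move: k2; rewrite !ler_norml => /andP[k3 k4]; move: (x `^ (gamma - 1)) p2 k3 k4 => z z0 k3 k4.
  have : 0 <= cL * gamma * z by rewrite mulr_ge0// ltW.
  have : 0 <= cL * z by rewrite mulr_ge0// ltW.
  by rewrite /C => *; apply/andP; split; lra.
have xx : x `^ gamma <= x by apply: ge1r_powR; lra.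
have : C * x `^ gamma <= L0 / 2.
  apply: le_trans (_ : C * (L0 / (2 * C)) <= _).
    by apply: ler_wpM2l; [exact: ltW|lra].
  by rewrite le_eqVlt; apply/orP; left; apply/eqP; field; rewrite gt_eqF.
move: e1; rewrite ler_norml => /andP[e1 _]; lra.
Qed.

(** The fibre height has to be a positive [C^1] function on the whole line. [L] is therefore brought
    back to [L0] away from the junction, by a cutoff equal to 1 below [d / 2] and to 0 beyond
    [3 d / 4]. It matches the flat part in [C^1] because [L - L0] is [O(x^gamma)] and [L'] is
    [O(x^(gamma - 1))] with [gamma > 1]. *)
Lemma profile_extension : exists (l dl : R -> R) (d C : R),
  [/\ [/\ 0 < d <= 1, d < B1 & 0 < C],
      (forall x, L0 / 2 <= l x) /\ (forall x, l x <= L0),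
      (forall x : R, is_derive x 1 l (dl x)) /\ continuous dl,
      (forall x, x <= 0 -> l x = L0) /\ (forall x, 0 < x < d -> l x = L x) &
      forall delta, 0 < delta < d -> forall x, 0 <= x <= delta ->
        `|dl x / l x ^+ 2| <= C * delta `^ (gamma - 1) /\
        `|(l x ^+ 2)^-1 - (L0 ^+ 2)^-1| <= C * delta `^ gamma].
Proof.
have g := profile_gamma HL.
have B10 := profile_B1_gt0 HL; have L00 := profile_L0_gt0 HL.
have [d [C [/andP[d0 d1] dB C0 HC]]] := profile_asymptotics.
have dn : d != 0 by rewrite gt_eqF.
pose ch x := step (- (4 / d) * x + 3).
pose dch x := - (4 / d) * derive1 step (- (4 / d) * x + 3).
have chd (x : R) : is_derive x 1 ch (dch x) by exact: is_derive_step_affine.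
have cdch : continuous dch.
  apply: contM; first exact: cont_cst.
  apply: (@cont_comp _ _ (derive1 step)); first by case: (@step_Ck R 1).
  by apply: contD; [apply: contM; [exact: cont_cst|move=> ?; exact: cvg_id]|exact: cont_cst].
have arg x : - (4 / d) * x + 3 = (3 * d - 4 * x) / d by field.
have ch01 x : 0 <= ch x <= 1 by exact: step_ge0_le1.
have ch1 x : x < d / 2 -> ch x = 1 /\ dch x = 0.
  move=> h; rewrite /ch /dch step1 ?step_der1 ?mulr0//.
    by rewrite arg ltr_pdivlMr//; lra.
  by rewrite arg ler_pdivlMr//; lra.
have ch0 x : 3 * d < 4 * x -> ch x = 0 /\ dch x = 0.
  move=> h; rewrite /ch /dch step0 ?step_der0 ?mulr0//.
    by rewrite arg ltr_pdivrMr//; lra.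
  by rewrite arg ler_pdivrMr//; lra.
pose l x := if x <= 0 then L0 else L0 + ch x * (L x - L0).
pose dl x := if x <= 0 then 0 else dch x * (L x - L0) + ch x * derive1 L x.
have lpos x : 0 < x -> l x = L0 + ch x * (L x - L0) by move=> h; rewrite /l leNgt h.
have dlpos x : 0 < x -> dl x = dch x * (L x - L0) + ch x * derive1 L x.
  by move=> h; rewrite /dl leNgt h.
have pos_near (x : R) : 0 < x -> \forall t \near x, 0 < t by move=> h; exact: lt_nbhsr.
have far (x : R) : 3 * d < 4 * x -> \forall t \near x, 3 * d < 4 * t.
  move=> h; near=> t; have : 3 * d / 4 < t by near: t; apply: lt_nbhsr; lra.
  by lra.
have lfar x : 3 * d < 4 * x -> l x = L0 /\ dl x = 0.
  move=> h; have x0 : 0 < x by lra.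
  by have [h1 h2] := ch0 x h; rewrite lpos// dlpos// h1 h2 !mul0r !addr0.
have [ld cdl] : (forall x : R, is_derive x 1 l (dl x)) /\ continuous dl.
  apply: (@glue_at_zero _ l dl L0).
  - by move=> x h; rewrite /l h.
  - by move=> x h; rewrite /dl h.
  - move=> x x0; have [xd|xd] := ltP x d; last first.
      have h : 3 * d < 4 * x by lra.
      have [_ ->] := lfar x h; apply: (near_eq_is_derive (f := fun _ : R => L0)).
      by apply: filterS (far x h) => t /lfar[].
    rewrite dlpos//.
    apply: (near_eq_is_derive (f := fun x => L0 + ch x * (L x - L0))).
      by apply: filterS (pos_near x x0) => t t0; rewrite lpos.
    have dL : is_derive x 1 L (derive1 L x).
      by apply: derivable_is_derive; apply: (profile_derivable HL); lra.
    have := derD (derC L0 x) (derM (chd x) (derD dL (derC (- L0) x))).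
    by rewrite add0r addr0.
  - move=> x x0; have [xd|xd] := ltP x d; last first.
      have h : 3 * d < 4 * x by lra.
      have [_ e] := lfar x h; apply/cvgrPdist_le => ep ep0.
      by apply: filterS (far x h) => t /lfar[_ ->]; rewrite e subrr normr0 ltW.
    have xB : 0 < x < B1 by rewrite x0; lra.
    have cL1 : {for x, continuous (fun x => dch x * (L x - L0) + ch x * derive1 L x)}.
      apply: cvgD; apply: cvgM.
      + exact: cdch.
      + by apply: cvgB; [exact: (profile_continuous HL)|exact: cvg_cst].
      + exact: (@der_cont _ ch dch chd x).
      + by apply/differentiable_continuous/derivable1_diffP; exact: (@profile_smooth _ _ _ _ _ _ _ HL 1).
    apply/cvgrPdist_le => ep ep0; move/cvgrPdist_le : cL1 => /(_ ep ep0) H.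
    rewrite dlpos//; apply: filterS2 H (pos_near x x0) => t H t0.
    by rewrite dlpos.
  (* [m] solves [C m^(gamma - 1) = e]. *)
  - move=> e e0; pose m := (e / C) `^ (gamma - 1)^-1.
    have m0 : 0 < m by rewrite powR_gt0// divr_gt0.
    exists (Num.min (d / 2) m); first by rewrite lt_min m0 andbT; lra.
    move=> x /andP[x0]; rewrite lt_min => /andP[xd xm].
    have [c1 c2] := ch1 x xd; rewrite lpos// dlpos// c1 c2 !mul1r mul0r add0r [L0 + _]addrC subrK.
    have xd' : 0 < x < d by lra.
    have [h1 h2 _] := HC x xd'.
    have pw : C * x `^ (gamma - 1) <= e.
      rewrite mulrC -ler_pdivlMr//.
      have -> : e / C = m `^ (gamma - 1).
        by rewrite -powRrM mulVf ?powRr1 ?ltW ?divr_gt0// gt_eqF; lra.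
      by apply: ge0_ler_powR; rewrite ?nnegrE ?ltW//; lra.
    split; last exact: le_trans pw.
    apply: le_trans h1 _; rewrite -(mulr_powRB1 (ltW x0)); last by lra.
    by rewrite mulrCA mulrC; apply: ler_wpM2r => //; exact: ltW.
have lb x : L0 / 2 <= l x <= L0.
  have [x0|x0] := leP x 0; first by rewrite /l x0; lra.
  have [xd|xd] := ltP x d; last first.
    have h : 3 * d < 4 * x by lra.
    by have [-> _] := lfar x h; lra.
  have xd' : 0 < x < d by rewrite x0.
  have [_ _ h] := HC x xd'; have /andP[h1 h2] := ch01 x.
  have hL : L x <= L0 by apply: (profile_le_L0 HL); have := profile_B0_gt0 HL; lra.
  rewrite lpos//; apply/andP; split; first nra.
  by rewrite gerDl mulr_ge0_le0//; lra.
have q1 : 0 < C * (4 / L0 ^+ 2) by rewrite mulr_gt0// divr_gt0// exprn_gt0.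
have q2 : 0 < C * (8 / L0 ^+ 3) by rewrite mulr_gt0// divr_gt0// exprn_gt0.
(* The radius is halved: only below [d / 2] does [l] coincide with [L]. *)
exists l, dl, (d / 2), (C * (4 / L0 ^+ 2) + C * (8 / L0 ^+ 3)); split.
- by split; [lra|lra|exact: addr_gt0].
- by split=> x; have /andP[] := lb x.
- by [].
- split=> x; first by move=> h; rewrite /l h.
  move=> /andP[x0 xd]; rewrite lpos//; have [-> _] := ch1 x xd.
  by rewrite mul1r addrC subrK.
have g0 : 0 <= gamma by lra.
have g1 : 0 <= gamma - 1 by lra.
have dd : d / 2 <= d by lra.
move=> delta hd x hx; have [dl0 dld] := andP hd; have [x0 xdl] := andP hx.
have p1 := powR_ge0 delta (gamma - 1); have p2 := powR_ge0 delta gamma.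
have K0 := addr_ge0 (ltW q1) (ltW q2).
have [x00|x0'] := leP x 0.
  by rewrite /dl /l x00 mul0r subrr normr0; split; exact: mulr_ge0.
have xdd := le_lt_trans xdl dld.
have [c1 c2] := ch1 x xdd.
have [h1 h2 h3] := HC x (introT andP (conj x0' (lt_le_trans xdd dd))).
have lE : l x = L x by rewrite lpos// c1 mul1r addrC subrK.
have dlE : dl x = derive1 L x by rewrite dlpos// c1 c2 mul0r mul1r add0r.
rewrite lE dlE; have /andP[_ lL0] := lb x; rewrite lE in lL0.
have [iL iL'] := inv_sqr_near L00 h3 lL0.
have mono e : 0 <= e -> C * x `^ e <= C * delta `^ e.
  move=> e0; apply: ler_wpM2l; first exact: ltW.
  by apply: ge0_ler_powR => //; rewrite nnegrE// ltW.
split.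
  apply: le_trans (normrM_le (le_trans h2 (mono _ g1)) iL) _.
  by rewrite mulrAC; apply: ler_wpM2r => //; rewrite lerDl ltW.
apply: le_trans iL' _.
apply: le_trans (_ : 8 / L0 ^+ 3 * (C * delta `^ gamma) <= _).
  apply: ler_wpM2l; first by rewrite divr_ge0// exprn_ge0// ltW.
  exact: le_trans (mono _ g0).
by rewrite mulrA [_ * C]mulrC; apply: ler_wpM2r => //; rewrite lerDr ltW.
Unshelve. all: by end_near.
Qed.

End ProfileWindow.

(** * Traces of the propagating modes *)

Section WindowEstimate.
Context {R : realType}.
Variables (B0 B1 L0 cL gamma : R) (L : R -> R).
Hypothesis HL : billiard_profile B0 B1 L0 cL gamma L.
Let D : set (R * R) := billiard B0 B1 L.

(** [window_bound] with [m1] of order [delta^(gamma - 1)] and [m2] of order [delta^gamma]. The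
    condition on [E delta^(gamma + 2)] makes the coefficient of [modeF] of order [1 / delta], and
    the one on [E delta^(2 gamma)] does the same for the [modeG phi] contribution. The contribution
    of ['D_dirx phi] alone keeps its powers, namely [E delta^(2 gamma + 1)]. *)
Lemma window_estimate : exists d C : R, [/\ 0 < d, 0 < C &
  forall delta E r, 0 < delta < d -> 0 < E ->
  E * delta ^+ 2 * delta `^ gamma <= 1 -> E * (delta `^ gamma) ^+ 2 <= 1 ->
  uniq r -> all (leq 1) r -> (forall k, k \in r -> (k%:R * pi / L0) ^+ 2 < E) ->
  exists2 CE, 0 <= CE & forall phi eta, test_function D phi ->
    0 <= eta -> near_solution B0 B1 L0 L E phi eta ->
    \sum_(k <- r) modeF L0 (fun _ => L0) k phi 0 ^+ 2 <= eta ^+ 2 * CE +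
      C / delta * integ 0 B1 (fun x => integ 0 L0 (fun y => phi (x, y) ^+ 2)) +
      C * E * delta * (delta `^ gamma) ^+ 2 *
        integ 0 B1 (fun x => integ 0 L0 (fun y => 'D_dirx phi (x, y) ^+ 2))].
Proof.
have g0 : 0 < gamma by have := profile_gamma HL; lra.
have B10 := profile_B1_gt0 HL; have L00 := profile_L0_gt0 HL; have B00 := profile_B0_gt0 HL.
have [l [dl [d [C [[/andP[d0 d1] dB C0] [l1 l2] [ld cdl] [lL0 lL] lC]]]]] := profile_extension HL.
pose T1 := 3 * L0 * (L0 ^+ 2 * C + 6) ^+ 2; pose T2 := 27 * L0 ^+ 5 * C ^+ 2.
pose T3 := 3 * L0 ^+ 5 * C ^+ 2.
have LC6 : 0 < L0 ^+ 2 * C + 6 by rewrite addr_gt0// mulr_gt0// exprn_gt0.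
have T10 : 0 < T1 by rewrite /T1 mulr_gt0 ?exprn_gt0// mulr_gt0.
have T20 : 0 < T2 by rewrite !mulr_gt0// exprn_gt0.
have T30 : 0 < T3 by rewrite !mulr_gt0// exprn_gt0.
exists d, (T1 + T2 + T3); split => //; first by lra.
move=> delta E r /andP[dl0 dld] E0 H1 H2 ur r1 rE.
have dlB : delta <= B1 by exact: ltW (lt_trans dld dB).
have lgt x : 0 < l x by apply: lt_le_trans (l1 x); rewrite divr_gt0.
have l00 : l 0 = L0 by apply: lL0.
have lsm n x : 0 < x < delta -> derivable (derive1n n l) x 1.
  apply: (@derive1n_local _ l L 0 delta).
    by move=> t /andP[t0 td]; rewrite lL// t0 (lt_trans td dld).
  by move=> m t /andP[t0 td]; apply: (profile_smooth HL); rewrite t0 (lt_le_trans td dlB).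
have lD (x y : R) : 0 < x < delta -> 0 < y < l x -> D (x, y).
  move=> /andP[x0 xd] /andP[y0 yl]; rewrite lL ?x0 ?(lt_trans xd dld)// in yl.
  split => /=; last by rewrite !ltW.
  by rewrite (ltW (lt_le_trans xd dlB)) andbT (le_trans _ (ltW x0))// oppr_le0 ltW.
have lI (x y : R) : 0 <= x <= delta -> interior D (x, y) -> 0 < y < l x.
  move=> /andP[x0 xd] /interior_billiard[_ y0 yL]; rewrite y0/=.
  move: x0; rewrite le_eqVlt => /orP[/eqP xE|x0].
    by move: yL; rewrite -xE l00 (profile_flat HL)// lexx oppr_le0 ltW.
  by rewrite lL// x0 (le_lt_trans xd dld).
have hd : 0 < delta < d by rewrite dl0.
have := @window_bound R B0 B1 L0 cL gamma L HL l dl delta dl0 dlB l00 lgt l2 ld cdl lsm lD lI E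
  (C * delta `^ (gamma - 1)) (C * delta `^ gamma) r E0
  (fun x hx => (lC delta hd x hx).1) (fun x hx => (lC delta hd x hx).2) ur r1 rE.
move=> [CE CE0 HCE]; exists CE => // phi eta tp eta0 ns.
apply: le_trans (HCE phi eta tp eta0 ns) _.
rewrite -addrA lerD2l.
have Y0 : 0 <= integ 0 B1 (fun x => integ 0 L0 (fun y => phi (x, y) ^+ 2)).
  by apply: integ_ge0 => x _; apply: integ_ge0 => y _; exact: sqr_ge0.
have X0 : 0 <= integ 0 B1 (fun x => integ 0 L0 (fun y => 'D_dirx phi (x, y) ^+ 2)).
  by apply: integ_ge0 => x _; apply: integ_ge0 => y _; exact: sqr_ge0.
have P0 : 0 < delta `^ gamma by exact: powR_gt0.
have PE : delta `^ (gamma - 1) = delta `^ gamma / delta.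
  by rewrite -(mulr_powRB1 (ltW dl0) g0) mulrC mulKf// gt_eqF.
rewrite PE.
move: (delta `^ gamma) (integ 0 B1 _) (integ 0 B1 _) P0 Y0 X0 H1 H2 => P X Y P0 Y0 X0 H1 H2.
have dn : delta != 0 by rewrite gt_eqF.
have E1 : E * L0 ^+ 2 * (C * P) * delta + 6 / delta =
  ((E * delta ^+ 2 * P) * (L0 ^+ 2 * C) + 6) / delta by field.
have E2 : 6 * delta * (delta ^+ 2 * (E * L0 ^+ 2 * (C * (P / delta)) ^+ 2 * (L0 ^+ 3 / 2))) =
   T3 * E * delta * P ^+ 2 by rewrite /T3; field.
have E3 : 6 * delta * (9 * (E * L0 ^+ 2 * (C * (P / delta)) ^+ 2 * (L0 ^+ 3 / 2))) =
   T2 / delta * (E * P ^+ 2) by rewrite /T2; field.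
have LC0 : 0 <= L0 ^+ 2 * C by rewrite mulr_ge0 ?sqr_ge0// ltW.
have q0 : 0 <= E * delta ^+ 2 * P by rewrite !mulr_ge0 ?sqr_ge0 ?ltW.
have q1 : 0 <= E * P ^+ 2 by rewrite mulr_ge0 ?sqr_ge0 ?ltW.
have I1 : 6 * delta * ((((E * delta ^+ 2 * P) * (L0 ^+ 2 * C) + 6) / delta) ^+ 2 * (L0 / 2)) <=
    T1 / delta.
  have -> : 6 * delta * ((((E * delta ^+ 2 * P) * (L0 ^+ 2 * C) + 6) / delta) ^+ 2 * (L0 / 2)) =
     3 * L0 * (E * delta ^+ 2 * P * (L0 ^+ 2 * C) + 6) ^+ 2 / delta by field.
  apply: ler_wpM2r; first by rewrite invr_ge0 ltW.
  apply: ler_wpM2l; first by rewrite mulr_ge0// ltW.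
  have a0 : 0 <= E * delta ^+ 2 * P * (L0 ^+ 2 * C) + 6.
    by apply: addr_ge0 => //; exact: mulr_ge0.
  rewrite ler_sqr ?nnegrE; [|exact: a0|exact: ltW].
  by rewrite lerD2r ler_piMl.
have I3 : T2 / delta * (E * P ^+ 2) <= T2 / delta.
  by rewrite ler_piMr// divr_ge0// ltW.
have T3d : 0 <= T3 / delta by rewrite divr_ge0// ltW.
have EdP : 0 <= E * delta * P ^+ 2 by rewrite !mulr_ge0 ?sqr_ge0// ltW.
rewrite mulrDr [leLHS](_ : _ = (6 * delta * ((((E * delta ^+ 2 * P) * (L0 ^+ 2 * C) + 6) / delta) ^+ 2
    * (L0 / 2)) + T2 / delta * (E * P ^+ 2)) * Y + T3 * E * delta * P ^+ 2 * X); last first.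
  by rewrite -E2 -E3 E1; ring.
apply: lerD; apply: ler_wpM2r; [exact: Y0| |exact: X0|].
  by apply: le_trans (lerD I1 I3) _; rewrite !mulrDl lerDl.
rewrite [leLHS](_ : _ = T3 * (E * delta * P ^+ 2)); last by ring.
rewrite [leRHS](_ : _ = (T1 + T2 + T3) * (E * delta * P ^+ 2)); last by ring.
by apply: ler_wpM2r => //; rewrite lerDr ltW// addr_gt0.
Qed.

End WindowEstimate.

(** * Sums over the frequencies in [x] *)

Section ResonanceSum.
Context {R : realType}.
Implicit Types (N n l : nat) (h m e : R).

Lemma sum_inv_sqr N : \sum_(l < N) (l%:R^-1 : R) ^+ 2 <= 2.
Proof.
case: N => [|N]; first by rewrite big_ord0.
(* Strengthened so as to telescope. The term of index 0 contributes nothing because [0^-1 = 0]. *)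
suff H n : \sum_(l < n.+2) (l%:R^-1 : R) ^+ 2 <= 2 - n.+1%:R^-1.
  case: N => [|N]; first by rewrite big_ord1 invr0 expr0n.
  by apply: le_trans (H N) _; rewrite gerBl invr_ge0 ler0n.
elim: n => [|n IH].
  by rewrite big_ord_recl big_ord1 invr0 invr1 expr0n expr1n add0r/=; lra.
rewrite big_ord_recr/=; apply: le_trans (lerD IH (lexx _)) _.
have n1 : 0 < n.+1%:R :> R by rewrite ltr0n.
have n2 : 0 < n.+2%:R :> R by rewrite ltr0n.
have -> : n.+1%:R = n.+2%:R - 1 :> R by rewrite -[n.+2]addn1 natrD addrK.
have : n.+1%:R = n.+2%:R - 1 :> R by rewrite -[n.+2]addn1 natrD addrK.
move: (n.+2%:R) n2 => x x0 xE; rewrite xE in n1.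
have : x^-1 ^+ 2 <= (x - 1)^-1 - x^-1.
  have -> : (x - 1)^-1 - x^-1 = ((x - 1) * x)^-1 by field; rewrite !gt_eqF.
  rewrite expr2 -invfM lef_pV2 ?posrE ?mulr_gt0//; nra.
lra.
Qed.

(** Truncated subtraction together with [0^-1 = 0] removes the terms with [l <= n], so this is a
    shifted copy of the basic sum. *)
Lemma sum_inv_sqr_above N n : \sum_(l < N) ((l - n)%N%:R^-1 : R) ^+ 2 <= 2.
Proof.
apply: le_trans (sum_inv_sqr (N - n)).
elim: N => [|N IH]; first by rewrite sub0n !big_ord0.
rewrite big_ord_recr/=; have [Nn|nN] := ltnP N n.
  have /eqP -> : (N - n)%N == 0%N by rewrite subn_eq0 ltnW.
  have /eqP -> : (N.+1 - n)%N == 0%N by rewrite subn_eq0.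
  rewrite big_ord0 invr0 expr0n/= addr0; apply: le_trans IH _.
  have /eqP -> : (N - n)%N == 0%N by rewrite subn_eq0 ltnW.
  by rewrite big_ord0.
by rewrite subSn// big_ord_recr/= lerD2r.
Qed.

Lemma sum_inv_sqr_below N n : \sum_(l < N) ((n - l)%N%:R^-1 : R) ^+ 2 <= 2.
Proof.
apply: le_trans (sum_inv_sqr n.+1).
elim: n N => [|n IH] N.
  rewrite big1 => [|i _]; last by rewrite sub0n invr0 expr0n.
  by apply: sumr_ge0 => i _; exact: sqr_ge0.
case: N => [|N]; first by rewrite big_ord0 sumr_ge0// => i _; exact: sqr_ge0.
rewrite big_ord_recl [leRHS]big_ord_recr/= subn0 [leRHS]addrC; apply: lerD => //.
by under eq_bigr do rewrite /bump/= add1n subSS; exact: IH.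
Qed.

Lemma sum_nonpos h m N : 0 < h -> m <= 0 ->
  \sum_(l < N) (l%:R * h / ((l%:R * h) ^+ 2 - m)) ^+ 2 <= 2 / h ^+ 2.
Proof.
move=> h0 m0; have hn : h != 0 by rewrite gt_eqF.
apply: le_trans (_ : \sum_(l < N) (l%:R^-1 ^+ 2) / h ^+ 2 <= _); last first.
  by rewrite -mulr_suml; apply: ler_wpM2r (sum_inv_sqr N); rewrite invr_ge0 sqr_ge0.
apply: ler_sum => -[l /= _] _; have [->|l0] := eqVneq l 0%N.
  by rewrite invr0 !mul0r expr0n/= mul0r.
have lp : 0 < l%:R :> R by rewrite ltr0n lt0n.
move: (l%:R) lp => x x0.
have xh : 0 < x * h by rewrite mulr_gt0.
have -> : x^-1 ^+ 2 / h ^+ 2 = ((x * h)^-1) ^+ 2 by field; rewrite hn gt_eqF.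
have den : 0 < (x * h) ^+ 2 - m by rewrite subr_gt0 (le_lt_trans m0)// exprn_gt0.
rewrite ler_sqr ?nnegrE ?invr_ge0 ?(ltW xh)//; last by rewrite divr_ge0 ?(ltW xh) ?(ltW den).
rewrite ler_pdivrMr// mulrBr expr2 mulKf ?gt_eqF// lerDl oppr_ge0.
by rewrite mulr_ge0_le0// invr_ge0 ltW.
Qed.

(* With [m = w ^ 2] the general term is at most [1 / (l h - w) ^ 2], except for
   the two frequencies next to [w], where nonresonance bounds the denominator. *)
Lemma sum_resonant h w e N : 0 < h -> 0 < w -> 0 < e ->
  (forall l, (0 < l)%N -> e <= `|w ^+ 2 - (l%:R * h) ^+ 2|) ->
  \sum_(l < N) (l%:R * h / ((l%:R * h) ^+ 2 - w ^+ 2)) ^+ 2 <=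
    4 / h ^+ 2 + 2 * ((w + h) / e) ^+ 2.
Proof.
move=> h0 w0 e0 nr; have hn : h != 0 by rewrite gt_eqF.
(* Since [n h <= w < (n + 1) h], the two exceptional indices are [n] and [n + 1], collected in
   [near]. Any other index is at distance at least [(n - l) h] or [(l - (n + 1)) h] from [w];
   truncated subtraction lets [tail] cover both sides in one formula. *)
pose n := Num.truncn (w / h).
have /andP[n1 n2] : n%:R <= w / h < n.+1%:R.
  by rewrite /n truncn_itv// divr_ge0 ?ltW.
have nw : n%:R * h <= w by rewrite -ler_pdivlMr.
have wn : w < n.+1%:R * h by rewrite -ltr_pdivrMr.
pose T := ((w + h) / e) ^+ 2.
have T0 : 0 <= T by exact: sqr_ge0.
have ih : 0 <= (h ^+ 2)^-1 by rewrite invr_ge0 sqr_ge0.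
pose near l : R := T * ((l == n)%:R + (l == n.+1)%:R).
pose tail l : R := (h ^+ 2)^-1 * (((n - l)%N%:R^-1) ^+ 2 + ((l - n.+1)%N%:R^-1) ^+ 2).
have term l : (l%:R * h / ((l%:R * h) ^+ 2 - w ^+ 2)) ^+ 2 <= near l + tail l.
  have tl0 : 0 <= tail l by rewrite mulr_ge0// addr_ge0// sqr_ge0.
  have nl0 : 0 <= near l by rewrite mulr_ge0// addr_ge0.
  have [l0|l0] := eqVneq l 0%N.
    by rewrite [leLHS](_ : _ = 0) ?addr_ge0// l0 !mul0r expr0n.
  have lp : 0 < l%:R * h :> R by rewrite mulr_gt0// ltr0n lt0n.
  have far (s : R) : 0 < s -> s * h <= `|l%:R * h - w| ->
      (l%:R * h / ((l%:R * h) ^+ 2 - w ^+ 2)) ^+ 2 <= (h ^+ 2)^-1 * (s^-1) ^+ 2.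
    move: (l%:R * h) lp => x x0 s0 sx.
    have d0 : 0 < `|x - w| by apply: lt_le_trans sx; rewrite mulr_gt0.
    have xw0 : x - w != 0 by rewrite -normr_gt0.
    have xw : 0 < x + w by rewrite addr_gt0.
    (* Factoring [x^2 - w^2]: the quotient [x / (x + w)] is at most 1, and only the distance to [w]
       is left. *)
    have -> : (x / (x ^+ 2 - w ^+ 2)) ^+ 2 = (x / (x + w)) ^+ 2 * ((`|x - w|)^-1) ^+ 2.
      rewrite exprVn real_normK ?num_real// subr_sqr; field.
      by rewrite xw0 gt_eqF.
    have a1 : (x / (x + w)) ^+ 2 <= 1.
      rewrite expr_le1 ?divr_ge0 ?(ltW x0) ?(ltW xw)// ler_pdivrMr// mul1r lerDl ltW//.
    have a2 : ((`|x - w|)^-1) ^+ 2 <= (h ^+ 2)^-1 * (s^-1) ^+ 2.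
      rewrite -exprVn -exprMn -invfM ler_sqr ?nnegrE ?invr_ge0 ?mulr_ge0 ?(ltW h0) ?(ltW s0) ?normr_ge0//.
      by rewrite lef_pV2 ?posrE ?mulr_gt0// mulrC.
    by apply: le_trans (ler_piMl _ a1) a2; exact: sqr_ge0.
  have [ln|nl] := ltnP l n.
    apply: le_trans (_ : tail l <= _); last by rewrite lerDr.
    apply: le_trans (far (n - l)%N%:R _ _) _.
    - by rewrite ltr0n subn_gt0.
    - rewrite natrB ?(ltnW ln)// distrC ger0_norm; first by rewrite mulrBl lerD2r.
      rewrite subr_ge0; apply: le_trans nw; apply: ler_wpM2r; [exact: ltW|rewrite ler_nat; exact: ltnW].
    - by rewrite /tail mulrDr lerDl mulr_ge0// sqr_ge0.
  have [ln|nl2] := ltnP n.+1 l.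
    apply: le_trans (_ : tail l <= _); last by rewrite lerDr.
    apply: le_trans (far (l - n.+1)%N%:R _ _) _.
    - by rewrite ltr0n subn_gt0.
    - have le1 : n.+1%:R * h <= l%:R * h by apply: ler_wpM2r; [exact: ltW|rewrite ler_nat; exact: ltnW].
      rewrite natrB ?(ltnW ln)// ger0_norm; last by rewrite subr_ge0; exact: le_trans (ltW wn) le1.
      by rewrite mulrBl lerD2l lerN2 ltW.
    - by rewrite /tail mulrDr lerDr mulr_ge0// sqr_ge0.
  apply: le_trans (_ : near l <= _); last by rewrite lerDl.
  have one : 1 <= (l == n)%:R + (l == n.+1)%:R :> R.
    have [->|ln] := eqVneq l n; first by rewrite lerDl ler0n.
    suff -> : l == n.+1 by rewrite add0r.
    by rewrite eqn_leq nl2 ltn_neqAle eq_sym ln nl.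
  apply: le_trans (ler_peMr T0 one).
  have lw : l%:R * h <= w + h.
    apply: le_trans (_ : n.+1%:R * h <= _); first by rewrite ler_pM2r// ler_nat.
    by rewrite -addn1 natrD mulrDl mul1r lerD2r.
  have le := nr l; rewrite lt0n l0 in le; have {}le := le isT.
  rewrite /T -[X in X <= _]real_normK ?num_real// ler_sqr ?nnegrE//; last first.
    by rewrite divr_ge0 ?addr_ge0 ?ltW.
  rewrite normrM normfV distrC (gtr0_norm lp).
  have p0 : 0 < `|w ^+ 2 - (l%:R * h) ^+ 2| := lt_le_trans e0 le.
  by apply: ler_pM; rewrite ?invr_ge0 ?(ltW lp) ?(ltW p0) ?lef_pV2 ?posrE.
apply: le_trans (ler_sum _ (fun (l : 'I_N) _ => term l)) _.
rewrite big_split/= -!mulr_sumr !big_split/= addrC; apply: lerD.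
  rewrite mulrC; apply: ler_wpM2r => //.
  have := sum_inv_sqr_below N n; have := sum_inv_sqr_above N n.+1; lra.
rewrite mulrC; apply: ler_wpM2r => //.
have one j : \sum_(l < N) (nat_of_ord l == j)%:R <= 1 :> R.
  have [jN|Nj] := ltnP j N; last first.
    rewrite big1 ?ler01// => l _; suff -> : (nat_of_ord l == j) = false by [].
    by apply/eqP => lj; move: (ltn_ord l); rewrite lj ltnNge Nj.
  rewrite (bigD1 (Ordinal jN))//= eqxx big1 ?addr0// => l lj.
  suff -> : (nat_of_ord l == j) = false by [].
  by apply/negbTE; apply: contraNneq lj => lj; apply/eqP/val_inj.
have := one n; have := one n.+1; lra.
Qed.

End ResonanceSum.

(** * Modes in the rectangle *)

Section ParsevalRate.
Context {R : realType}.

(** In [parseval_defect] the free parameter [b = e / (2 a)] uses up one half of the admissible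
    error, and [K] is then taken large for the other half. [K] precedes [g]: one truncation serves
    all functions, the Hoelder constant [G] entering only as a factor. *)
Lemma parseval_rate (p a e : R) : 0 < a -> 0 < e -> exists K : nat, forall (g : R -> R) (G : R),
  continuous g -> g p = 0 -> g (p + a) = 0 -> 0 <= G ->
  (forall y t, p <= y <= p + a -> p <= t <= p + a -> (g y - g t) ^+ 2 <= G * `|y - t|) ->
  integ p (p + a) (fun y => g y ^+ 2) <=
  2 / a * (\sum_(j < K.+1) integ p (p + a) (fun y => g y * sinb p a j y) ^+ 2) + G * e.
Proof.
move=> a0 e0; pose b := e / (2 * a).
have b0 : 0 < b by rewrite divr_gt0// mulr_gt0.
have pi0 : 0 < pi :> R := pi_gt0 R.
pose X := 2 * a * 64 / (pi / a) ^+ 2 / (b * e).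
pose K := (Num.truncn X).+1.
have wa0 : 0 < pi / a := divr_gt0 pi0 a0.
have X0 : 0 < X.
  apply: divr_gt0; last exact: mulr_gt0.
  by apply: divr_gt0; [apply: mulr_gt0 => //; exact: mulr_gt0|exact: exprn_gt0].
have XK : X <= 2 * K%:R + 2.
  have : X < K%:R by exact: truncnS_gt.
  have : 0 <= K%:R :> R by [].
  lra.
exists K => g G cg g0 g1 G0 H.
apply: le_trans (parseval_defect a0 K cg g0 g1 G0 b0 H) _.
rewrite lerD2l -mulrA; apply: ler_wpM2l => //.
rewrite mulrDr (_ : a * b = e / 2); last by rewrite /b; field; rewrite gt_eqF.
suff : a * (64 / (pi / a) ^+ 2 / (b * (2 * K%:R + 2))) <= e / 2 by lra.
have K2 : 0 < 2 * K%:R + 2 :> R by exact: lt_le_trans XK.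
have -> : a * (64 / (pi / a) ^+ 2 / (b * (2 * K%:R + 2))) = X * e / 2 / (2 * K%:R + 2).
  rewrite /X; move: (pi / a) wa0 (2 * K%:R + 2) K2 => v v0 d d0.
  have [vn dn bn en] : [/\ v != 0, d != 0, b != 0 & e != 0] by rewrite !gt_eqF.
  by move: (b) bn => b' bn; field; rewrite vn dn bn en.
by rewrite ler_pdivrMr//; nra.
Qed.

(** Cauchy-Schwarz in the integral of [df] between the two points. It supplies the hypothesis of
    [parseval_rate], with [G] the integral of [df^2]. *)
Lemma holder_half (p q : R) (f df : R -> R) : (forall x : R, is_derive x 1 f (df x)) ->
  continuous df -> forall x t, p <= x <= q -> p <= t <= q ->
  (f x - f t) ^+ 2 <= integ p q (fun s => df s ^+ 2) * `|x - t|.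
Proof.
move=> fd cdf x t hx ht.
wlog xt : x t hx ht / t <= x => [W|].
  have [h|h] := leP t x; first exact: W.
  by rewrite distrC -sqrrN opprB; apply: W => //; exact: ltW.
rewrite ger0_norm ?subr_ge0// -(integ_FTC xt cdf fd).
have := integ_CauchySchwarz t x cdf (@cont_cst _ _ (1 : R)).
rewrite (_ : (fun s => df s * 1) = df); last by apply/funext => s; rewrite mulr1.
rewrite [X in _ * X](_ : _ = x - t); last by rewrite integ_cst// expr1n mul1r.
move=> H; apply: le_trans H _; apply: ler_wpM2r; first by rewrite subr_ge0.
have cJ : continuous (fun s => df s ^+ 2) by exact: contX.
have h2 : t <= x <= q by rewrite xt; case/andP: hx.
rewrite (integ_split cJ ht) (integ_split cJ h2).
have p1 : 0 <= integ p t (fun s => df s ^+ 2) by apply: integ_ge0 => s _; exact: sqr_ge0.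
have p2 : 0 <= integ x q (fun s => df s ^+ 2) by apply: integ_ge0 => s _; exact: sqr_ge0.
by rewrite addrCA lerDl addr_ge0.
Qed.

End ParsevalRate.

Section ModeEstimate.
Context {R : realType}.
Variables (B0 B1 L0 cL gamma : R) (L : R -> R) (c0 eps : R).
Hypothesis HL : billiard_profile B0 B1 L0 cL gamma L.
Hypotheses (c0_gt0 : 0 < c0) (eps_ge0 : 0 <= eps).
Let D : set (R * R) := billiard B0 B1 L.
Let B0_gt0 : 0 < B0 := profile_B0_gt0 HL.
Let B1_gt0 : 0 < B1 := profile_B1_gt0 HL.
Let L0_gt0 : 0 < L0 := profile_L0_gt0 HL.

Definition mode_energy (E : R) (k : nat) : R := E - (k%:R * pi / L0) ^+ 2.

(** Size of the resonance factor. A mode with non-positive energy is evanescent in [x] and stays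
    away from resonance, hence the weight 1. *)
Definition mode_weight (E : R) (k : nat) : R :=
  if 0 < mode_energy E k then E `^ (1 + 2 * eps) else 1.

Lemma powR_split (E : R) : 0 < E -> E `^ (1 + 2 * eps) = E * E `^ eps ^+ 2.
Proof.
move=> E0; have En : E != 0 by rewrite gt_eqF.
rewrite powRD ?En ?implybT// powRr1 ?ltW//.
by rewrite -(powR_mulrn 2 (powR_ge0 E eps)) -powRrM [eps * 2]mulrC.
Qed.

Lemma mode_weight_ge1 (E : R) k : 1 <= E -> 1 <= mode_weight E k.
Proof.
move=> E1; rewrite /mode_weight; case: ifP => // _; rewrite powR_split ?(lt_le_trans ltr01)//.
have : 1 <= E `^ eps by rewrite -(powRr0 E); apply: ler_powR.
nra.
Qed.

(** For positive mode energy [w <= sqrt E], and the gap in [sum_resonant] is [c0 E^(- eps)], so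
    [((w + h) / e)^2] is at most a constant times [E^(1 + 2 eps)]; [E >= 1] absorbs the shift by
    [h]. *)
Lemma resonance_weight : exists2 C, 0 < C & forall (E : R) k N, 1 <= E ->
  nonresonant B0 L0 c0 eps E -> (0 < k)%N ->
  \sum_(l < N) (l%:R * (pi / B0) / ((l%:R * (pi / B0)) ^+ 2 - mode_energy E k)) ^+ 2 <=
    C * mode_weight E k.
Proof.
pose h := pi / B0; have h0 : 0 < h by rewrite divr_gt0 ?pi_gt0.
have hn : h != 0 by rewrite gt_eqF.
have c0n : c0 != 0 by rewrite gt_eqF.
have i1 : 0 < 4 / h ^+ 2 by rewrite divr_gt0 ?exprn_gt0.
have i2 : 0 <= 2 * ((1 + h) / c0) ^+ 2 by rewrite mulr_ge0 ?sqr_ge0.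
exists (4 / h ^+ 2 + 2 * ((1 + h) / c0) ^+ 2); first by lra.
move=> E k N E1 [E0 nr] k0; rewrite -/h.
have W1 := mode_weight_ge1 k E1; rewrite /mode_weight in W1 *.
case: ltP W1 => [m0|m0] W1; last first.
  by rewrite mulr1; apply: le_trans (sum_nonpos N h0 m0) _; lra.
pose w := Num.sqrt (mode_energy E k).
have w0 : 0 < w by rewrite sqrtr_gt0.
have wE : w ^+ 2 = mode_energy E k by rewrite sqr_sqrtr ?ltW.
have e0 : 0 < c0 * E `^ (- eps) by rewrite mulr_gt0// powR_gt0.
have nr' l : (0 < l)%N -> c0 * E `^ (- eps) <= `|w ^+ 2 - (l%:R * h) ^+ 2|.
  move=> l0; have := nr k l k0 l0; rewrite wE /mode_energy /h.
  by rewrite -!exprMn -!expr_div_n -[l%:R * pi / B0]mulrA.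
rewrite -wE; apply: le_trans (sum_resonant N h0 w0 e0 nr') _.
rewrite [leRHS]mulrDl; apply: lerD; first by rewrite ler_peMr// ltW.
rewrite -[leRHS]mulrA; apply: ler_wpM2l => //.
rewrite powR_split// powRN.
have P0 : 0 < E `^ eps by rewrite powR_gt0.
have wsE : w <= Num.sqrt E.
  by apply: ler_wsqrtr; rewrite /mode_energy gerBl sqr_ge0.
have sE : Num.sqrt E ^+ 2 = E by rewrite sqr_sqrtr ?ltW.
have sE1 : 1 <= Num.sqrt E by rewrite -sqrtr1 ler_wsqrtr.
move: (Num.sqrt E) wsE sE sE1 => s ws sE s1.
move: (E `^ eps) P0 => P P0; rewrite -sE.
have -> : ((1 + h) / c0) ^+ 2 * (s ^+ 2 * P ^+ 2) = ((s * (1 + h)) * P / c0) ^+ 2 by field.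
have -> : (w + h) / (c0 * P^-1) = (w + h) * P / c0 by field; rewrite c0n gt_eqF.
have s0 : 0 <= s by lra.
rewrite ler_sqr ?nnegrE; [|by rewrite !mulr_ge0 ?invr_ge0 ?addr_ge0 ?ltW|
  by rewrite !mulr_ge0 ?invr_ge0 ?addr_ge0 ?(ltW P0) ?(ltW c0_gt0) ?(ltW h0)].
apply: ler_wpM2r; first by rewrite invr_ge0 ltW.
apply: ler_wpM2r; first exact: ltW.
nra.
Qed.

Lemma mode0 (l : R -> R) phi (x : R) : modeF L0 l 0 phi x = 0.
Proof.
by rewrite -[RHS](integ0 0 L0); apply: eq_integ => y _; rewrite !mul0r sin0 mulr0.
Qed.

Notation F := (modeF L0 (fun _ => L0)).

Lemma mode_holder phi k (x t : R) : test_function D phi -> - B0 <= x <= 0 -> - B0 <= t <= 0 ->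
  (F k phi x - F k phi t) ^+ 2 <=
  L0 * integ (- B0) 0 (fun x => integ 0 L0 (fun y => 'D_dirx phi (x, y) ^+ 2)) * `|x - t|.
Proof.
move=> tp hx ht; have c0' := test_continuous tp.
have c1 := test_continuous (test_derive tp (or_introl erefl)).
have dl (s : R) : is_derive s 1 (fun _ : R => L0) 0 by exact: derC.
have cF1 : continuous (F k ('D_dirx phi)) := modeF_cont (fun _ => L0_gt0) dl c1.
have dF (x' : R) : is_derive x' 1 (F k phi) (F k ('D_dirx phi) x').
  have := modeF_derive L0 k (fun _ => L0_gt0) dl (@cont_cst _ _ 0) x' tp.
  have -> : modeG L0 (fun _ => L0) (fun _ => 0) k phi x' = 0.
    by rewrite -[RHS](integ0 0 L0); apply: eq_integ => y _; rewrite mul0r !mulr0.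
  by rewrite subr0.
pose J (s : R) := integ 0 L0 (fun y => 'D_dirx phi (s, y) ^+ 2).
have cJ : continuous J.
  by apply: (@integ_param_continuous _ (fun z => 'D_dirx phi z ^+ 2)); exact: contX.
have J0 x' : 0 <= J x' by apply: integ_ge0 => y _; exact: sqr_ge0.
have FJ x' : F k ('D_dirx phi) x' ^+ 2 <= L0 * J x'.
  have cs : continuous (fun y : R => sin (k%:R * pi * (y / L0))).
    have -> : (fun y : R => sin (k%:R * pi * (y / L0))) =
        (fun y : R => sin (k%:R * pi / L0 * (y - 0))).
      by apply/funext => y; rewrite subr0; congr sin; ring.
    exact: cont_sin_affine.
  have := integ_CauchySchwarz 0 L0 (@cont_pair2 _ _ x' c1) cs.
  move=> H; apply: le_trans H _; rewrite mulrC; apply: ler_wpM2r; first exact: J0.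
  rewrite -[leRHS](_ : integ 0 L0 (fun _ => 1) = _); last by rewrite integ_cst ?(ltW L0_gt0)// mul1r subr0.
  apply: le_integ; [by cont|exact: cont_cst|move=> y _].
  by rewrite -[leRHS](cos2Dsin2 (k%:R * pi * (y / L0))) lerDr sqr_ge0.
apply: le_trans (holder_half dF cF1 hx ht) _; apply: ler_wpM2r => //.
rewrite -(integZ _ _ _ cJ); apply: le_integ; [exact: (@contX _ _ _ 2 cF1)| |move=> s _; exact: FJ].
exact: contM (@cont_cst _ _ L0) cJ.
Qed.

(** Sine coefficients of the linear ramp from 0 at [- B0] to 1 at 0, which [mode_estimate] subtracts
    to restore a Dirichlet condition at 0. *)
Lemma integ_ramp_sinb (j : nat) : (0 < j)%N ->
  integ (- B0) 0 (fun x => (x + B0) / B0 * sinb (- B0) B0 j x) =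
  - (cos (j%:R * pi) / (j%:R * (pi / B0))).
Proof.
move=> j0; pose lam := j%:R * (pi / B0).
have B0n : B0 != 0 by rewrite gt_eqF.
have lam0 : lam != 0 by rewrite gt_eqF// mulr_gt0 ?ltr0n// divr_gt0 ?pi_gt0.
have lB : lam * B0 = j%:R * pi by rewrite /lam; field.
have dq (x : R) : is_derive x 1 (fun x => (x + B0) / B0) B0^-1.
  have := derZ B0^-1 (derD (derI x) (derC B0 x)); rewrite addr0 mulr1.
  by congr is_derive; apply/funext => t; rewrite mulrC.
have dc (x : R) : is_derive x 1 (fun x => - lam^-1 * cos (lam * (x - - B0))) (sinb (- B0) B0 j x).
  have := derZ (- lam^-1) (is_derive_cos_affine lam (- B0) x).
  by rewrite mulrNN mulKf.
have NB : - B0 <= 0 by rewrite oppr_le0 ltW.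
have := integ_by_parts NB (@cont_cst _ _ B0^-1) (@sinb_cont _ (- B0) B0 j) dq dc.
move=> ->; rewrite integZ; last first.
  by apply: contM; [exact: cont_cst|exact: cont_cos_affine].
rewrite integZ; last exact: cont_cos_affine.
have := @integ_cos_affine R lam (- B0) B0 (ltW B0_gt0) lam0.
rewrite addNr lB sin_npi => -> //.
by rewrite add0r sub0r opprK lB divff// mul1r !mul0r !mulr0 !subr0 mulNr mulrC.
Qed.

Lemma sqr_sum3_le (x y z : R) : (x + y + z) ^+ 2 <= 3 * (x ^+ 2 + y ^+ 2 + z ^+ 2).
Proof.
have := sqr_ge0 (x - y); have := sqr_ge0 (x - z); have := sqr_ge0 (y - z); nra.
Qed.

(** The coefficient vanishes at [- B0] but not at 0, so [parseval_rate] applies to [g], its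
    difference with [f 0] times the ramp [q]. A sine coefficient of [g] has three parts: an error of
    order [eta], the trace times [lam j / N j] from [rect_mode_identity], and that of the ramp. The
    squares of the second sum to the resonance factor, those of the third converge like the sum of
    [1 / j^2]. *)
Lemma mode_estimate : exists2 C, 0 < C & forall (E e : R) k, 1 <= E -> 0 < e ->
  nonresonant B0 L0 c0 eps E -> (0 < k)%N ->
  exists2 CE, 0 <= CE & forall phi eta, test_function D phi -> 0 <= eta ->
    near_solution B0 B1 L0 L E phi eta ->
    integ (- B0) 0 (fun x => F k phi x ^+ 2) <=
    C * (mode_weight E k * F k phi 0 ^+ 2) + eta ^+ 2 * CE +
    e * integ (- B0) 0 (fun x => integ 0 L0 (fun y => 'D_dirx phi (x, y) ^+ 2)).
Proof.
have [Cr Cr0 HCr] := resonance_weight.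
have B0n : B0 != 0 by rewrite gt_eqF.
have p0 : 0 < pi :> R := pi_gt0 R.
pose h := pi / B0; have h0 : 0 < h by rewrite divr_gt0.
have ih : 0 < 2 / h ^+ 2 by rewrite divr_gt0// exprn_gt0.
have iB : 0 < B0^-1 by rewrite invr_gt0.
exists (12 / B0 * (Cr + 2 / h ^+ 2) + 4 / B0 + 2 * B0).
  by rewrite !addr_gt0// ?mulr_gt0// addr_gt0.
move=> E e k E1 e0 nr k0.
have E0 : 0 <= E by lra.
(* The Hoelder constant of [g] has a gradient part and a ramp part. The second entry makes the
   former cost at most [e / 2], and [ex <= 1] bounds the latter by a multiple of [f 0 ^ 2]. *)
pose ex := Num.min 1 (e / (4 * L0)).
have ex0 : 0 < ex by rewrite lt_min ltr01 divr_gt0// mulr_gt0.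
have ex1 : ex <= 1 by rewrite ge_min lexx.
have exL : 4 * L0 * ex <= e.
  have : ex <= e / (4 * L0) by rewrite ge_min lexx orbT.
  by rewrite ler_pdivlMr ?mulr_gt0// mulrC.
have [K HK] := parseval_rate (- B0) B0_gt0 ex0.
pose lam j : R := j%:R * h.
pose N j := lam j ^+ 2 - mode_energy E k.
have Nn j : (0 < j)%N -> N j != 0.
  move=> j0; rewrite -normr_gt0 /N distrC.
  have [_ /(_ k j k0 j0)] := nr; rewrite /mode_energy /lam /h.
  rewrite -!exprMn -!expr_div_n -[j%:R * pi / B0]mulrA; apply: lt_le_trans.
  by rewrite mulr_gt0// powR_gt0//; lra.
have exC j : exists C : R, 0 <= C /\ forall phi eta,
    test_function D phi -> 0 <= eta -> near_solution B0 B1 L0 L E phi eta ->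
    `|lam j * cos (j%:R * pi) * F k phi 0 + N j *
      integ (- B0) 0 (fun x => F k phi x * sinb (- B0) B0 j x)| <= eta * C.
  by have [C C0 HC] := rect_mode_identity HL k j E0; exists C.
have [Cj HCj] := choice exC.
pose T := \sum_(j < K.+1) (Cj j / N j) ^+ 2.
have T0 : 0 <= T by apply: sumr_ge0 => j _; exact: sqr_ge0.
exists (12 / B0 * T); first by rewrite mulr_ge0// divr_ge0// ltW.
move=> phi eta tp eta0 ns.
pose X := integ (- B0) 0 (fun x => integ 0 L0 (fun y => 'D_dirx phi (x, y) ^+ 2)).
rewrite -/X.
have X0 : 0 <= X by apply: integ_ge0 => x _; apply: integ_ge0 => y _; exact: sqr_ge0.
have cph := test_continuous tp.
have dl (s : R) : is_derive s 1 (fun _ : R => L0) 0 by exact: derC.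
have cF : continuous (F k phi) := modeF_cont (fun _ => L0_gt0) dl cph.
have FB : F k phi (- B0) = 0.
  rewrite -[RHS](integ0 0 L0); apply: eq_integ => y _.
  by rewrite (test_vanish_left _ tp) ?mul0r.
have hold x t : - B0 <= x <= 0 -> - B0 <= t <= 0 ->
   (F k phi x - F k phi t) ^+ 2 <= L0 * X * `|x - t| by exact: mode_holder.
have modes j := (HCj j).2 phi eta tp eta0 ns.
have W1 := mode_weight_ge1 k E1; have HW := HCr E k K.+1 E1 nr k0.
move: (F k phi) cF FB hold modes => f cf fB hold modes.
pose q (x : R) := (x + B0) / B0.
have cq : continuous q.
  have -> : q = fun x => B0^-1 * x + 1 by apply/funext => x; rewrite /q; field.
  by exact: (Ck_continuous (@Ck_affine R 0 _ _)).
pose g x := f x - f 0 * q x.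
have cg : continuous g by rewrite /g; cont.
have g0 : g (- B0) = 0 by rewrite /g fB /q addNr mul0r mulr0 subrr.
have g1 : g (- B0 + B0) = 0 by rewrite addNr /g /q add0r divff// mulr1 subrr.
have G0 : 0 <= 2 * (L0 * X + f 0 ^+ 2 / B0).
  apply: mulr_ge0 => //; apply: addr_ge0; first exact: mulr_ge0 (ltW L0_gt0) X0.
  exact: mulr_ge0 (sqr_ge0 _) (ltW iB).
have gh y t : - B0 <= y <= - B0 + B0 -> - B0 <= t <= - B0 + B0 ->
    (g y - g t) ^+ 2 <= 2 * (L0 * X + f 0 ^+ 2 / B0) * `|y - t|.
  rewrite addNr => hy ht; have H := hold y t hy ht.
  have -> : g y - g t = (f y - f t) - f 0 * ((y - t) / B0) by rewrite /g /q; field.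
  have H2 : (f 0 * ((y - t) / B0)) ^+ 2 <= f 0 ^+ 2 / B0 * `|y - t|.
    rewrite exprMn -mulrA; apply: ler_wpM2l; first exact: sqr_ge0.
    rewrite expr_div_n -[(y - t) ^+ 2]real_normK ?num_real//.
    have n1 : `|y - t| <= B0 by rewrite ler_norml; lra.
    have n0 : 0 <= `|y - t| by [].
    move: (`|y - t|) n0 n1 => d d0 d1.
    have -> : B0^-1 * d = (B0 * d) / B0 ^+ 2 by field.
    apply: ler_wpM2r; first by rewrite invr_ge0 sqr_ge0.
    by rewrite expr2; apply: ler_wpM2r.
  move: (f y - f t) (f 0 * ((y - t) / B0)) H H2 => a b H H2.
  have := sqr_ge0 (a + b).
  rewrite mulrDr mulrDl -!mulrA; rewrite -!mulrA in H H2; nra.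
have := HK g _ cg g0 g1 G0 gh; rewrite addNr => HP.
have coef j : integ (- B0) 0 (fun x => g x * sinb (- B0) B0 j x) ^+ 2 <=
   3 * (eta ^+ 2 * (Cj j / N j) ^+ 2 + f 0 ^+ 2 * (lam j / N j) ^+ 2 +
        f 0 ^+ 2 * ((j%:R^-1) ^+ 2 / h ^+ 2)).
  have cs := @sinb_cont R (- B0) B0 j.
  have [j0|j0] := posnP j.
    rewrite (_ : integ _ _ _ = 0); last first.
      rewrite -[RHS](integ0 (- B0) 0); apply: eq_integ => x _.
      by rewrite /sinb j0 !mul0r sin0 mulr0.
    have s1 := sqr_ge0 (Cj j / N j); have s2 := sqr_ge0 (lam j / N j).
    have s3 : 0 <= (j%:R^-1) ^+ 2 / h ^+ 2 by rewrite divr_ge0 ?sqr_ge0.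
    by rewrite expr0n/= mulr_ge0// !addr_ge0// mulr_ge0// sqr_ge0.
  have -> : integ (- B0) 0 (fun x => g x * sinb (- B0) B0 j x) =
      integ (- B0) 0 (fun x => f x * sinb (- B0) B0 j x) + f 0 * (cos (j%:R * pi) / lam j).
    rewrite -[f 0 * _]opprK -mulrN -(integ_ramp_sinb j0) -integZ; last by cont.
    rewrite -integB; [|by cont|by cont].
    by apply: eq_integ => x _; rewrite /g /q; ring.
  have M := modes j; have Nj := Nn j j0.
  have lj : lam j != 0 by rewrite gt_eqF// mulr_gt0// ltr0n.
  have cc : (cos (j%:R * pi) : R) ^+ 2 = 1 by exact: sqr_cos_npi.
  move: (cos (j%:R * pi)) cc M => c cc M.
  move: (integ (- B0) 0 (fun x => f x * sinb (- B0) B0 j x)) M => I M.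
  (* [er] is the left-hand side of the approximate identity. Solving for [I] divides by [N j],
     nonzero by nonresonance, and the sign [c] disappears in the squares. *)
  set er := lam j * c * f 0 + N j * I in M.
  have -> : I + f 0 * (c / lam j) = er / N j + (- (c * f 0 * (lam j / N j))) + c * f 0 / lam j.
    by rewrite /er; field; rewrite Nj lj.
  apply: le_trans (sqr_sum3_le _ _ _) _; rewrite sqrrN !exprMn cc !mul1r.
  apply: ler_wpM2l => //; apply: lerD; last first.
    rewrite le_eqVlt; apply/orP; left; apply/eqP; congr (_ * _).
    by rewrite -[pi ^+ 2 * _]exprMn -[((pi / B0) ^+ 2)^-1]exprVn -exprMn -invfM.
  rewrite lerD2r [leRHS]mulrA; apply: ler_wpM2r; first exact: sqr_ge0.
  rewrite -exprMn -[er ^+ 2]real_normK ?num_real// ler_sqr ?nnegrE//.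
  by rewrite mulr_ge0//; case: (HCj j).
have coefs : \sum_(j < K.+1) integ (- B0) 0 (fun x => g x * sinb (- B0) B0 j x) ^+ 2 <=
    3 * (eta ^+ 2 * T + f 0 ^+ 2 * (Cr * mode_weight E k) + f 0 ^+ 2 * (2 / h ^+ 2)).
  apply: le_trans (ler_sum _ (fun (j : 'I_K.+1) _ => coef j)) _.
  rewrite -mulr_sumr !big_split/= -!mulr_sumr; apply: ler_wpM2l => //.
  apply: lerD; first (rewrite lerD2l; apply: ler_wpM2l; [exact: sqr_ge0|exact: HW]).
  apply: ler_wpM2l; first exact: sqr_ge0.
  rewrite -mulr_suml; apply: ler_wpM2r (sum_inv_sqr K.+1).
  by rewrite invr_ge0 sqr_ge0.
have fg : integ (- B0) 0 (fun x => f x ^+ 2) <=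
    2 * integ (- B0) 0 (fun x => g x ^+ 2) + 2 * B0 * f 0 ^+ 2.
  have -> : 2 * B0 * f 0 ^+ 2 = integ (- B0) 0 (fun _ => 2 * f 0 ^+ 2).
    by rewrite integ_cst; [ring|rewrite oppr_le0 ltW].
  have cg2 : continuous (fun x => g x ^+ 2) by cont.
  rewrite -integZ// -integD; [|by cont|exact: cont_cst].
  apply: le_integ; [by cont|by apply: contD; [cont|exact: cont_cst]|move=> x hx].
  have q01 : 0 <= q x <= 1.
    move: hx => /andP[x1 x2]; rewrite /q divr_ge0 ?(ltW B0_gt0)//= ?ler_pdivrMr ?mul1r//.
      by rewrite gerDr.
    by rewrite -lerBlDr sub0r.
  have q2 : f 0 ^+ 2 * q x ^+ 2 <= f 0 ^+ 2.
    by rewrite ler_piMr ?sqr_ge0//; have /andP[? ?] := q01; rewrite expr_le1.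
  have -> : f x = g x + f 0 * q x by rewrite /g; ring.
  rewrite -exprMn in q2; move: (f 0 * q x) q2 => b q2.
  have := sqr_ge0 (g x - b); nra.
move: (integ _ _ (fun x => f x ^+ 2)) (integ _ _ (fun x => g x ^+ 2)) HP fg => If Ig HP fg.
move: (\sum_(j < K.+1) _) coefs HP => S coefs HP.
have c2 : 2 / B0 * S <= 2 / B0 * (3 * (eta ^+ 2 * T + f 0 ^+ 2 * (Cr * mode_weight E k) + f 0 ^+ 2 * (2 / h ^+ 2))).
  by apply: ler_wpM2l coefs; rewrite divr_ge0// ltW.
move: (mode_weight E k) W1 c2 => w W1 c2.
have F0 := sqr_ge0 (f 0); move: (f 0 ^+ 2) F0 c2 fg HP => z z0 c2 fg HP.
have wz : z <= w * z by rewrite ler_peMl.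
have r1 : 2 * (L0 * X + z / B0) * ex <= e / 2 * X + 2 / B0 * (w * z).
  rewrite mulrDr mulrDl; apply: lerD.
    rewrite (_ : 2 * (L0 * X) * ex = (4 * L0 * ex) / 2 * X); last by field.
    by apply: ler_wpM2r => //; lra.
  rewrite (_ : 2 * (z / B0) * ex = 2 / B0 * (ex * z)); last by field.
  apply: ler_wpM2l; first by rewrite divr_ge0// ltW.
  by apply: le_trans wz; rewrite ler_piMl.
have r2 : z * (2 / h ^+ 2) <= w * z * (2 / h ^+ 2) by apply: ler_wpM2r => //; exact: ltW.
have r3 : 2 / B0 * (3 * (eta ^+ 2 * T + z * (Cr * w) + z * (2 / h ^+ 2))) <=
   2 / B0 * (3 * (eta ^+ 2 * T + z * (Cr * w) + w * z * (2 / h ^+ 2))).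
  apply: ler_wpM2l; first by rewrite divr_ge0// ltW.
  by apply: ler_wpM2l => //; rewrite lerD2l.
have r4 : 2 * B0 * z <= 2 * B0 * (w * z) by apply: ler_wpM2l => //; rewrite mulr_ge0// ltW.
rewrite [leRHS](_ : _ = 2 * (2 / B0 * (3 * (eta ^+ 2 * T + z * (Cr * w) + w * z * (2 / h ^+ 2))) +
   (e / 2 * X + 2 / B0 * (w * z))) + 2 * B0 * (w * z)); last by field; rewrite B0n gt_eqF.
lra.
Qed.

End ModeEstimate.

(** * The a priori estimate *)

Section APriori.
Context {R : realType}.
Variables (B0 B1 L0 cL gamma : R) (L : R -> R) (c0 eps : R).
Hypothesis HL : billiard_profile B0 B1 L0 cL gamma L.
Hypotheses (c0_gt0 : 0 < c0) (eps_ge0 : 0 <= eps).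
Let D : set (R * R) := billiard B0 B1 L.
Let B0_gt0 : 0 < B0 := profile_B0_gt0 HL.
Let B1_gt0 : 0 < B1 := profile_B1_gt0 HL.
Let L0_gt0 : 0 < L0 := profile_L0_gt0 HL.

Notation F := (modeF L0 (fun _ => L0)).

Definition mass (a b : R) (psi : R * R -> R) : R :=
  integ a b (fun x => integ 0 L0 (fun y => psi (x, y) ^+ 2)).

Lemma fiber_cont (psi : R * R -> R) : continuous psi ->
  continuous (fun x => integ 0 L0 (fun y => psi (x, y) ^+ 2)).
Proof.
by move=> c; apply: (@integ_param_continuous _ (fun z => psi z ^+ 2)); exact: contX.
Qed.

Lemma mass_ge0 a b psi : 0 <= mass a b psi.
Proof. by apply: integ_ge0 => x _; apply: integ_ge0 => y _; exact: sqr_ge0. Qed.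

Lemma mass_split psi : continuous psi -> mass (- B0) B1 psi = mass (- B0) 0 psi + mass 0 B1 psi.
Proof.
move=> c; have h : - B0 <= 0 <= B1 by rewrite oppr_le0 !ltW.
exact: (integ_split (fiber_cont c) h).
Qed.

Lemma ip_mass psi : test_function D psi -> ip D psi psi = mass (- B0) B1 psi.
Proof.
move=> tp; rewrite (ip_test HL (test_continuous tp) tp).
by apply: eq_integ => x _; apply: eq_integ => y _; rewrite expr2.
Qed.

(** Each [eta * sqrt t] is at most [(t + eta^2) / 2]; half of [X + Z] then moves to the left, which
    yields the constants 3 and [2 + E]. *)
Lemma energy_absorb (X Z A E eta : R) : 0 <= X -> 0 <= Z -> 0 <= A -> 0 <= E ->
  X + Z - E * A <= eta * (Num.sqrt X + Num.sqrt Z + E * Num.sqrt A) ->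
  X + Z <= 3 * E * A + (2 + E) * eta ^+ 2.
Proof.
move=> X0 Z0 A0 E0.
have sx := sqr_sqrtr X0; have sz := sqr_sqrtr Z0; have sa := sqr_sqrtr A0.
rewrite -{1 3}sx -{1 3}sz -{1 3}sa.
move: (Num.sqrt X) (Num.sqrt Z) (Num.sqrt A) => x z a H.
have h1 := sqr_ge0 (x - eta); have h2 := sqr_ge0 (z - eta).
have h3 : 0 <= E * (a - eta) ^+ 2 by rewrite mulr_ge0// sqr_ge0.
rewrite !sqrrB !mulrDr in H h1 h2 h3 *.
rewrite !mulrDl; lra.
Qed.

(** [phi] is itself admissible as a test function in [near_solution]. *)
Lemma energy_bound E phi eta : 0 <= E -> test_function D phi ->
  near_solution B0 B1 L0 L E phi eta ->
  mass (- B0) B1 ('D_dirx phi) + mass (- B0) B1 ('D_diry phi) <=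
  3 * E * mass (- B0) B1 phi + (2 + E) * eta ^+ 2.
Proof.
move=> E0 tp ns; have := ns phi tp.
have t1 := test_derive tp (or_introl erefl); have t2 := test_derive tp (or_intror erefl).
have c := test_continuous tp; have c1 := test_continuous t1; have c2 := test_continuous t2.
rewrite (IT_form _ _ _ _ c1 c1 c2 c2 c c).
rewrite -(ip_test HL c1 t1) -(ip_test HL c2 t2) -(ip_test HL c tp).
rewrite (ip_mass t1) (ip_mass t2) (ip_mass tp) => /(le_trans (ler_norm _)).
apply: energy_absorb => //; exact: mass_ge0.
Qed.

(* [phi(0, y)^2] is minus the integral over the wing of [2 phi phi_x]. *)
Lemma trace_bound phi s (r : seq nat) : test_function D phi -> 0 < s -> uniq r -> all (leq 1) r ->
  \sum_(k <- r) F k phi 0 ^+ 2 <=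
  L0 / 2 * (s * mass 0 B1 phi + s^-1 * mass 0 B1 ('D_dirx phi)).
Proof.
move=> tp s0 ur r1; have sn : s != 0 by rewrite gt_eqF.
have t1 := test_derive tp (or_introl erefl).
have c := test_continuous tp; have c1 := test_continuous t1.
have vtop y : L0 <= y -> phi (0, y) = 0.
  move=> h; apply: (test_vanish tp) => /interior_billiard[_ _].
  by rewrite (profile_flat HL) ?lexx ?oppr_le0 ?(ltW B0_gt0)// ltNge h.
have c0y := @cont_pair2 _ _ 0 c.
apply: le_trans (sin_mode_bessel L0_gt0 (lexx L0) ur r1 c0y vtop) _.
apply: ler_wpM2l; first by rewrite divr_ge0// ltW.
have cc : continuous (fun z => 2 * phi z * 'D_dirx phi z) by cont.
have cR : continuous (fun z => s * phi z ^+ 2 + s^-1 * 'D_dirx phi z ^+ 2) by cont.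
have -> : s * mass 0 B1 phi + s^-1 * mass 0 B1 ('D_dirx phi) =
    integ 0 L0 (fun y => integ 0 B1 (fun x => s * phi (x, y) ^+ 2 + s^-1 * 'D_dirx phi (x, y) ^+ 2)).
  rewrite -(@integ_Fubini _ (fun z => s * phi z ^+ 2 + s^-1 * 'D_dirx phi z ^+ 2))//.
  have f1 := fiber_cont c; have f2 := fiber_cont c1.
  rewrite /mass -!integZ// -integD; [|by cont|by cont].
  apply: eq_integ => x _; have k1 := @cont_pair2 _ _ x c; have k2 := @cont_pair2 _ _ x c1.
  by rewrite -!integZ -?integD//; cont.
apply: le_integ; [by cont| |move=> y _].
  apply: (@integ_param_continuous _ (fun z => s * phi (z.2, z.1) ^+ 2 + s^-1 * 'D_dirx phi (z.2, z.1) ^+ 2)).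
  exact: (cont_swap cR).
have k1 := @cont_pair1 _ _ y c; have k2 := @cont_pair1 _ _ y c1.
have k3 := @cont_pair1 _ _ y cc; rewrite /= in k3.
have d2 (x : R) := derX2 (test_dx x y tp).
have := integ_FTC (ltW B1_gt0) k3 d2.
rewrite (test_vanish_right _ tp (lexx B1)) expr0n sub0r => H.
rewrite -[leLHS]opprK -H -integN//; apply: le_integ; [by cont|by cont|move=> x _].
(* Weighted inequality between [- 2 phi phi_x] and the two squares; the free weight [s] is later
   used to absorb the gradient. *)
have : 0 <= s^-1 * (s * phi (x, y) + 'D_dirx phi (x, y)) ^+ 2.
  by rewrite mulr_ge0 ?sqr_ge0// invr_ge0 ltW.
have -> : s^-1 * (s * phi (x, y) + 'D_dirx phi (x, y)) ^+ 2 =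
  s * phi (x, y) ^+ 2 + s^-1 * 'D_dirx phi (x, y) ^+ 2 + 2 * phi (x, y) * 'D_dirx phi (x, y).
  by field.
lra.
Qed.

(** Parseval in [y] on each slice, with a defect governed by the [y]-gradient, then [mode_estimate]
    for each of the finitely many modes, with a defect governed by the [x]-gradient. Both defects
    carry [(16 E)^-1], because the gradient is bounded by a multiple of [E] times the mass. *)
Lemma rect_estimate : exists2 C, 0 < C & forall E, 1 <= E -> nonresonant B0 L0 c0 eps E ->
  exists (K : nat) (CE : R), 0 <= CE /\ forall phi eta, test_function D phi -> 0 <= eta ->
    near_solution B0 B1 L0 L E phi eta ->
    mass (- B0) 0 phi <=
    C * (\sum_(k <- index_iota 1 K.+1) mode_weight L0 eps E k * F k phi 0 ^+ 2) + eta ^+ 2 * CE +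
    (16 * E)^-1 * (mass (- B0) 0 ('D_dirx phi) + mass (- B0) 0 ('D_diry phi)).
Proof.
have [C C0 HC] := mode_estimate HL c0_gt0 eps_ge0.
have L0n : L0 != 0 by rewrite gt_eqF.
have L20 : 0 < 2 / L0 by rewrite divr_gt0.
exists (2 / L0 * C); first exact: mulr_gt0.
move=> E E1 nr; have E0 : 0 < E by lra.
have e0 : 0 < (16 * E)^-1 by rewrite invr_gt0 mulr_gt0.
have [K HK] := parseval_rate 0 L0_gt0 e0.
(* Undoes the factor [2 / L0] of Parseval and shares the admissible defect among [K + 1] modes. *)
pose e := L0 / 2 * (16 * E)^-1 / K.+1%:R.
have K0 : 0 < K.+1%:R :> R by rewrite ltr0n.
have ep : 0 < e by rewrite /e divr_gt0// mulr_gt0// divr_gt0.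
have exC k : exists CE : R, 0 <= CE /\ ((0 < k)%N -> forall phi eta, test_function D phi ->
    0 <= eta -> near_solution B0 B1 L0 L E phi eta ->
    integ (- B0) 0 (fun x => F k phi x ^+ 2) <=
    C * (mode_weight L0 eps E k * F k phi 0 ^+ 2) + eta ^+ 2 * CE +
    e * mass (- B0) 0 ('D_dirx phi)).
  have [k0|k0] := posnP k; first by exists 0.
  by have [CE CE0 H] := HC E e k E1 ep nr k0; exists CE.
have [CE HCE] := choice exC.
exists K, (2 / L0 * \sum_(k <- index_iota 1 K.+1) CE k); split.
  apply: mulr_ge0; first exact: ltW.
  by apply: sumr_ge0 => k _; case: (HCE k).
move=> phi eta tp eta0 ns.
have t1 := test_derive tp (or_introl erefl); have t2 := test_derive tp (or_intror erefl).
have c := test_continuous tp; have c1 := test_continuous t1; have c2 := test_continuous t2.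
have dl (s : R) : is_derive s 1 (fun _ : R => L0) 0 by exact: derC.
have cF k : continuous (F k phi) := modeF_cont (fun _ => L0_gt0) dl c.
have cF2 k : continuous (fun x => F k phi x ^+ 2) by exact: contX.
have fc := fiber_cont c; have fc2 := fiber_cont c2.
have FE k x : integ 0 L0 (fun y => phi (x, y) * sinb 0 L0 k y) = F k phi x.
  apply: eq_integ => y _; rewrite /sinb subr0; congr (_ * sin _); ring.
have step1 : mass (- B0) 0 phi <= 2 / L0 * (\sum_(j < K.+1) integ (- B0) 0 (fun x => F j phi x ^+ 2)) +
    (16 * E)^-1 * mass (- B0) 0 ('D_diry phi).
  have cS : continuous (fun x => \sum_(j < K.+1) F j phi x ^+ 2) by exact: cont_sum.
  rewrite -integ_sum// -integZ// -[(16 * E)^-1 * _]integZ// -integD; [|by cont|by cont].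
  apply: le_integ; [by []|by cont|move=> x hx].
  have k0 := @cont_pair2 _ _ x c; have k2 := @cont_pair2 _ _ x c2.
  have G0 : 0 <= integ 0 L0 (fun y => 'D_diry phi (x, y) ^+ 2).
    by apply: integ_ge0 => y _; exact: sqr_ge0.
  have vt : phi (x, 0 + L0) = 0 by rewrite add0r (test_vanish_top HL _ tp).
  have := HK (fun y => phi (x, y)) _ k0 (test_vanish_bottom _ tp) vt G0.
  rewrite add0r => H; apply: le_trans (H _) _.
    by move=> y t hy ht; exact: (holder_half (fun y => test_dy x y tp) k2).
  rewrite [_ * (16 * E)^-1]mulrC lerD2r; apply: ler_wpM2l; first exact: ltW.
  by rewrite le_eqVlt; apply/orP; left; apply/eqP; apply: eq_bigr => j _; rewrite FE.
have step2 : \sum_(j < K.+1) integ (- B0) 0 (fun x => F j phi x ^+ 2) <=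
   C * (\sum_(k <- index_iota 1 K.+1) mode_weight L0 eps E k * F k phi 0 ^+ 2) +
   eta ^+ 2 * (\sum_(k <- index_iota 1 K.+1) CE k) + K.+1%:R * (e * mass (- B0) 0 ('D_dirx phi)).
  rewrite -(big_mkord xpredT (fun j => integ (- B0) 0 (fun x => F j phi x ^+ 2))) big_ltn//.
  rewrite [X in X + _](_ : _ = 0); last first.
    by rewrite -[RHS](integ0 (- B0) 0); apply: eq_integ => x _; rewrite mode0 expr0n.
  rewrite add0r.
  have -> : K.+1%:R * (e * mass (- B0) 0 ('D_dirx phi)) =
     e * mass (- B0) 0 ('D_dirx phi) + \sum_(k <- index_iota 1 K.+1) e * mass (- B0) 0 ('D_dirx phi).
    rewrite big_const_seq count_predT size_iota subn1/= iter_addr addr0.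
    by rewrite -natr1 mulrDl mul1r addrC mulr_natl.
  have me : 0 <= e * mass (- B0) 0 ('D_dirx phi) by rewrite mulr_ge0 ?mass_ge0// ltW.
  apply: le_trans (_ : C * (\sum_(k <- index_iota 1 K.+1) mode_weight L0 eps E k * F k phi 0 ^+ 2) +
   eta ^+ 2 * (\sum_(k <- index_iota 1 K.+1) CE k) +
   \sum_(k <- index_iota 1 K.+1) e * mass (- B0) 0 ('D_dirx phi) <= _); last first.
    by rewrite lerD2l lerDr.
  rewrite !mulr_sumr -!big_split/= big_nat [leRHS]big_nat; apply: ler_sum => k /andP[k0 _].
  by have [_ H] := HCE k; exact: H.
have alg (S T X Z k : R) : k != 0 ->
    2 / L0 * (C * S + eta ^+ 2 * T + k * (L0 / 2 * (16 * E)^-1 / k * X)) + (16 * E)^-1 * Z =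
    2 / L0 * C * S + eta ^+ 2 * (2 / L0 * T) + (16 * E)^-1 * (X + Z).
  by move=> kn; field; rewrite kn L0n gt_eqF.
apply: le_trans step1 _.
apply: le_trans (lerD (ler_wpM2l (ltW L20) step2) (lexx _)) _.
rewrite le_eqVlt; apply/orP; left; apply/eqP.
by rewrite alg// gt_eqF.
Qed.

Definition rho1 : R := (2 + gamma + 2 * (gamma + 1) * eps) / (2 * gamma + 1).

(** The modes with non-positive energy cost a factor [E] through [trace_bound]; this inequality
    makes [E^(2 rho1)] dominate that factor. *)
Lemma rho1_ge : 1 <= rho1 * 2.
Proof.
have g := profile_gamma HL; have e := eps_ge0.
by rewrite /rho1 mulrAC ler_pdivlMr; nra.
Qed.

(** [delta = c E^(- s)] with [s (2 gamma + 1) = 3 + 2 eps], the exponent that removes every power of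
    [E] from the fourth quantity; its smallness then rests on [c] alone. The second and third
    conditions hold since the exponents of [E] are non-positive, and the last equality holds because
    [1 + 2 eps + s = 2 rho1]. *)
Lemma window_scale (E c : R) : 1 <= E -> 0 < c <= 1 -> exists delta : R,
  [/\ 0 < delta <= c, E * delta ^+ 2 * delta `^ gamma <= 1, E * (delta `^ gamma) ^+ 2 <= 1,
      E ^+ 2 * E `^ (1 + 2 * eps) * delta * (delta `^ gamma) ^+ 2 <= c &
      E `^ (1 + 2 * eps) / delta = (E `^ rho1) ^+ 2 / c].
Proof.
move=> E1 /andP[cp c1]; have g := profile_gamma HL.
have E0 : 0 < E by lra.
have En : E != 0 by rewrite gt_eqF.
have cn : c != 0 by rewrite gt_eqF.
have G0 : 2 * gamma + 1 != 0 by rewrite gt_eqF//; lra.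
have e0 := eps_ge0.
have [s [sE sd s0 s1]] : exists s : R, [/\ s * (2 * gamma + 1) = 3 + 2 * eps,
    s = (3 + 2 * eps) / (2 * gamma + 1), 0 <= s & s <= 1 + eps].
  exists ((3 + 2 * eps) / (2 * gamma + 1)); split => //; first by rewrite mulfVK.
    by apply: divr_ge0; lra.
  by rewrite ler_pdivrMr; [nra|lra].
have pD a b : E `^ a * E `^ b = E `^ (a + b) by rewrite powRD// En implybT.
have p1 a : a <= 0 -> E `^ a <= 1.
  by move=> a0; rewrite -(powRr0 E); apply: ler_powR.
have EE : E = E `^ 1 by rewrite powRr1// ltW.
pose cg := c `^ gamma.
have cg0 : 0 < cg by exact: powR_gt0.
have cg1 : cg ^+ 2 <= 1.
  have : cg <= c by apply: ge1r_powR; [rewrite cp c1|lra].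
  by move=> h; rewrite expr_le1 ?(ltW cg0)//; lra.
pose x a := E `^ a.
have x0 a : 0 < x a by exact: powR_gt0.
have dE : (c * x (- s)) `^ gamma = cg * x (- (s * gamma)).
  by rewrite powRM ?(ltW cp) ?(ltW (x0 _))// /x -powRrM mulNr.
exists (c * x (- s)); rewrite dE; split.
- rewrite mulr_gt0//= ler_piMr ?(ltW cp)//; apply: p1; lra.
- have -> : E * (c * x (- s)) ^+ 2 * (cg * x (- (s * gamma))) =
    c ^+ 2 * cg * (x 1 * (x (- s) * x (- s)) * x (- (s * gamma))).
    by rewrite {1}EE -/(x 1); ring.
  rewrite /x !pD -/(x _).
  have h : x (1 + (- s + - s) - s * gamma) <= 1.
    apply: p1; have : s * gamma = (3 + 2 * eps - s) / 2 by rewrite -sE; field.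
    lra.
  have h2 : c ^+ 2 * cg <= 1.
    have e1 : cg <= 1 by rewrite -(@expr_le1 _ 2) ?(ltW cg0).
    have e2 : c ^+ 2 <= 1 by rewrite expr_le1 ?(ltW cp).
    by rewrite mulr_ile1 ?sqr_ge0 ?(ltW cg0).
  by apply: mulr_ile1 => //; [exact: mulr_ge0 (sqr_ge0 _) (ltW cg0)|exact: ltW].
- have -> : E * (cg * x (- (s * gamma))) ^+ 2 =
    cg ^+ 2 * (x 1 * (x (- (s * gamma)) * x (- (s * gamma)))).
    by rewrite {1}EE -/(x 1); ring.
  rewrite /x !pD -/(x _).
  have h : x (1 + (- (s * gamma) - s * gamma)) <= 1 by apply: p1; lra.
  by rewrite mulr_ile1 ?sqr_ge0 ?(ltW (x0 _)).
- have -> : E ^+ 2 * E `^ (1 + 2 * eps) * (c * x (- s)) * (cg * x (- (s * gamma))) ^+ 2 =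
    c * cg ^+ 2 * (x 1 * x 1 * x (1 + 2 * eps) * x (- s) * (x (- (s * gamma)) * x (- (s * gamma)))).
    by rewrite {1}EE -/(x 1) -/(x (1 + 2 * eps)); ring.
  rewrite /x !pD -/(x _).
  have -> : 1 + 1 + (1 + 2 * eps) - s + (- (s * gamma) - s * gamma) = 0 by lra.
  by rewrite /x powRr0 mulr1 ler_piMr// ltW.
- have -> : E `^ (1 + 2 * eps) / (c * x (- s)) = E `^ (1 + 2 * eps) * x s / c.
    by rewrite /x powRN; field; rewrite cn gt_eqF// powR_gt0.
  rewrite /x expr2 !pD; congr (E `^ _ / c).
  by rewrite sd /rho1; field.
Qed.

(* The gradient terms have total weight [7 / 16] and are absorbed in the left-hand side. *)
Lemma absorb (C1 C2 l c E w delta p AR Y XR XW ZR ZW q P Q S CE1 CE2 r : R) :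
  0 < C1 -> 0 < C2 -> 0 < l -> 0 < c -> 1 <= E -> 0 < w -> 0 < delta ->
  c <= (24 * C1 * C2)^-1 -> E ^+ 2 * w * delta * p ^+ 2 <= c -> w / delta = r / c -> E <= r ->
  0 <= q -> 0 <= CE1 -> 0 <= CE2 ->
  0 <= AR -> 0 <= Y -> 0 <= XR -> 0 <= XW -> 0 <= ZR -> 0 <= ZW ->
  AR <= C1 * S + q * CE1 + (16 * E)^-1 * (XR + ZR) ->
  P <= q * CE2 + C2 / delta * Y + C2 * E * delta * p ^+ 2 * XW ->
  XR + XW + (ZR + ZW) <= 3 * E * (AR + Y) + (2 + E) * q ->
  Q <= l / 2 * (12 * C1 * l * E * Y + (12 * C1 * l * E)^-1 * XW) ->
  S <= w * P + Q ->
  AR + Y <= 2 * (1 + C1 * C2 / c + 6 * C1 ^+ 2 * l ^+ 2) * r * Y +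
    q * (2 * (C1 * w * CE2 + CE1 + 1)).
Proof.
move=> C10 C20 l0 cp E1 w0 dl0 cC h3 h4 Rg q0 CE10 CE20 n1 n2 n3 n4 n5 n6 K1 K2 K3 K4 K5.
have E0 : 0 < E by lra.
have [M Mdef] : exists M : R, M = XR + XW + (ZR + ZW) by eexists.
have M0 : 0 <= M by rewrite Mdef !addr_ge0.
have iE : 0 < E^-1 by rewrite invr_gt0.
have ME : M / E <= 3 * (AR + Y) + 3 * q.
  rewrite ler_pdivrMr//; rewrite Mdef; apply: le_trans K3 _.
  have : 0 <= (E - 1) * q by rewrite mulr_ge0// subr_ge0.
  lra.
(* The gradient term of the window: the scale of [delta] leaves the factor [C1 C2 c], at most 1/24
   by the choice of [c]. *)
have a1 : C1 * (w * (C2 * E * delta * p ^+ 2 * XW)) <= M / E / 24.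
  have -> : C1 * (w * (C2 * E * delta * p ^+ 2 * XW)) =
     (C1 * C2) * (E ^+ 2 * w * delta * p ^+ 2) * (XW / E).
    by field; rewrite gt_eqF.
  have b1 : (C1 * C2) * (E ^+ 2 * w * delta * p ^+ 2) <= 24^-1.
    have e1 : C1 * C2 * (24 * C1 * C2)^-1 = 24^-1 by field; rewrite !gt_eqF.
    rewrite -e1; apply: ler_wpM2l; first by rewrite mulr_ge0 ?ltW.
    exact: le_trans cC.
  have x0 : 0 <= XW / E by rewrite divr_ge0// ltW.
  apply: le_trans (ler_wpM2r x0 b1) _; rewrite mulrC; apply: ler_wpM2r => //.
  by apply: ler_wpM2r; [exact: ltW|rewrite Mdef; lra].
(* The gradient term of the plain trace: the weight [12 C1 l E] is such that exactly [XW / E / 24]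
   remains. *)
have a2 : C1 * Q <= 6 * C1 ^+ 2 * l ^+ 2 * E * Y + M / E / 24.
  apply: le_trans (ler_wpM2l (ltW C10) K4) _.
  have -> : C1 * (l / 2 * (12 * C1 * l * E * Y + (12 * C1 * l * E)^-1 * XW)) = 6 * C1 ^+ 2 * l ^+ 2 * E * Y + XW / E / 24.
    by field; rewrite !gt_eqF.
  rewrite lerD2l; apply: ler_wpM2r => //.
  by apply: ler_wpM2r; [exact: ltW|rewrite Mdef; lra].
have a3 : (16 * E)^-1 * (XR + ZR) <= M / E / 16.
  have -> : (16 * E)^-1 * (XR + ZR) = (XR + ZR) / E / 16 by field; rewrite gt_eqF.
  apply: ler_wpM2r => //; apply: ler_wpM2r; [exact: ltW|rewrite Mdef; lra].
have a4 : C1 * (w * P) <= C1 * w * CE2 * q + C1 * C2 / c * r * Y + M / E / 24.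
  have e0 : 0 <= C1 * w by rewrite mulr_ge0 ?ltW.
  rewrite mulrA; apply: le_trans (ler_wpM2l e0 K2) _.
  rewrite !mulrDr; apply: lerD; last by rewrite -[X in X <= _]mulrA.
  apply: lerD; first by rewrite le_eqVlt; apply/orP; left; apply/eqP; ring.
  rewrite le_eqVlt; apply/orP; left; apply/eqP.
  have -> : C1 * w * (C2 / delta * Y) = C1 * C2 * (w / delta) * Y by ring.
  by rewrite h4; ring.
have a5 : C1 * S <= C1 * (w * P) + C1 * Q by rewrite -mulrDr; apply: ler_wpM2l => //; exact: ltW.
have b1 : Y <= r * Y by rewrite ler_peMl//; lra.
have k0 : 0 <= 6 * C1 ^+ 2 * l ^+ 2.
  by apply: mulr_ge0 (sqr_ge0 l); exact: mulr_ge0 (sqr_ge0 C1).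
have k1 : 0 <= C1 * C2 / c by rewrite divr_ge0 ?mulr_ge0 ?ltW.
have b2 : 6 * C1 ^+ 2 * l ^+ 2 * E * Y <= 6 * C1 ^+ 2 * l ^+ 2 * (r * Y).
  by rewrite -mulrA; apply: ler_wpM2l => //; exact: ler_wpM2r.
have z2 : 0 <= C1 * w * CE2 * q by apply: mulr_ge0 => //; apply: mulr_ge0 => //; rewrite mulr_ge0 ?ltW.
have z3 : 0 <= q * CE1 by exact: mulr_ge0.
rewrite -[C1 * C2 / c * r * Y]mulrA in a4.
rewrite [leRHS](_ : _ = 2 * (r * Y) + 2 * (C1 * C2 / c * (r * Y)) +
  2 * (6 * C1 ^+ 2 * l ^+ 2 * (r * Y)) + 2 * (C1 * w * CE2 * q) + 2 * (q * CE1) + 2 * q); last by ring.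
have z0 : 0 <= r * Y by lra.
have b3 := mulr_ge0 k1 z0; have b4 := mulr_ge0 k0 z0.
move: (6 * C1 ^+ 2 * l ^+ 2 * E * Y) (6 * C1 ^+ 2 * l ^+ 2 * (r * Y)) (C1 * C2 / c * (r * Y)) a2 a4 b2 b3 b4.
move: (C1 * w * CE2 * q) (q * CE1) z2 z3 K1.
move: (C1 * S) (C1 * (w * P)) (C1 * Q) a5 => x1 x2 x3 a5 x4 x5 z2 z3 K1 x6 x7 x8 a2 a4 b2 b3 b4.
move: (M / E) ((16 * E)^-1 * (XR + ZR)) (r * Y) ME a3 K1 a2 a4 b1 z0 => m x9 z ME a3 K1 a2 a4 b1 z0.
lra.
Qed.

Lemma apriori : exists2 C, 0 < C & forall E, 1 <= E -> nonresonant B0 L0 c0 eps E ->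
  exists2 CE, 0 <= CE & forall phi eta, test_function D phi -> 0 <= eta ->
    near_solution B0 B1 L0 L E phi eta ->
    mass (- B0) B1 phi <= C * (E `^ rho1) ^+ 2 * mass 0 B1 phi + eta ^+ 2 * CE.
Proof.
have [C1 C10 HR] := rect_estimate.
have [d [C2 [d0 C20 HW]]] := window_estimate HL.
have g := profile_gamma HL.
pose c := Num.min (Num.min 1 (d / 2)) (24 * C1 * C2)^-1.
have CC0 : 0 < 24 * C1 * C2 by rewrite !mulr_gt0.
have cp : 0 < c by rewrite !lt_min ltr01 invr_gt0 CC0 divr_gt0.
have [c1 cd cC] : [/\ c <= 1, c <= d / 2 & c <= (24 * C1 * C2)^-1].
  by rewrite /c !ge_min !lexx ?orbT.
have T0 : 0 < 1 + C1 * C2 / c + 6 * C1 ^+ 2 * L0 ^+ 2.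
  rewrite -addrA addr_gt0// addr_gt0//; first by rewrite divr_gt0// mulr_gt0.
  by rewrite !mulr_gt0// exprn_gt0.
exists (2 * (1 + C1 * C2 / c + 6 * C1 ^+ 2 * L0 ^+ 2)); first exact: mulr_gt0.
move=> E E1 nr; have E0 : 0 < E by lra.
have [delta [/andP[dl0 dlc] h1 h2 h3 h4]] : exists delta : R,
  [/\ 0 < delta <= c, E * delta ^+ 2 * delta `^ gamma <= 1, E * (delta `^ gamma) ^+ 2 <= 1,
      E ^+ 2 * E `^ (1 + 2 * eps) * delta * (delta `^ gamma) ^+ 2 <= c &
      E `^ (1 + 2 * eps) / delta = (E `^ rho1) ^+ 2 / c].
  by apply: window_scale => //; rewrite cp.
have [K [CE1 [CE10 H1]]] := HR E E1 nr.
(* The propagating modes, for which the frequency [om] of the window multiplier is real and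
   positive. *)
pose r := [seq k <- index_iota 1 K.+1 | 0 < mode_energy L0 E k].
have ur : uniq r by rewrite filter_uniq// iota_uniq.
have pos (s : seq nat) : {subset s <= index_iota 1 K.+1} -> all (leq 1) s.
  by move=> sub; apply/allP => k /sub; rewrite mem_index_iota => /andP[].
have r1 : all (leq 1) r by apply: pos => k; rewrite mem_filter => /andP[].
have rE k : k \in r -> (k%:R * pi / L0) ^+ 2 < E.
  by rewrite mem_filter => /andP[]; rewrite /mode_energy subr_gt0.
have dd : 0 < delta < d by rewrite dl0; lra.
have [CE2 CE20 H2] := HW delta E r dd E0 h1 h2 ur r1 rE.
pose w := E `^ (1 + 2 * eps).
have w0 : 0 < w by exact: powR_gt0.
exists (2 * (C1 * w * CE2 + CE1 + 1)).
  apply: mulr_ge0 => //; apply: addr_ge0 => //; apply: addr_ge0 => //.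
  by apply: mulr_ge0 => //; exact: mulr_ge0 (ltW C10) (ltW w0).
move=> phi eta tp eta0 ns.
have K1 := H1 phi eta tp eta0 ns; have K2 := H2 phi eta tp eta0 ns.
have K3 := energy_bound (ltW E0) tp ns.
pose s := 12 * C1 * L0 * E; have s0 : 0 < s by rewrite !mulr_gt0.
have K4 := trace_bound tp s0 (iota_uniq 1 _) (pos _ (fun k h => h)).
(* The plain trace sum on the right runs over all modes, so [trace_bound] applies as it is; counting
   the propagating ones twice only enlarges the bound. *)
have K5 : \sum_(k <- index_iota 1 K.+1) mode_weight L0 eps E k * F k phi 0 ^+ 2 <=
    w * (\sum_(k <- r) F k phi 0 ^+ 2) + \sum_(k <- index_iota 1 K.+1) F k phi 0 ^+ 2.
  rewrite big_filter mulr_sumr [X in _ <= X + _]big_mkcond -big_split/=.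
  apply: ler_sum => k _; rewrite /mode_weight; case: ifP => _.
    by rewrite lerDl sqr_ge0.
  by rewrite mul1r add0r.
have c0' := test_continuous tp.
have k1 := test_continuous (test_derive tp (or_introl erefl)).
have k2 := test_continuous (test_derive tp (or_intror erefl)).
have A1 := mass_split c0'; have A2 := mass_split k1; have A3 := mass_split k2.
rewrite -/(mass 0 B1 phi) -/(mass 0 B1 ('D_dirx phi)) in K2.
have n1 := mass_ge0 (- B0) 0 phi; have n2 := mass_ge0 0 B1 phi.
have n3 := mass_ge0 (- B0) 0 ('D_dirx phi); have n4 := mass_ge0 0 B1 ('D_dirx phi).
have n5 := mass_ge0 (- B0) 0 ('D_diry phi); have n6 := mass_ge0 0 B1 ('D_diry phi).
have q0 : 0 <= eta ^+ 2 := sqr_ge0 _.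
rewrite A1; rewrite A1 A2 A3 in K3; rewrite -/w in h3 h4.
have Rg : E <= (E `^ rho1) ^+ 2.
  have -> : (E `^ rho1) ^+ 2 = E `^ (rho1 * 2) by rewrite powRrM (powR_mulrn 2) ?powR_ge0.
  rewrite -[leLHS](powRr1 (ltW E0)); apply: ler_powR => //.
  exact: rho1_ge.
rewrite /s in K4.
exact: (absorb C10 C20 L0_gt0 cp E1 w0 dl0 cC h3 h4 Rg q0 CE10 CE20 n1 n2 n3 n4 n5 n6 K1 K2 K3 K4 K5).
Qed.

End APriori.

(** * Eigenfunctions *)

Section Eigenfunctions.
Context {R : realType}.
Notation mR2 := (measurableTypeR R * measurableTypeR R)%type.

Lemma sqrtr_addr_le (a b : R) : 0 <= a -> 0 <= b ->
  Num.sqrt (a + b) <= Num.sqrt a + Num.sqrt b.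
Proof.
move=> a0 b0; have sa := sqrtr_ge0 a; have sb := sqrtr_ge0 b.
rewrite -(@ler_pXn2r _ 2) ?nnegrE ?sqrtr_ge0 ?addr_ge0//.
rewrite sqr_sqrtr ?addr_ge0// sqrrD !sqr_sqrtr//.
by rewrite addrAC lerDl mulrn_wge0// mulr_ge0.
Qed.

(** Limit [eta -> 0] in [apriori] at fixed [E]. It is taken for the norms and not for their squares,
    because the approximation errors are additive in the norms. *)
Lemma eigen_bound (B0 B1 L0 cL gamma : R) (L : R -> R) (c0 eps : R) :
  billiard_profile B0 B1 L0 cL gamma L -> 0 < c0 -> 0 <= eps ->
  exists2 C, 0 < C & forall (E : R) (f : R * R -> R), 1 <= E -> nonresonant B0 L0 c0 eps E ->
    in_H10 (billiard B0 B1 L) f -> helmholtz (billiard B0 B1 L) E f ->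
    ip (billiard B0 B1 L) f f <= C * (E `^ rho1 gamma eps) ^+ 2 * ip (wing B0 B1 L0 L) f f.
Proof.
move=> HL c00 eps0; have [C C0 HC] := apriori HL c00 eps0.
exists C => // E f E1 nr fH fE.
have [CE CE0 HCE] := HC E E1 nr.
pose K := C * (E `^ rho1 gamma eps) ^+ 2; rewrite -/K in HCE *.
have K0 : 0 <= K by rewrite mulr_ge0 ?sqr_ge0// ltW.
have A0 := ip_ge0 (billiard B0 B1 L) f; have Y0 := ip_ge0 (wing B0 B1 L0 L) f.
suff H : Num.sqrt (ip (billiard B0 B1 L) f f) <= Num.sqrt K * Num.sqrt (ip (wing B0 B1 L0 L) f f).
  have KY := mulr_ge0 K0 Y0.
  by move: H; rewrite -(sqrtrM _ K0) ler_psqrt.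
apply/ler_addgt0Pr => e e0.
(* The three errors in units of [eta]: approximation on the wing, the term [eta^2 CE], and
   approximation on the table. *)
pose T := Num.sqrt K + Num.sqrt CE + 1.
have T0 : 0 < T by rewrite ltr_wpDl// addr_ge0 ?sqrtr_ge0.
have eta0 : 0 < e / T by exact: divr_gt0.
have [phi [tp a1 _ a3 ns]] := eigen_approx HL (le_trans ler01 E1) fH fE eta0.
have := HCE phi (e / T) tp (ltW eta0) ns.
rewrite -(ip_mass HL tp) /mass -(ip_wing_test HL tp) => H.
have P0 := ip_ge0 (wing B0 B1 L0 L) phi.
have eE : e = e / T * T by rewrite divfK// gt_eqF.
rewrite [X in _ <= _ + X]eE.
move: (e / T) eta0 a1 a3 H => eta eta0 a1 a3 H.
have h1 : Num.sqrt (ip (billiard B0 B1 L) phi phi) <=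
    Num.sqrt K * Num.sqrt (ip (wing B0 B1 L0 L) phi phi) + eta * Num.sqrt CE.
  apply: le_trans (ler_wsqrtr H) _.
  apply: le_trans (sqrtr_addr_le _ _) _; [exact: mulr_ge0|by rewrite mulr_ge0 ?sqr_ge0|].
  by rewrite sqrtrM// [Num.sqrt (eta ^+ 2 * CE)]sqrtrM ?sqr_ge0// sqrtr_sqr gtr0_norm.
have h2 := ler_wpM2l (sqrtr_ge0 K) a3.
rewrite /T; move: (Num.sqrt (ip _ f f)) (Num.sqrt (ip _ phi phi)) a1 h1.
move: (Num.sqrt (ip _ phi phi)) (Num.sqrt (ip _ f f)) h2 => y1 y2 h2 x1 x2 a1 h1.
rewrite !mulrDr in h2 *; rewrite mulr1 [eta * Num.sqrt K]mulrC; lra.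
Qed.

Variables (D : set (R * R)) (mD : measurable (D : set mR2)).

Lemma normc_sqr (z : R[i]) : ComplexField.Normc.normc z ^+ 2 =
  complex.Re z ^+ 2 + complex.Im z ^+ 2.
Proof. by case: z => a b /=; rewrite sqr_sqrtr// addr_ge0// sqr_ge0. Qed.

Lemma normc_sq_integrable (u : R * R -> R[i]) :
  sq_integrable D (Re_fun u) -> sq_integrable D (Im_fun u) ->
  sq_integrable D (fun z => ComplexField.Normc.normc (u z)).
Proof.
move=> [m1 i1] [m2 i2]; split.
  have -> : (fun z => ComplexField.Normc.normc (u z)) =
      (fun z => Num.sqrt (Re_fun u z ^+ 2 + Im_fun u z ^+ 2)).
    by apply/funext => z; rewrite /Re_fun /Im_fun; case: (u z).
  apply: (measurableT_comp (f := @Num.sqrt R)).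
    by apply: continuous_measurable_fun; exact: sqrt_continuous.
  by apply: measurable_funD; apply: measurable_funX.
have -> : EFin \o (fun z => ComplexField.Normc.normc (u z) ^+ 2) =
   ((EFin \o (fun z => (Re_fun u z ^+ 2)%R)) \+ (EFin \o (fun z => (Im_fun u z ^+ 2)%R)))%E.
  by apply/funext => z /=; rewrite normc_sqr.
exact: integrableD.
Qed.

Lemma ip_normc (u : R * R -> R[i]) :
  sq_integrable D (Re_fun u) -> sq_integrable D (Im_fun u) ->
  ip D (fun z => ComplexField.Normc.normc (u z)) (fun z => ComplexField.Normc.normc (u z)) =
  ip D (Re_fun u) (Re_fun u) + ip D (Im_fun u) (Im_fun u).
Proof.
move=> s1 s2; rewrite -RintegralD//; [|exact: ip_integrable|exact: ip_integrable].
by apply: eq_Rintegral => z _; rewrite -expr2 normc_sqr !expr2.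
Qed.

End Eigenfunctions.

Theorem theorem2 (R : realType) (B0 B1 L0 cL gamma : R) (L : R -> R)
    (HL : billiard_profile B0 B1 L0 cL gamma L)
    (c0 : R) (c0_gt0 : 0 < c0) (Z0_neq0 : nonresonant B0 L0 c0 0 !=set0)
    (eps : R) (eps_ge0 : 0 <= eps) :
  exists E0 C : R,
    forall (E : R) (u : R * R -> R[i]),
      nonresonant B0 L0 c0 eps E -> E0 < E ->
      dirichlet_eigenfunction (billiard B0 B1 L) E u ->
      (L2normC (billiard B0 B1 L) u <=
         (C * E `^ rho gamma eps)%:E * L2normC (wing B0 B1 L0 L) u)%E.
Proof.
have [C C0 HC] := eigen_bound HL c0_gt0 eps_ge0.
(* [C] bounds squared norms, hence the square root. Real and imaginary parts are bounded separately
   with the same constant, and their squared norms add up to that of [u]. *)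
exists 1, (Num.sqrt C) => E u nr E1 [[H1 H2] [e1 e2] _].
have b1 := HC E _ (ltW E1) nr H1 e1; have b2 := HC E _ (ltW E1) nr H2 e2.
have mD := billiard_measurable HL; have mW := wing_measurable HL.
have s1 := in_L2_sq_integrable H1.1; have s2 := in_L2_sq_integrable H2.1.
have w1 := sq_integrable_wing HL s1; have w2 := sq_integrable_wing HL s2.
rewrite /L2normC (sq_integrable_L2norm mD (normc_sq_integrable mD s1 s2)).
rewrite (sq_integrable_L2norm mW (normc_sq_integrable mW w1 w2)) -EFinM lee_fin.
rewrite (ip_normc mD s1 s2) (ip_normc mW w1 w2).
have Y0 := addr_ge0 (ip_ge0 (wing B0 B1 L0 L) (Re_fun u)) (ip_ge0 (wing B0 B1 L0 L) (Im_fun u)).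
have P0 : 0 <= E `^ rho1 gamma eps by exact: powR_ge0.
have rr : E `^ rho1 gamma eps <= E `^ rho gamma eps.
  by apply: ler_powR; [exact: ltW|rewrite /rho /rho1 le_max lexx].
have b3 := lerD b1 b2; rewrite -mulrDr in b3.
apply: le_trans (ler_wsqrtr b3) _.
rewrite sqrtrM ?mulr_ge0 ?sqr_ge0 ?(ltW C0)// sqrtrM ?(ltW C0)// sqrtr_sqr (ger0_norm P0).
apply: ler_wpM2r; first exact: sqrtr_ge0.
by apply: ler_wpM2l => //; exact: sqrtr_ge0.
Qed.
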